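(* Let $n\ge 1$, $K=\mathbb C[\epsilon,\epsilon^{-1}]$, let $\mathcal A=\mathcal A^{\mathrm{pol}}_{2n}$ be the polynomial Weyl algebra over $K$, and let $\tau_{2n}:\mathcal A^{\otimes(2n+1)}\to K$ be the $K$-linear map $$\tau_{2n}(a)=\mu_{2n}\int_{\Delta_{2n}}\prod_{0\le i<j\le 2n}e^{\epsilon(2u_i-2u_j+1)\alpha_{ij}}\,\pi_{2n}(a)\,du_1\wedge\cdots\wedge du_{2n},\qquad u_0=0 .$$ Then: (i) $\tau_{2n}$ is an $\mathfrak{sp}_{2n}(\mathbb C)$-invariant cocycle in the normalized Hochschild cochain complex $\bar C^{2n}(\mathcal A)=\mathrm{Hom}_K(\mathcal A\otimes(\mathcal A/K1)^{\otimes 2n},K)$; that is, $\tau_{2n}$ vanishes if one of its last $2n$ arguments is in $K1$, $\tau_{2n}\circ d_{\mathrm{Hoch}}=0$ on $\mathcal A^{\otimes (2n+2)}$, and $$\sum_{i=0}^{2n}\tau_{2n}(a_0\otimes\cdots\otimes[a,a_i]_\epsilon\otimes\cdots\otimes a_{2n})=0$$ for all $a\in\mathfrak{sp}_{2n}(\mathbb C)\subset\mathcal A$ and all $a_0,\dots,a_{2n}\in\mathcal A$. (ii) $\tau_{2n}(c_{2n})=1$, where $c_{2n}=\sum_{\sigma\in S_{2n}}\mathrm{sign}(\sigma)\,1\otimes y_{\sigma(1)}\otimes\cdots\otimes y_{\sigma(2n)}$. (iii) If $a\in\mathfrak{sp}_{2n}(\mathbb C)$, then for all $a_0,\dots,a_{2n-1}\in\mathcal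 A$ $$\sum_{i=1}^{2n}(-1)^i\,\tau_{2n}(a_0\otimes a_1\otimes\cdots\otimes a_{i-1}\otimes a\otimes a_i\otimes\cdots\otimes a_{2n-1})=0 .$$
   Context: Weyl algebra: $\mathcal A=\mathcal A^{\mathrm{pol}}_{2n}$ is $K[p_1,\dots,p_n,q_1,\dots,q_n]$ with the Moyal product $f\star g=m(\exp(\epsilon\alpha)(f\otimes g))$, where $m(f\otimes g)=fg$ is the commutative product and $\alpha=\frac12\sum_{i=1}^n(\partial_{p_i}\otimes\partial_{q_i}-\partial_{q_i}\otimes\partial_{p_i})$. Set $[f,g]_\epsilon=\frac1\epsilon(f\star g-g\star f)$. Put $y_{2i-1}=p_i$, $y_{2i}=q_i$. $\mathfrak{sp}_{2n}(\mathbb C)\subset\mathcal A$ denotes the Lie algebra (for $[\,,]_\epsilon$) of homogeneous quadratic polynomials in the $y_i$ with coefficients in $\mathbb C$. All tensor products are over $K$. Hochschild differential: $d_{\mathrm{Hoch}}(a_0\otimes\cdots\otimes a_k)=a_0\star a_1\otimes a_2\otimes\cdots\otimes a_k+\sum_{j=1}^{k-1}(-1)^ja_0\otimes\cdots\otimes a_j\star a_{j+1}\otimes\cdots\otimes a_k+(-1)^ka_k\star a_0\otimes a_1\otimes\cdots\otimes a_{k-1}$. Ingredients of $\tau_{2n}$: $\Delta_{2n}=\{0\le u_1\le\cdots\le u_{2n}\le1\}\subset\mathbb R^{2n}$ with standard orientation. The slots of $\mathcal A^{\otimes(2n+1)}$ are numbered $0,\dots,2n$; for $i\ne j$, $\alpha_{ij}$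 is the endomorphism of $\mathcal A^{\otimes(2n+1)}$ given by $\frac12\sum_{r=1}^n\big(\partial_{p_r}^{(i)}\partial_{q_r}^{(j)}-\partial_{q_r}^{(i)}\partial_{p_r}^{(j)}\big)$, where the superscript $(i)$ means acting on the $i$-th tensor factor. These endomorphisms commute. $\pi_{2n}(a_0\otimes\cdots\otimes a_{2n})=\sum_{\sigma\in S_{2n}}\mathrm{sign}(\sigma)\,a_0\otimes\partial_{y_{\sigma(1)}}a_1\otimes\cdots\otimes\partial_{y_{\sigma(2n)}}a_{2n}$. $\mu_{2n}(a_0\otimes\cdots\otimes a_{2n})=a_0(0)\cdots a_{2n}(0)\in K$, where $a(0)$ is the constant term of $a$ as a polynomial in $p,q$. The exponentials are expanded in Taylor series (only finitely many terms contribute) and integrated term by term. *)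

(* Defs.v *)
From HB Require Import structures.
From mathcomp Require Import all_boot all_order all_algebra all_fingroup.
From mathcomp Require Import zify.
From mathcomp Require Import ssrcomplements mpoly complex.
From mathcomp Require Import boolp classical_sets functions cardinality fsbigop.
From mathcomp Require Import reals ereal measure lebesgue_measure.
From mathcomp Require Import lebesgue_integral.

Set Implicit Arguments.
Unset Strict Implicit.
Unset Printing Implicit Defensive.

Import Order.TTheory GRing.Theory Num.Theory.
Local Open Scope classical_set_scope.
Local Open Scope ring_scope.

(* Laurent polynomials, as the subring of the field of fractions of F[X]
   whose elements have the form p / X^k. *)
Section Laurent.
Variable F : fieldType.

Definition laurent_pred : {pred {fraction {poly F}}} :=
  fun x => `[< exists p k, x = FracField.tofrac p / FracField.tofrac 'X ^+ k >].

Lemma laurent_subring : subring_closed laurent_pred.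
Proof.
have X0 : FracField.tofrac ('X : {poly F}) != 0.
  by rewrite tofrac_eq0 polyX_eq0.
split.
- by apply/asboolP; exists 1, 0%N; rewrite tofrac1 expr0 divr1.
- move=> _ _ /asboolP[p [k ->]] /asboolP[q [l ->]]; apply/asboolP.
  exists (p * 'X ^+ l - q * 'X ^+ k), (k + l)%N.
  rewrite tofracB !tofracM !tofracXn exprD mulrBl invfM; congr (_ - _).
    by rewrite mulrACA divff ?expf_neq0// mulr1.
  by rewrite [_^-1 * _]mulrC mulrACA divff ?expf_neq0// mulr1.
- move=> _ _ /asboolP[p [k ->]] /asboolP[q [l ->]]; apply/asboolP.
  by exists (p * q), (k + l)%N; rewrite tofracM exprD invfM mulrACA.
Qed.

HB.instance Definition _ :=
  GRing.isSubringClosed.Build {fraction {poly F}} laurent_pred laurent_subring.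

Record laurent := Laurent {
  laurent_val :> {fraction {poly F}};
  _ : laurent_val \in laurent_pred }.

HB.instance Definition _ := [isSub for laurent_val].
HB.instance Definition _ := [Choice of laurent by <:].
HB.instance Definition _ := [SubChoice_isSubComNzRing of laurent by <:].


Definition lunit : pred laurent :=
  fun x => (x != 0) && ((val x)^-1 \in laurent_pred).
Definition linv (x : laurent) : laurent := insubd x (val x)^-1.

Fact mul_linv : {in lunit, left_inverse 1 linv *%R}.
Proof.
move=> x /andP[x0 xV]; apply: val_inj.
have xE : val (linv x) = (val x)^-1 by exact: insubdK.
have v0 : val x != 0 :> {fraction {poly F}}.
  by apply: contra x0 => /eqP x0; apply/eqP/val_inj.
rewrite [LHS]/= [X in X * _]xE; exact: mulVf.
Qed.

Fact lunitPl (x y : laurent) : y * x = 1 -> lunit x.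
Proof.
move=> /(congr1 val) /= yx1.
have x0 : val x != 0 :> {fraction {poly F}}.
  by apply: contra_eq_neq yx1 => ->; rewrite mulr0 eq_sym oner_neq0.
apply/andP; split; first by apply: contra_neq x0 => ->.
by rewrite -[_^-1]mul1r -yx1 mulfK//; exact: valP.
Qed.

Fact linv_out : {in [predC lunit], linv =1 id}.
Proof.
move=> x; rewrite !inE negb_and negbK => /orP[/eqP ->|xV].
  by apply: val_inj; rewrite val_insubd /= invr0 if_same.
by apply: val_inj; rewrite val_insubd (negPf xV).
Qed.

HB.instance Definition _ := GRing.ComNzRing_hasMulInverse.Build laurent
  mul_linv lunitPl linv_out.

Fact lconst_subproof (c : F) : FracField.tofrac c%:P \in laurent_pred.
Proof. by apply/asboolP; exists c%:P, 0%N; rewrite expr0 divr1. Qed.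
Definition lconst (c : F) : laurent := Laurent (lconst_subproof c).

Fact leps_subproof : FracField.tofrac ('X : {poly F}) \in laurent_pred.
Proof. by apply/asboolP; exists 'X, 0%N; rewrite expr0 divr1. Qed.
Definition leps : laurent := Laurent leps_subproof.

Lemma leps_unit : leps \is a GRing.unit.
Proof.
have X0 : FracField.tofrac ('X : {poly F}) != 0.
  by rewrite tofrac_eq0 polyX_eq0.
apply/andP; split; first by apply: contra_neq X0 => /(congr1 val).
by apply/asboolP; exists 1, 1%N; rewrite tofrac1 div1r expr1.
Qed.

Fact lconst_is_zmod_morphism : zmod_morphism lconst.
Proof. by move=> x y; apply: val_inj; rewrite /= polyCB tofracB. Qed.
Fact lconst_is_monoid_morphism : monoid_morphism lconst.
Proof.
split; first by apply: val_inj; rewrite /= polyC1 tofrac1.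
by move=> x y; apply: val_inj; rewrite /= polyCM tofracM.
Qed.
HB.instance Definition _ :=
  GRing.isZmodMorphism.Build F laurent lconst lconst_is_zmod_morphism.
HB.instance Definition _ :=
  GRing.isMonoidMorphism.Build F laurent lconst lconst_is_monoid_morphism.

End Laurent.
Arguments leps {F}.

(* The m-th tensor power of K[y_0, ..., y_(d-1)] over K is modelled by the
   polynomial ring in the m * d variables y^(i)_j = 'X_(mxvec_index i j), with
   i < m the slot and j < d; a pure tensor is the product of its factors, each
   written in the variables of its own slot. *)
Section TensorPower.
Variable K : comNzRingType.

Definition tens m d (a : 'I_m -> {mpoly K[d]}) : {mpoly K[m * d]} :=
  \prod_(i < m) (a i \mPo [tuple 'X_(mxvec_index i j) | j < d]).

(* the multiplication map a_0 (x) ... (x) a_(m-1) |-> a_0 ... a_(m-1) *)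
Definition tmul m d (t : {mpoly K[m * d]}) : {mpoly K[d]} :=
  t \mPo [tuple mxvec (\matrix_(i < m, j < d) 'X_j) ord0 k | k < m * d].

Definition tderiv m d (i : 'I_m) (j : 'I_d) (t : {mpoly K[m * d]}) :=
  t^`M(mxvec_index i j).

Definition slot_mnm m d (u : 'X_{1..m * d}) (i : 'I_m) : 'X_{1..d} :=
  [multinom u (mxvec_index i j) | j < d].

(* the linear map that agrees with phi on pure tensors of monomials *)
Definition tlift m d (V : lmodType K) (phi : ('I_m -> {mpoly K[d]}) -> V)
    (t : {mpoly K[m * d]}) : V :=
  \sum_(u <- msupp t) t@_u *: phi (fun i => 'X_[slot_mnm u i]).

Definition upd (T : Type) m (a : 'I_m -> T) (i : 'I_m) (x : T) : 'I_m -> T :=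
  fun k => if k == i then x else a k.

(* a_0, ..., a_(i-1), x, a_i, ..., a_(m-1) *)
Definition ins (T : Type) m (a : 'I_m -> T) (i : 'I_m.+1) (x : T) :
    'I_m.+1 -> T := fun k => oapp a x (unlift i k).

Definition multilin m (U V : lmodType K) (phi : ('I_m -> U) -> V) :=
  forall a i c x y,
    phi (upd a i (c *: x + y)) = c *: phi (upd a i x) + phi (upd a i y).

Lemma updE T m (a : 'I_m -> T) i : upd a i (a i) = a.
Proof. by apply/funext => k; rewrite /upd; case: eqP => [->|]. Qed.

Lemma tens_multilin m d : multilin (@tens m d).
Proof.
move=> a i c x y;
pose y_ k := [tuple 'X_(mxvec_index k j) : {mpoly K[m * d]} | j < d].
have E z : tens (upd a i z) = (z \mPo y_ i) * \prod_(k | k != i) (a k \mPo y_ k).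
  rewrite /tens (bigD1 i)//= {1}/upd eqxx; congr (_ * _).
  by apply: eq_bigr => k /negPf ki; rewrite /upd ki.
by rewrite !E comp_mpolyD comp_mpolyZ mulrDl -scalerAl.
Qed.

Lemma tens_mnm m d (f : 'I_m -> 'X_{1..d}) (u : 'X_{1..m * d}) :
  (forall i, slot_mnm u i = f i) ->
  tens (fun i => 'X_[f i]) = 'X_[u] :> {mpoly K[m * d]}.
Proof.
move=> uf; rewrite /tens mpolyXE_id (reindex _ (curry_mxvec_bij m d)) /=.
rewrite (eq_bigr (fun p => 'X_(mxvec_index p.1 p.2) ^+ u (mxvec_index p.1 p.2)));
  last by case.
rewrite -(pair_bigA _ (fun i j => 'X_(mxvec_index i j) ^+ u (mxvec_index i j))) /=.
apply: eq_bigr => i _; rewrite comp_mpolyX; apply: eq_bigr => j _.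
by rewrite tnth_mktuple -uf mnmE.
Qed.

Lemma tlift_linear m d (V : lmodType K) (phi : ('I_m -> {mpoly K[d]}) -> V) :
  linear (tlift phi).
Proof.
pose h u := phi (fun i => 'X_[slot_mnm u i]).
have E w t : (msize t <= w)%N ->
    tlift phi t = \sum_(u : 'X_{1..(m * d) < w}) t@_u *: h u.
  move=> tw; pose I : subFinType _ := 'X_{1..(m * d) < w}.
  rewrite /tlift (big_mksub I) ?msupp_uniq//=; first last.
    by move=> u /msize_mdeg_lt /leq_trans; apply.
  by rewrite big_rmcond// => u /memN_msupp_eq0 ->; rewrite scale0r.
move=> c s t; pose w := maxn (msize (c *: s + t)) (maxn (msize s) (msize t)).
rewrite !(E w) ?leq_max ?leqnn ?orbT// scaler_sumr -big_split /=.
by apply: eq_bigr => u _; rewrite mcoeffD mcoeffZ scalerDl scalerA.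
Qed.

Lemma tlift_tens m d (V : lmodType K) (phi : ('I_m -> {mpoly K[d]}) -> V) a :
  multilin phi -> tlift phi (tens a) = phi a.
Proof.
move=> phiL; pose L := GRing.isLinear.Build _ _ _ _ _ (tlift_linear phi).
pose T : {linear {mpoly K[m * d]} -> V} := HB.pack (tlift phi) L.
have TE t : tlift phi t = T t by [].
have base f : tlift phi (tens (fun i => 'X_[f i])) = phi (fun i => 'X_[f i]).
  pose u : 'X_{1..m * d} :=
    [multinom f (enum_val (cast_ord (esym (mxvec_cast m d)) k)).1
                (enum_val (cast_ord (esym (mxvec_cast m d)) k)).2 | k < m * d].
  have uf i : slot_mnm u i = f i.
    by apply/mnmP => j; rewrite !mnmE cast_ordK enum_rankK.
  rewrite (tens_mnm uf) /tlift msuppX big_seq1 mcoeffX eqxx scale1r.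
  by congr phi; apply/funext => i; rewrite uf.
have step k : (k <= m)%N -> forall b : 'I_m -> {mpoly K[d]},
    (forall i : 'I_m, (k <= i)%N -> exists v, b i = 'X_[v]) ->
    tlift phi (tens b) = phi b.
  elim: k => [_ b bX|k IH km b bX].
    have [f bf] := choice (fun i => bX i (leq0n _)).
    by rewrite (_ : b = fun i => 'X_[f i]); [exact: base|apply/funext].
  pose ik := Ordinal km; rewrite -[b](updE _ ik).
  have: forall q, tlift phi (tens (upd b ik q)) = phi (upd b ik q).
    have mono v : tlift phi (tens (upd b ik 'X_[v])) = phi (upd b ik 'X_[v]).
      apply: IH => [|i ki]; first exact: ltnW.
      rewrite /upd; case: eqP => [_|/eqP ik']; first by exists v.
      apply: bX; rewrite ltn_neqAle ki andbT.
      by apply: contra ik' => /eqP kE; apply/eqP/val_inj; rewrite /= -kE.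
    have zero : tlift phi (tens (upd b ik 0)) = phi (upd b ik 0).
      have := phiL b ik (-1) 0 0; have := tens_multilin b ik (-1) 0 0.
      rewrite !scaler0 !addr0 !scaleN1r !addNr => -> ->.
      by rewrite TE raddf0.
    elim/mpolyind => [//|c v q _ _ IHq].
    by rewrite tens_multilin phiL TE linearP -!TE IHq mono.
  exact.
by apply: (step m) => // i; rewrite leqNgt ltn_ord.
Qed.

Lemma multilin_eq m d (V : lmodType K) (phi psi : ('I_m -> {mpoly K[d]}) -> V) :
  multilin phi -> multilin psi ->
  (forall f : 'I_m -> 'X_{1..d},
    phi (fun i => 'X_[f i]) = psi (fun i => 'X_[f i])) -> phi =1 psi.
Proof.
move=> phiL psiL E a; rewrite -(tlift_tens _ phiL) -(tlift_tens _ psiL).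
by apply: eq_bigr => u _; rewrite E.
Qed.

Lemma tmul_tens m d (a : 'I_m -> {mpoly K[d]}) :
  tmul (tens a) = \prod_(i < m) a i.
Proof.
rewrite /tmul /tens rmorph_prod; apply: eq_bigr => i _ /=.
rewrite [X in X \mPo _]comp_mpolyEX raddf_sum /= [RHS]mpolyE.
apply: eq_bigr => u _; rewrite comp_mpolyZ comp_mpolyX rmorph_prod /=.
rewrite [in RHS]mpolyXE_id; congr (_ *: _); apply: eq_bigr => j _.
by rewrite rmorphXn /= tnth_mktuple comp_mpolyXU -tnth_nth tnth_mktuple mxvecE mxE.
Qed.

Lemma mcoeff0_tens m d (a : 'I_m -> {mpoly K[d]}) :
  (tens a)@_0%MM = \prod_(i < m) (a i)@_0%MM.
Proof.
have E N (p : {mpoly K[N]}) : p@_0%MM = p.@[fun=> 0].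
  rewrite mevalE; have [u0|u0] := boolP (0%MM \in msupp p).
    rewrite (bigD1_seq 0%MM)//= [X in _ + X]big1 ?addr0.
      by rewrite big1 ?mulr1// => i _; rewrite mnm0E expr0.
    move=> u un0; have [i ui] : exists i, u i != 0%N.
      apply/existsP; apply: contraR un0 => /existsPn ui0.
      by apply/eqP/mnmP => i; rewrite mnm0E; apply/eqP/negPn/ui0.
    by rewrite (bigD1 i)//= expr0n (negPf ui) mul0r mulr0.
  rewrite (memN_msupp_eq0 u0) big_seq big1// => u up.
  have [i ui] : exists i, u i != 0%N.
    apply/existsP; apply: contraR u0 => /existsPn ui0.
    rewrite (_ : 0%MM = u)//; apply/mnmP => i; rewrite mnm0E.
    by apply/esym/eqP/negPn/ui0.
  by rewrite (bigD1 i)//= expr0n (negPf ui) mul0r mulr0.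
rewrite E /tens rmorph_prod; apply: eq_bigr => i _ /=.
rewrite comp_mpoly_meval E; apply: meval_eq => j.
by rewrite tnth_mktuple mevalXU.
Qed.

Lemma tderiv_tens m d (a : 'I_m -> {mpoly K[d]}) i j :
  tderiv i j (tens a) = tens (upd a i (a i)^`M(j)).
Proof.
move: a; apply: multilin_eq.
- move=> a k c x y.
  by rewrite /tderiv tens_multilin mderivD mderivZ.
- move=> a k c x y; have [<-|ki] := eqVneq k i.
    have E z : upd (upd a k z) k (upd a k z k)^`M(j) = upd a k z^`M(j).
      by apply/funext => s; rewrite /upd eqxx; case: eqP.
    by rewrite !E mderivD mderivZ tens_multilin.
  have E z : upd (upd a k z) i (upd a k z i)^`M(j) = upd (upd a i (a i)^`M(j)) k z.
    apply/funext => s; rewrite /upd [i == k]eq_sym (negPf ki).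
    by case: (eqVneq s i) => [->|//]; rewrite eq_sym (negPf ki).
  by rewrite !E tens_multilin.
move=> f.
pose u (g : 'I_m -> 'X_{1..d}) : 'X_{1..m * d} :=
  [multinom g (enum_val (cast_ord (esym (mxvec_cast m d)) k)).1
              (enum_val (cast_ord (esym (mxvec_cast m d)) k)).2 | k < m * d].
have uE g s t : u g (mxvec_index s t) = g s t.
  by rewrite mnmE cast_ordK enum_rankK.
have uf g s : slot_mnm (u g) s = g s.
  by apply/mnmP => t; rewrite mnmE uE.
rewrite (tens_mnm (uf f)) /tderiv mderivX uE mderivX.
rewrite -[X in upd _ _ X]addr0 tens_multilin.
rewrite [X in _ + X](_ : _ = 0) ?addr0; last first.
  by rewrite /tens (bigD1 i)//= /upd eqxx comp_mpoly0 mul0r.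
have -> : upd (fun s => 'X_[f s]) i 'X_[f i - U_(j)] =
    fun s => 'X_[upd f i (f i - U_(j))%MM s] :> {mpoly K[d]}.
  by apply/funext => s; rewrite /upd; case: eqP.
rewrite (tens_mnm (uf _)); congr (_ *: 'X_[_]); apply/mnmP => k.
case: (mxvec_indexP k) => s t; rewrite mnmBE mnm1E !uE /upd.
have -> : (mxvec_index i j == mxvec_index s t) = (s == i) && (j == t).
  apply/eqP/andP => [/(congr1 (fun k => enum_val (cast_ord (esym (mxvec_cast m d)) k)))|].
    by rewrite /mxvec_index !cast_ordK !enum_rankK => -[-> ->].
  by move=> [/eqP -> /eqP ->].
by case: eqVneq => [->|_] /=; rewrite ?subn0// mnmBE mnm1E.
Qed.

End TensorPower.

(* Lebesgue measure on R^m, with R^(m+1) identified with R * R^m through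
   (x, u) |-> x :: u. *)
Section LebesgueTuple.
Variable R : realType.
Local Notation RT := (measurableTypeR R).

Definition tcons m (p : RT * m.-tuple RT) : m.+1.-tuple RT :=
  [tuple of p.1 :: p.2].

Fixpoint lebesgue_tuple m : set (m.-tuple RT) -> \bar R :=
  match m with
  | 0 => \d_ [tuple]
  | m'.+1 => pushforward (lebesgue_measure \x @lebesgue_tuple m')%E (@tcons m')
  end.

Lemma measurable_tcons m : measurable_fun setT (@tcons m).
Proof. exact: measurable_cons. Qed.

Section Step.
Variables (m : nat) (mu : {sigma_finite_measure set (m.-tuple RT) -> \bar R}).

Let step := pushforward (lebesgue_measure \x mu)%E (@tcons m).

Let mcons A : measurable A -> measurable (@tcons m @^-1` A).
Proof. by move=> mA; rewrite -[X in measurable X]setTI; exact: measurable_tcons. Qed.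

Let step0 : step set0 = 0%E.
Proof. by rewrite /step /pushforward preimage_set0 measure0. Qed.

Let step_ge0 A : (0 <= step A)%E.
Proof. by rewrite /step /pushforward; exact: integral_ge0. Qed.

Let step_sigma_additive : semi_sigma_additive step.
Proof.
move=> F mF tF mUF; rewrite /step /pushforward preimage_bigcup.
apply: measure_semi_sigma_additive.
- by move=> k; exact: mcons.
- apply/trivIsetP => /= i j _ _ ij; rewrite -preimage_setI.
  by move/trivIsetP : tF => /(_ _ _ _ _ ij) ->//; rewrite preimage_set0.
- by rewrite -preimage_bigcup; exact: mcons.
Qed.

HB.instance Definition _ :=
  isMeasure.Build _ _ _ step step0 step_ge0 step_sigma_additive.

Let step_sigma_finite : sigma_finite setT step.
Proof.
have /sigma_finiteP[F [FT Fnd Fm]] := sigma_finiteT (@lebesgue_measure R).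
have /sigma_finiteP[G [GT Gnd Gm]] := sigma_finiteT mu.
exists (fun k => [set w : m.+1.-tuple RT |
                   F k (thead w) /\ G k [tuple of behead w]]).
  apply/seteqP; split=> // w _.
  have [i _ Fi] : (\bigcup_i F i) (thead w) by rewrite -FT.
  have [j _ Gj] : (\bigcup_i G i) [tuple of behead w] by rewrite -GT.
  exists (maxn i j) => //=; split.
    by move: (thead w) Fi; apply/subsetPset/Fnd; rewrite leq_maxl.
  by move: [tuple of behead w] Gj; apply/subsetPset/Gnd; rewrite leq_maxr.
move=> k; split.
  rewrite [X in measurable X](_ : _ =
    (fun w : m.+1.-tuple RT => tnth w ord0) @^-1` F k `&`
    (fun w : m.+1.-tuple RT => [tuple of behead w]) @^-1` G k)//.
  apply: measurableI; rewrite -[X in measurable X]setTI.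
    by apply: measurable_tnth => //; case: (Fm k).
  by apply: measurable_behead => //; case: (Gm k).
have [[mF Foo] [mG Goo]] := (Fm k, Gm k).
rewrite /step /pushforward [X in product_measure1 _ _ X](_ : _ = F k `*` G k).
  by rewrite product_measure1E// lte_mul_pinfty// ge0_fin_numE.
apply/seteqP; split=> -[x u] /= []; rewrite theadE.
  by move=> Fx Gu; split=> //; congr (G k) : Gu; apply/val_inj.
by move=> Fx Gu; split=> //; congr (G k) : Gu; apply/val_inj.
Qed.

HB.instance Definition _ :=
  Measure_isSigmaFinite.Build _ _ _ step step_sigma_finite.

Lemma lebesgue_tuple_step :
  exists nu : {sigma_finite_measure set (m.+1.-tuple RT) -> \bar R},
    nu = step :> (set _ -> _).
Proof. by exists step. Qed.

End Step.

Lemma lebesgue_tuple_subproof m :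
  exists mu : {sigma_finite_measure set (m.-tuple RT) -> \bar R},
    mu = @lebesgue_tuple m :> (set _ -> _).
Proof.
elim: m => [|m [mu E]]; first by exists (\d_ [tuple]).
have [nu nuE] := lebesgue_tuple_step mu.
by exists nu; rewrite nuE E.
Qed.

Variable m : nat.

Let lebesgue_tuple0 : lebesgue_tuple (@set0 (m.-tuple RT)) = 0%E.
Proof. by have [mu <-] := lebesgue_tuple_subproof m. Qed.

Let lebesgue_tuple_ge0 (A : set (m.-tuple RT)) : (0 <= lebesgue_tuple A)%E.
Proof. by have [mu <-] := lebesgue_tuple_subproof m. Qed.

Let lebesgue_tuple_additive : semi_sigma_additive (@lebesgue_tuple m).
Proof.
by have [mu <-] := lebesgue_tuple_subproof m; exact: measure_semi_sigma_additive.
Qed.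

HB.instance Definition _ := isMeasure.Build _ _ _ (@lebesgue_tuple m)
  lebesgue_tuple0 lebesgue_tuple_ge0 lebesgue_tuple_additive.

Let lebesgue_tuple_sigma_finite : sigma_finite setT (@lebesgue_tuple m).
Proof. by have [mu <-] := lebesgue_tuple_subproof m; exact: sigma_finiteT. Qed.

HB.instance Definition _ := Measure_isSigmaFinite.Build _ _ _ (@lebesgue_tuple m)
  lebesgue_tuple_sigma_finite.

End LebesgueTuple.

Lemma fsum_linear (K : nzRingType) (U V : lmodType K) (I : choiceType)
    (L : I -> U -> V) :
  (forall i, linear (L i)) ->
  (forall t, finite_set [set i | L i t != 0]) ->
  linear (fun t => \sum_(i \in [set: I]) L i t).
Proof.
move=> Llin Lfin c s t /=.
pose A := [set i | L i s != 0] `|` [set i | L i t != 0].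
have fA : finite_set A by rewrite finite_setU.
have E q : (forall i, ~ A i -> L i q = 0) ->
    \sum_(i \in [set: I]) L i q = \sum_(i \in A) L i q.
  by move=> q0; apply/esym/fsbig_widen => // i [_ /q0].
have A0 i : ~ A i -> L i s = 0 /\ L i t = 0.
  by move=> /not_orP[/negP/negPn/eqP -> /negP/negPn/eqP ->].
rewrite (E (c *: s + t)); last first.
  by move=> i /A0[si ti]; rewrite Llin si ti scaler0 addr0.
rewrite (E s) => [|i /A0[]//]; rewrite (E t) => [|i /A0[]//].
rewrite !(fsbig_finite _ _ fA) /= scaler_sumr -big_split /=.
by apply: eq_bigr => i _; rewrite Llin.
Qed.

Lemma scalerCA (K : comNzRingType) (V : lmodType K) (a b : K) (v : V) :
  a *: (b *: v) = b *: (a *: v).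
Proof. by rewrite !scalerA mulrC. Qed.

Section WeylAlgebra.
Variables (K : comUnitRingType) (eps : K) (n : nat).
Local Notation d := (2 * n)%N.

(* K[p_1, ..., p_n, q_1, ..., q_n]; with indices starting at 0, y_(2r) is p_r
   and y_(2r+1) is q_r. *)
Definition weyl := {mpoly K[d]}.

Definition tpow (m : nat) := {mpoly K[m * d]}.

Fact pidx_subproof (r : 'I_n) : (2 * r < d)%N.
Proof. by rewrite ltn_pmul2l. Qed.
Definition pidx (r : 'I_n) : 'I_d := Ordinal (pidx_subproof r).

Fact qidx_subproof (r : 'I_n) : ((2 * r).+1 < d)%N.
Proof. by rewrite -[(_.+2)%N]addn2 -mulnSr leq_pmul2l. Qed.
Definition qidx (r : 'I_n) : 'I_d := Ordinal (qidx_subproof r).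

Definition alpha m (i j : 'I_m) (t : tpow m) : tpow m :=
  2^-1 *: \sum_(r < n)
    (tderiv i (pidx r) (tderiv j (qidx r) t)
     - tderiv i (qidx r) (tderiv j (pidx r) t)).

Definition eps_alpha m (i j : 'I_m) (t : tpow m) : tpow m :=
  eps *: alpha i j t.

(* exp D, for D locally nilpotent: the sum is over the finite support *)
Definition lexp m (D : tpow m -> tpow m) (t : tpow m) : tpow m :=
  \sum_(k \in [set: nat]) k`!%:R^-1 *: iter k D t.

Lemma msize_mderiv N (i : 'I_N) (t : {mpoly K[N]}) :
  (msize t^`M(i) <= (msize t).-1)%N.
Proof.
rewrite /mderiv; apply: (leq_trans (msize_sum _ _ _)).
apply/bigmax_leqP_seq => u ut _; have ltu := msize_mdeg_lt ut.
have [u0|u0] := posnP (u i); first by rewrite u0 mul0r scale0r msize0.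
apply: (leq_trans (msizeZ_le _ _)); rewrite msizeX.
have <- : (mdeg u).-1 = mdeg (u - U_(i))%MM.
  rewrite -[in LHS](@submK _ U_(i)%MM u) ?lep1mP -?lt0n// mdegD mdeg1.
  by rewrite addn1.
rewrite prednK; last by rewrite (leq_trans u0)// mdegE (bigD1 i)//= leq_addr.
by rewrite -ltnS prednK// (leq_ltn_trans _ ltu).
Qed.

Lemma alpha_linear m (i j : 'I_m) : linear (alpha i j).
Proof.
move=> c s t; rewrite /alpha /tderiv [c *: (_ *: _)]scalerA [c * _]mulrC.
rewrite -scalerA -scalerDr; congr (_ *: _).
rewrite [X in _ = X + _]scaler_sumr -big_split /=; apply: eq_bigr => r _.
by rewrite !mderivD !mderivZ scalerBr opprD addrACA.
Qed.

Lemma eps_alpha_linear m (i j : 'I_m) : linear (eps_alpha i j).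
Proof.
move=> c s t; rewrite /eps_alpha alpha_linear scalerDr.
by congr (_ + _); exact: scalerCA.
Qed.

Lemma msize_eps_alpha m (i j : 'I_m) t :
  (msize (eps_alpha i j t) <= (msize t).-1)%N.
Proof.
rewrite /eps_alpha; apply: (leq_trans (msizeZ_le _ _)).
rewrite /alpha; apply: (leq_trans (msizeZ_le _ _)).
apply: (leq_trans (msize_sum _ _ _)); apply/bigmax_leqP => r _.
have le2 (u v : 'I_(m * d)) : (msize t^`M(u)^`M(v) <= (msize t).-1)%N.
  apply: (leq_trans (msize_mderiv _ _)); apply: (leq_trans (leq_pred _)).
  exact: msize_mderiv.
by apply: (leq_trans (msizeD_le _ _)); rewrite msizeN geq_max !le2.
Qed.

Lemma iter_eps_alpha_linear m (i j : 'I_m) k : linear (iter k (eps_alpha i j)).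
Proof. by elim: k => [|k IH] c s t //=; rewrite IH eps_alpha_linear. Qed.

Lemma msize_iter_eps_alpha m (i j : 'I_m) k t :
  (msize (iter k (eps_alpha i j) t) <= msize t - k)%N.
Proof.
elim: k => [|k IH] /=; first by rewrite subn0.
apply: (leq_trans (msize_eps_alpha _ _ _)).
by rewrite subnS -!subn1 leq_sub2r.
Qed.

Lemma lexp_eps_alpha_linear m (i j : 'I_m) : linear (lexp (eps_alpha i j)).
Proof.
apply: (@fsum_linear K (tpow m) (tpow m) nat
  (fun k t => k`!%:R^-1 *: iter k (eps_alpha i j) t)).
  move=> k c s t; rewrite iter_eps_alpha_linear scalerDr.
  by congr (_ + _); exact: scalerCA.
move=> t; apply: (sub_finite_set _ (finite_II (msize t))) => k /=.
apply: contra_neqT; rewrite -leqNgt => tk.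
have := msize_iter_eps_alpha i j k t.
rewrite (eqP (tk : _ - _ == 0)%N) leqn0 msize_poly_eq0 => /eqP ->.
by rewrite scaler0.
Qed.

Definition star (f g : weyl) : weyl :=
  tmul (lexp (@eps_alpha 2 ord0 ord_max)
             (tens (fun i : 'I_2 => if i == ord0 then f else g))).

Lemma star_linear_l g : linear (star^~ g).
Proof.
move=> c x y; rewrite /star.
pose a : 'I_2 -> weyl := fun=> g.
have E z : (fun i : 'I_2 => if i == ord0 then z else g) = upd a ord0 z by [].
by rewrite !E tens_multilin lexp_eps_alpha_linear /tmul comp_mpolyD comp_mpolyZ.
Qed.

Lemma star_linear_r f : linear (star f).
Proof.
move=> c x y; rewrite /star.
pose a : 'I_2 -> weyl := fun=> f.
have E z : (fun i : 'I_2 => if i == ord0 then f else z) = upd a ord_max z.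
  by apply/funext => -[[|[|//]] ?].
by rewrite !E tens_multilin lexp_eps_alpha_linear /tmul comp_mpolyD comp_mpolyZ.
Qed.

Definition bracket (f g : weyl) : weyl := eps^-1 *: (star f g - star g f).

(* homogeneous quadratic polynomials with coefficients in C *)
Definition sp (C : nzRingType) (emb : C -> K) (a : weyl) : Prop :=
  exists2 b : {mpoly C[d]}, b \is 2.-homog & a = map_mpoly emb b.

Section Hochschild.
Variable k : nat.

(* the arguments of the j-th summand (j <= k), in which a_j and a_(j+1) are
   multiplied *)
Definition face (a : 'I_k.+2 -> weyl) (j : 'I_k.+1) : 'I_k.+1 -> weyl :=
  fun i => if (i < j)%N then a (widen_ord (leqnSn _) i)
           else if i == j then star (a (widen_ord (leqnSn _) j)) (a (lift ord0 j))
           else a (lift ord0 i).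

Definition cyclic_face (a : 'I_k.+2 -> weyl) : 'I_k.+1 -> weyl :=
  fun i => if i == ord0 then star (a ord_max) (a ord0)
           else a (widen_ord (leqnSn _) i).

Definition dHoch_tens (a : 'I_k.+2 -> weyl) : tpow k.+1 :=
  \sum_(j < k.+1) (-1) ^+ j *: tens (face a j)
  + (-1) ^+ k.+1 *: tens (cyclic_face a).

Definition dHoch : tpow k.+2 -> tpow k.+1 := tlift dHoch_tens.


Let slotwise (psi : ('I_k.+2 -> weyl) -> 'I_k.+1 -> weyl) := forall a i,
  exists b i' (l : weyl -> weyl), linear l /\
    forall x, psi (upd a i x) = upd b i' (l x).

Let slotwise_multilin psi :
  slotwise psi -> @multilin K _ weyl (tpow k.+1) (fun a => tens (psi a)).
Proof.
move=> psiS a i c x y; have [b [i' [l [llin E]]]] := psiS a i.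
by rewrite !E llin tens_multilin.
Qed.

Let face_slotwise j : slotwise (face^~ j).
Proof.
move=> a i; have [->|ij] := eqVneq i (widen_ord (leqnSn _) j).
  exists (face a j), j, (star^~ (a (lift ord0 j))).
  split=> [|x]; first exact: star_linear_l.
  apply/funext => s; rewrite /face /upd -!val_eqE /= /bump /= !add1n.
  by move: star => st; repeat case: ifPn => ?; try by []; exfalso; lia.
have [->|ij'] := eqVneq i (lift ord0 j).
  exists (face a j), j, (star (a (widen_ord (leqnSn _) j))).
  split=> [|x]; first exact: star_linear_r.
  apply/funext => s; rewrite /face /upd -!val_eqE /= /bump /= !add1n.
  by move: star => st; repeat case: ifPn => ?; try by []; exfalso; lia.
move: ij ij'; rewrite -!val_eqE /= /bump /= add1n => ij ij'.
have ik : ((if (i < j)%N then i : nat else i.-1) < k.+1)%N.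
  by have := ltn_ord i; have := ltn_ord j; case: ifPn; lia.
move: ik; case: ifPn => lij ik; exists (face a j), (Ordinal ik), id;
  split=> // x; apply/funext => s;
  rewrite /face /upd -!val_eqE /= /bump /= !add1n;
  by move: star => st; repeat case: ifPn => ?; try by []; exfalso; lia.
Qed.

Let cyclic_face_slotwise : slotwise cyclic_face.
Proof.
move=> a i; have [->|i0] := eqVneq i ord0.
  exists (cyclic_face a), ord0, (star (a ord_max)).
  split=> [|x]; first exact: star_linear_r.
  apply/funext => s; rewrite /cyclic_face /upd -!val_eqE /=.
  by move: star => st; repeat case: ifPn => ?; try by []; exfalso; lia.
have [->|im] := eqVneq i ord_max.
  exists (cyclic_face a), ord0, (star^~ (a ord0)).
  split=> [|x]; first exact: star_linear_l.
  apply/funext => s; have := ltn_ord s.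
  rewrite /cyclic_face /upd -!val_eqE /= => sk.
  by move: star => st; repeat case: ifPn => ?; try by []; exfalso; lia.
move: i0 im; rewrite -!val_eqE /= => i0 im.
have ik : (i < k.+1)%N by have := ltn_ord i; lia.
exists (cyclic_face a), (Ordinal ik), id; split=> // x.
apply/funext => s; have := ltn_ord s.
rewrite /cyclic_face /upd -!val_eqE /= => sk.
by move: star => st; repeat case: ifPn => ?; try by []; exfalso; lia.
Qed.

Lemma dHoch_tens_multilin : multilin dHoch_tens.
Proof.
move=> a i c x y; rewrite /dHoch_tens scalerDr scaler_sumr.
rewrite addrACA -big_split /=; congr (_ + _).
  apply: eq_bigr => j _; rewrite (slotwise_multilin (face_slotwise j)).
  by rewrite scalerDr; congr (_ + _); exact: scalerCA.
rewrite (slotwise_multilin cyclic_face_slotwise).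
by rewrite scalerDr; congr (_ + _); exact: scalerCA.
Qed.

Lemma dHochE a : dHoch (tens a) = dHoch_tens a.
Proof. exact/tlift_tens/dHoch_tens_multilin. Qed.

End Hochschild.

Definition slot_pair m := {p : 'I_m * 'I_m | (p.1 < p.2)%N}.

Section Trace.
Variables (R : realType) (emb : R -> K).

(* the simplex 0 <= u_1 <= ... <= u_m <= 1 *)
Definition simplex m : set (m.-tuple (measurableTypeR R)) :=
  [set u | (forall i, 0 <= (tnth u i : R) <= 1) /\
           (forall i j : 'I_m, (i <= j)%N -> (tnth u i : R) <= tnth u j)].

Definition antisym (t : tpow d.+1) : tpow d.+1 :=
  \sum_(s : 'S_d) (-1) ^+ s *:
    t^`M[(\sum_(k < d) U_(mxvec_index (lift ord0 k) (s k)))%MM].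

(* The product over i < j of the exponentials is expanded into
     sum_N prod_(i<j) (2 u_i - 2 u_j + 1)^N_ij / N_ij! (eps alpha_ij)^N_ij,
   N running over the families of naturals indexed by the pairs i < j;
   [taylor_int N] is the integral of the scalar factor (with u_0 = 0) and
   [taylor_op N] is the operator. *)
Definition taylor_int (N : {ffun slot_pair d.+1 -> nat}) : R :=
  \int[@lebesgue_tuple R d]_(u in @simplex d)
    \prod_p ((2 * tnth [tuple of (0 : R) :: u] (val p).1
              - 2 * tnth [tuple of (0 : R) :: u] (val p).2 + 1) ^+ N p
             / (N p)`!%:R).

Definition taylor_op (N : {ffun slot_pair d.+1 -> nat}) :
    tpow d.+1 -> tpow d.+1 :=
  \big[(fun f g => f \o g)/id]_(p : slot_pair d.+1)
    iter (N p) (eps_alpha (val p).1 (val p).2).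

Definition tau (t : tpow d.+1) : K :=
  (\sum_(N \in [set: {ffun slot_pair d.+1 -> nat}])
     emb (taylor_int N) *: taylor_op N (antisym t))@_0%MM.

Lemma taylor_op_linear N : linear (taylor_op N).
Proof.
rewrite /taylor_op; elim/big_ind: _ => // [f g flin glin|p _] c s t /=.
  by rewrite glin flin.
exact: iter_eps_alpha_linear.
Qed.

Lemma msize_taylor_op N t : (msize (taylor_op N t) <= msize t - \sum_p N p)%N.
Proof.
rewrite /taylor_op.
elim/big_ind2: _ t => [t|f v g w fv gw t|p _ t] /=; first by rewrite subn0.
  apply: (leq_trans (fv _)); rewrite addnC subnDA leq_sub2r//.
exact: msize_iter_eps_alpha.
Qed.

Lemma finite_taylor t : finite_set [set N | taylor_op N t != 0].
Proof.
pose P := slot_pair d.+1.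
pose h (N : {ffun P -> 'I_(msize t).+1}) : {ffun P -> nat} := [ffun p => N p : nat].
apply: (@sub_finite_set _ _ (h @` setT)); last first.
  by apply: finite_image; exact: finite_finset.
move=> N /= N0; have Nt : (\sum_p N p < msize t)%N.
  rewrite ltnNge; apply: contra N0 => tN.
  have := msize_taylor_op N t.
  by rewrite (eqP (tN : _ - _ == 0)%N) leqn0 msize_poly_eq0.
exists [ffun p => inord (N p)] => //; apply/ffunP => p; rewrite !ffunE inordK//.
by rewrite ltnS (leq_trans _ (ltnW Nt))// (bigD1 p)//= leq_addr.
Qed.

Lemma antisym_linear : linear antisym.
Proof.
move=> c s t; rewrite /antisym scaler_sumr -big_split /=.
apply: eq_bigr => p _; rewrite mderivmD mderivmZ scalerDr.
by congr (_ + _); exact: scalerCA.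
Qed.

Lemma antisym_tens (a : 'I_d.+1 -> weyl) :
  antisym (tens a) = \sum_(s : 'S_d) (-1) ^+ s *:
    tens (fun i => if unlift ord0 i is Some k then (a i)^`M(s k) else a i).
Proof.
apply: eq_bigr => s _; congr (_ *: _).
pose b (r : seq 'I_d) (i : 'I_d.+1) : weyl :=
  if unlift ord0 i is Some k then if k \in r then (a i)^`M(s k) else a i
  else a i.
have E (r : seq 'I_d) : uniq r ->
    (tens a)^`M[(\sum_(k <- r) U_(mxvec_index (lift ord0 k) (s k)))%MM]
    = tens (b r).
  elim: r => [_|k r IH /= /andP[kr ur]].
    rewrite big_nil mderivm0m; congr tens; apply/funext => i.
    by rewrite /b; case: unliftP.
  rewrite big_cons addmC mderivmDm IH// mderivmU1m.
  rewrite -[LHS]/(tderiv (lift ord0 k) (s k) (tens (b r))) tderiv_tens.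
  congr tens; apply/funext => i; rewrite /upd /b.
  have [->|ik] := eqVneq i (lift ord0 k).
    by rewrite liftK inE eqxx (negPf kr).
  case: unliftP => [k' ik'|//]; rewrite inE; case: eqVneq => [kk|//].
  by rewrite ik' kk eqxx in ik.
rewrite (E (index_enum _) (index_enum_uniq _)); congr tens; apply/funext => i.
by rewrite /b; case: unliftP => // k; rewrite mem_index_enum.
Qed.

Lemma tau_linear : linear_for *%R tau.
Proof.
move=> c s t; rewrite /tau antisym_linear.
pose L N x := emb (taylor_int N) *: taylor_op N x : tpow d.+1.
have -> := @fsum_linear K _ _ _ L; first by rewrite mcoeffD mcoeffZ.
- move=> N a x y; rewrite /L taylor_op_linear scalerDr.
  by congr (_ + _); exact: scalerCA.
- move=> x; apply: sub_finite_set (finite_taylor x) => N /=.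
  by apply: contra_neq => E; rewrite /L E scaler0.
Qed.

HB.instance Definition _ :=
  GRing.isLinear.Build K (tpow d.+1) K *%R tau tau_linear.

End Trace.

Definition c2n : tpow d.+1 :=
  \sum_(s : 'S_d) (-1) ^+ s *:
    tens (fun i : 'I_d.+1 => if unlift ord0 i is Some k then 'X_(s k) else 1).

End WeylAlgebra.

(* K = C[eps, eps^-1] *)
Section LaurentC.
Variable R : realType.
Definition KC : comUnitRingType := laurent (complex R).
Definition epsC : KC := leps.
Definition constC : complex R -> KC := @lconst (complex R).
Definition constR (x : R) : KC := constC (real_complex R x).
End LaurentC.
Arguments epsC {R}.

(* Main.v *)
(* Reading the derivatives in the p's and q's of slot i as variables, the
   cochain becomes t |-> (P(d) t)(0) for the polynomial
     P = (int_Delta exp X) * det,  X = sum_(i < j) (2 u_i - 2 u_j + 1) w_ij,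
   where w_ij is the symbol of eps alpha_ij and det is the determinant of the
   variables of the slots 1, ..., 2n.
   Multiplying adjacent slots with the star product replaces exp X by a face
   of the same integrand on the (2n+1)-simplex and det by a sum of two
   neighbouring maximal minors D_j + D_(j+1) of the variables of the slots
   1, ..., 2n+1.  In dHoch the terms recombine into the differences of
   neighbouring faces, which by Stokes are integrals of
     d(exp X)/du_k = 2 (sum_s w_ks) exp X,
   and sum_k (-1)^k D_k w_ks = 0 is the Laplace expansion of a determinant
   with a repeated column.
   A quadratic element acts on symbols by a derivation that kills every w_ij,
   being symplectic, and det, being traceless; this gives invariance.
   When a quadratic element is inserted, only the part of exp X that is linear
   in the inserted slot survives, since det is linear in it already; the signed
   determinants do not depend on the place of insertion, and Stokes makes the
   sum of the integrals telescope. *)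
Require Import Defs.
From HB Require Import structures.
From mathcomp Require Import all_boot all_order all_algebra all_fingroup.
From mathcomp Require Import zify ring.
From mathcomp Require Import ssrcomplements mpoly complex.
From mathcomp Require Import boolp classical_sets functions fsbigop.
From mathcomp Require Import reals ereal normedtype derive realfun measure.
From mathcomp Require Import lebesgue_measure measurable_realfun lebesgue_integral ftc.

Set Implicit Arguments.
Unset Strict Implicit.
Unset Printing Implicit Defensive.

Import Order.TTheory GRing.Theory Num.Theory.
Local Open Scope ring_scope.

(** * Integration of polynomials over the simplex *)

(** The weight 2 u_i - 2 u_j + 1 is 1 when the two points coincide, which is the weight of eps alpha
    in the star product. When u_j reaches 1 it is the opposite of the weight of the point 0 against
    u_i, and the antisymmetry of w_ij compensates the sign. Hence the faces where neighbouring
    points meet give the ordinary summands of the Hochschild differential, and the face at 1 gives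
    the cyclic one. Symbols are polynomials, so exp X is not among them. It is replaced by a Taylor
    polynomial whose order M is at least the size of the tensor acted upon: the laws of the
    exponential then hold up to symbols of order M, which annihilate that tensor. The integrands are
    polynomials in u with symbols as coefficients, so the integral over the simplex is defined
    formally on monomials, over any commutative ring with inverses of the positive integers, and
    Stokes becomes an identity between fractions. The Lebesgue integral enters only through the real
    coefficients of the Taylor expansion. *)

Section LinearExtension.
Variables (N : nat) (R : comNzRingType) (V : lmodType R).

Definition mlift (h : 'X_{1..N} -> V) (p : {mpoly R[N]}) : V :=
  \sum_(m <- msupp p) p@_m *: h m.

(** A common degree bound puts several polynomials over one index set, which makes linearity
    visible. *)
Lemma mliftwE h w p : (msize p <= w)%N ->
  mlift h p = \sum_(m : 'X_{1..N < w}) p@_m *: h m.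
Proof.
move=> pw; pose I : subFinType _ := 'X_{1..N < w}.
rewrite /mlift (big_mksub I) ?msupp_uniq//=; first last.
  by move=> u /msize_mdeg_lt /leq_trans; apply.
by rewrite big_rmcond// => u /memN_msupp_eq0 ->; rewrite scale0r.
Qed.

Lemma mlift_is_linear h : linear (mlift h).
Proof.
move=> c p q; pose w := maxn (msize (c *: p + q)) (maxn (msize p) (msize q)).
rewrite !(@mliftwE h w) ?leq_max ?leqnn ?orbT// scaler_sumr -big_split /=.
by apply: eq_bigr => u _; rewrite mcoeffD mcoeffZ scalerDl scalerA.
Qed.

HB.instance Definition _ h :=
  GRing.isLinear.Build R {mpoly R[N]} V _ (mlift h) (mlift_is_linear h).

Lemma mliftX h m : mlift h 'X_[m] = h m.
Proof. by rewrite /mlift msuppX big_seq1 mcoeffX eqxx scale1r. Qed.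

Lemma mpoly_linear_ext (f g : {linear {mpoly R[N]} -> V}) :
  (forall m, f 'X_[m] = g 'X_[m]) -> f =1 g.
Proof.
move=> E p; rewrite (mpolyE p) !linear_sum; apply: eq_bigr => m _.
by rewrite !linearZ E.
Qed.

Lemma mpoly_linear_ext_fun (f g : {mpoly R[N]} -> V) :
  linear f -> linear g -> (forall m, f 'X_[m] = g 'X_[m]) -> f =1 g.
Proof.
move=> flin glin E.
pose F : {linear {mpoly R[N]} -> V} := HB.pack f (GRing.isLinear.Build _ _ _ _ f flin).
pose G : {linear {mpoly R[N]} -> V} := HB.pack g (GRing.isLinear.Build _ _ _ _ g glin).
exact: (@mpoly_linear_ext F G).
Qed.

End LinearExtension.

Section SimplexIntegral.
Variables (S : comNzRingType) (iw : nat -> S).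
Hypothesis iwK : forall k, (0 < k)%N -> k%:R * iw k = 1.

(** These are the denominators met when u^e is integrated one variable after the other: each
    integration raises the exponent by one and passes it on to the next point. *)
Definition psum (e : nat -> nat) k := (\sum_(0 <= i < k.+1) (e i).+1)%N.

Definition mnm_int d (e : nat -> nat) : S := \prod_(0 <= k < d) iw (psum e k).

(* The integral over 0 <= u_0 <= ... <= u_(d-1) <= 1: a monomial u^e is
   integrated in u_0 from 0 to u_1, then in u_1 from 0 to u_2, and so on. *)
Definition simplex_int d (F : {mpoly S[d]}) : S :=
  @mlift d S S^o (fun m => mnm_int d (fun i => nth 0%N m i)) F.

HB.instance Definition _ d :=
  GRing.Linear.copy (@simplex_int d) (@mlift d S S^o _).

Lemma simplex_intZ d c (F : {mpoly S[d]}) :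
  simplex_int (c *: F) = c * simplex_int F.
Proof. exact: linearZ. Qed.

(* The point t_k of the partition 0 = t_0 <= u_0 <= ... <= u_(d-1) <= 1. *)
Definition spt d (k : nat) : {mpoly S[d]} :=
  if k is k'.+1 then if insub k' is Some i then 'X_(i : 'I_d) else 1 else 0.

(** Restriction to the face t_j = t_(j+1). The variable of index i is the point t_(i+1), hence the
    shift; the ends j = 0 and j = d.+1 are u_0 = 0 and u_d = 1. *)
Definition sface d (j : nat) : {mpoly S[d.+1]} -> {mpoly S[d]} :=
  comp_mpoly [tuple spt d (if (i < j)%N then i.+1 else i) | i < d.+1].

HB.instance Definition _ d j := GRing.RMorphism.copy (@sface d j)
  (comp_mpoly [tuple spt d (if (i < j)%N then i.+1 else i) | i < d.+1]).
HB.instance Definition _ d j := GRing.Linear.copy (@sface d j)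
  (comp_mpoly [tuple spt d (if (i < j)%N then i.+1 else i) | i < d.+1]).

(** The exponents of a monomial restricted to u_k = u_(k+1). *)
Definition merge k (e : nat -> nat) i :=
  if (i < k)%N then e i else if i == k then (e k + e k.+1)%N else e i.+1.

Lemma eq_mnm_int d (e e' : nat -> nat) :
  (forall i, (i < d)%N -> e i = e' i) -> mnm_int d e = mnm_int d e'.
Proof.
move=> E; apply: eq_big_nat => k /andP[_ kd]; congr iw.
by apply: eq_big_nat => i /andP[_ ik]; rewrite E// (leq_trans ik).
Qed.

Lemma psumS e k : psum e k.+1 = (psum e k + (e k.+1).+1)%N.
Proof. by rewrite /psum big_nat_recr. Qed.

Lemma psum0 e : psum e 0 = (e 0%N).+1.
Proof. by rewrite /psum big_nat1. Qed.

Lemma psum_gt0 e k : (0 < psum e k)%N.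
Proof. by case: k => [|k]; rewrite ?psum0// psumS addnS. Qed.

Lemma psum_merge e k i :
  psum (merge k e) i = if (i < k)%N then psum e i else (psum e i.+1).-1.
Proof.
elim: i => [|i IH].
  rewrite psum0 psumS psum0 /merge; case: k => [|k] //=.
  lia.
rewrite [LHS]psumS IH {IH} /merge.
have := psum_gt0 e i; have [ik|ki] := ltnP i k.
  by case: (ltngtP i.+1 k) ik => [| |E] _; rewrite !psumS; try subst k; lia.
have -> : (i.+1 < k)%N = false by lia.
have -> : (i.+1 == k) = false by lia.
by rewrite !psumS; lia.
Qed.

Lemma psum_shift e i : e 0%N = 0%N ->
  psum (fun j => e j.+1) i = (psum e i.+1).-1.
Proof.
move=> e0; elim: i => [|i IH]; first by rewrite psumS !psum0 e0.
by rewrite psumS IH [in RHS]psumS; have := psum_gt0 e i.+1; lia.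
Qed.

Lemma psum_dec e k i : (0 < e k)%N ->
  psum (fun j => (e j - (j == k))%N) i
  = if (i < k)%N then psum e i else (psum e i).-1.
Proof.
move=> ek; elim: i => [|i IH].
  by rewrite !psum0; case: k ek => [|k] /=; rewrite ?subn0//; lia.
rewrite psumS IH psumS; have := psum_gt0 e i; have [ik|ki] := ltnP i k.
  by case: (ltngtP i.+1 k) => [| |E]; try subst k; lia.
have -> : (i.+1 < k)%N = false by lia.
have -> : (i.+1 == k) = false by lia.
lia.
Qed.

(** Lowering e_k lowers the partial sums from k on and keeps those below, and merging acts alike, so
    the three products share almost all factors. For k > 0 what remains is c / (p (p + c)) = 1 / p -
    1 / (p + c), with c = e_k and p the partial sum before k. *)
Lemma mnm_int_stokes d (e : nat -> nat) k : (k <= d)%N ->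
  (e k)%:R * mnm_int d.+1 (fun j => (e j - (j == k))%N)
  = mnm_int d (merge k e)
    - (if k is k'.+1 then mnm_int d (merge k' e)
       else (e 0%N == 0%N)%:R * mnm_int d (fun j => e j.+1)).
Proof.
move=> kd; set B := \prod_(k <= i < d) iw (psum e i.+1).-1.
have split_ r (f : nat -> S) : (r <= d)%N ->
    \prod_(0 <= i < d) f i = (\prod_(0 <= i < r) f i) * \prod_(r <= i < d) f i.
  by move=> rd; rewrite (@big_cat_nat _ _ _ r).
have mergeE r : (r <= d)%N -> mnm_int d (merge r e) =
    (\prod_(0 <= i < r) iw (psum e i)) * \prod_(r <= i < d) iw (psum e i.+1).-1.
  move=> rd; rewrite /mnm_int (split_ r)//; congr (_ * _); apply: eq_big_nat => i.
    by move=> /andP[_ ir]; rewrite psum_merge ir.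
  by move=> /andP[ri _]; rewrite psum_merge ltnNge ri.
have decE : (0 < e k)%N -> mnm_int d.+1 (fun j => (e j - (j == k))%N) =
    (\prod_(0 <= i < k) iw (psum e i)) * (iw (psum e k).-1 * B).
  move=> ek; rewrite /mnm_int (@big_cat_nat _ _ _ k)//= ?(leqW kd)//; congr (_ * _).
    by apply: eq_big_nat => i /andP[_ ik]; rewrite psum_dec ?ik.
  rewrite big_nat_recl//=; congr (_ * _); first by rewrite psum_dec ?ltnn.
  by apply: eq_big_nat => i /andP[ki _]; rewrite psum_dec// ltnNge (leqW ki).
rewrite mergeE//; case: k @B kd decE => [|k] B kd decE.
  rewrite big_geq// mul1r; have [e0|e0] := posnP (e 0%N).
    rewrite e0 mul0r mul1r /B; apply/esym/eqP; rewrite subr_eq0; apply/eqP.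
    by apply: eq_big_nat => i _; rewrite psum_shift.
  rewrite decE// big_geq// mul1r mul0r subr0 psum0 /= mulrA.
  by rewrite iwK// mul1r.
rewrite mergeE ?(ltnW kd)// big_nat_recr//=.
have -> : \prod_(k <= i < d) iw (psum e i.+1).-1 = iw (psum e k.+1).-1 * B.
  by rewrite big_ltn.
set P := \prod_(0 <= i < k) _.
have := iwK (psum_gt0 e k).
have [e0|e0] := posnP (e k.+1).
  by rewrite e0 mul0r psumS e0 addn1 /= => _; rewrite mulrA subrr.
rewrite decE// big_nat_recr//= -/P psumS addnS /=.
have : (0 < psum e k + e k.+1)%N by lia.
move=> /iwK; rewrite natrD; set b := iw (psum e k); set a := iw _.
move=> aK bK; rewrite !mulrA.
transitivity (P * B * (((psum e k)%:R + (e k.+1)%:R) * a * b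
   - ((psum e k)%:R * b) * a)); first by ring.
by rewrite aK bK -/B; ring.
Qed.

Lemma simplex_intX d m :
  simplex_int ('X_[m] : {mpoly S[d]}) = mnm_int d (fun i => nth 0%N m i).
Proof. by rewrite /simplex_int mliftX. Qed.

Lemma simplex_int_prod d (e : nat -> nat) :
  simplex_int (\prod_(0 <= i < d) spt d i.+1 ^+ e i) = mnm_int d e.
Proof.
have -> : \prod_(0 <= i < d) spt d i.+1 ^+ e i = 'X_[[multinom e i | i < d]].
  rewrite big_mkord mpolyXE_id; apply: eq_bigr => i _ /=.
  by rewrite valK mnmE.
rewrite simplex_intX; apply: eq_mnm_int => i id_.
by have := mnm_nth 0%N [multinom e j | j < d] (Ordinal id_); rewrite mnmE => <-.
Qed.

Lemma sface_spt d j k : (k <= d.+1)%N ->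
  sface j (spt d.+1 k) = spt d (if (k <= j)%N then k else k.-1).
Proof.
case: k => [_|k]; first by rewrite /sface /= comp_mpoly0.
move=> kd; rewrite {1}/spt (insubT (fun i => i < d.+1)%N kd) /=.
rewrite /sface comp_mpolyXU -tnth_nth tnth_mktuple /=.
by case: ltnP.
Qed.

Lemma spt_last d : spt d d.+1 = 1.
Proof. by rewrite /spt insubF ?ltnn. Qed.

Lemma simplex_int_sfaceX d (m : 'X_{1..d.+1}) j : (j <= d.+1)%N ->
  simplex_int (sface j 'X_[m])
  = let e i := nth 0%N m i in
    if j is j'.+1 then mnm_int d (merge j' e)
    else (e 0%N == 0%N)%:R * mnm_int d (fun i => e i.+1).
Proof.
move=> jd; set e := fun i => _; rewrite /= /sface comp_mpolyX.
rewrite (eq_bigr (fun i : 'I_d.+1 =>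
   spt d (if (i < j)%N then i.+1 else i) ^+ e i)); last first.
  by move=> i _; rewrite tnth_mktuple (mnm_nth 0%N).
rewrite -(big_mkord xpredT (fun i => spt d (if (i < j)%N then i.+1 else i) ^+ e i)).
case: j jd => [_|j]; last rewrite ltnS => jd.
  rewrite big_nat_recl//= expr0n.
  rewrite -{1}(mul1r (\prod_(0 <= i < d) _)); case: (e 0%N == 0%N).
    by rewrite !mul1r simplex_int_prod.
  by rewrite !mul0r raddf0.
rewrite -simplex_int_prod; congr simplex_int.
rewrite [LHS](@big_cat_nat _ _ _ j)//= ?(leqW jd)//.
rewrite [RHS](@big_cat_nat _ _ _ j)//=; congr (_ * _).
  apply: eq_big_nat => i /andP[_ ij].
  by rewrite /merge ij ltnS (ltnW ij).
rewrite (@big_ltn _ _ _ j)// ltnSn.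
case: (ltngtP j d) jd => // [jd _|-> _].
  rewrite [X in _ * X]big_ltn// [RHS]big_ltn// mulrA; congr (_ * _).
    by rewrite ltnn /merge ltnn eqxx exprD.
  rewrite big_add1 /=; apply: eq_big_nat => i /andP[ji _].
  rewrite /merge [(i < j)%N]ltnNge (ltnW ji) /= gtn_eqF//.
  by rewrite ltnS [(i < j)%N]ltnNge (ltnW ji).
by rewrite spt_last expr1n mul1r !big_geq.
Qed.

Lemma simplex_stokes d (k : 'I_d.+1) (F : {mpoly S[d.+1]}) :
  simplex_int F^`M(k)
  = simplex_int (sface k.+1 F) - simplex_int (sface k F).
Proof.
pose f : {linear {mpoly S[d.+1]} -> S^o} := (@simplex_int d.+1 \o mderiv k)%FUN.
pose g : {linear {mpoly S[d.+1]} -> S^o} :=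
  ((@simplex_int d \o sface k.+1) \- (@simplex_int d \o sface k))%FUN.
suff E m : f 'X_[m] = g 'X_[m] by exact: (@mpoly_linear_ext _ S S^o f g E F).
rewrite /f /g /= mderivX linearZ /= !simplex_int_sfaceX ?ltn_ord ?(ltnW (ltn_ord k))//.
rewrite simplex_intX; have kd : (k <= d)%N by rewrite -ltnS.
rewrite -(mnm_int_stokes (fun i => nth 0%N m i) kd) -mnm_nth.
congr (_ * _); apply: eq_mnm_int => i id_.
have := mnm_nth 0%N (m - U_(k))%MM (Ordinal id_).
by rewrite mnmBE mnm1E (mnm_nth 0%N m) eq_sym => <-.
Qed.

End SimplexIntegral.

(** * Lebesgue integrals over the simplex *)

Section SimplexLebesgue.
Import numFieldNormedType.Exports.
Local Open Scope classical_set_scope.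
Variable R : realType.
Local Notation RT := (measurableTypeR R).
Local Notation mu := (@lebesgue_measure R).

Lemma integral_exprn (b : R) k : 0 <= b ->
  (\int[mu]_(x in `[0%R, b]) (x ^+ k)%:E = (b ^+ k.+1 / k.+1%:R)%:E)%E.
Proof.
rewrite le_eqVlt => /predU1P[<-|b0].
  by rewrite set_itv1 integral_set1 expr0n mul0r.
have dF (x : R) : derivable (fun x : R => x ^+ k.+1 / k.+1%:R) x 1.
  by apply: derivableM => //; exact: exprn_derivable.
have cF : continuous (fun x : R => x ^+ k.+1 / k.+1%:R).
  by move=> x; apply: cvgM; [exact: exprn_continuous|exact: cvg_cst].
rewrite (@continuous_FTC2 _ _ (fun x => x ^+ k.+1 / k.+1%:R))//=.
- by rewrite expr0n mul0r sube0.
- by apply: continuous_in_subspaceT => x _; exact: exprn_continuous.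
- split => //; [exact/cvg_at_right_filter/cF|exact/cvg_at_left_filter/cF].
- move=> x _; rewrite derive1Mr//.
  rewrite derive1E exp_derive scaler1 /=.
  by rewrite -[_ *: _]/(_ * _) mulrAC divff ?mul1r// pnatr_eq0.
exact: exprn_derivable.
Qed.

(** The default value 1 of [head] supplies the upper bound of x when u is empty. *)
Lemma simplex_cons m (x : RT) (u : m.-tuple RT) :
  simplex (R := R) [tuple of x :: u] <->
  simplex (R := R) u /\ (0 <= (x : R) <= head (1 : R) u).
Proof.
split=> [[u01 ule]|[[u01 ule] xu]].
  have S (i : 'I_m) : tnth [tuple of x :: u] (lift ord0 i) = tnth u i.
    by rewrite tnthS.
  split; first split=> [i|i j ij].
  - by have := u01 (lift ord0 i); rewrite S.
  - by have := ule (lift ord0 i) (lift ord0 j); rewrite !S; apply; rewrite leq_bump2.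
  - have /andP[x0 x1] : 0 <= (x : R) <= 1 by have := u01 ord0; rewrite tnth0.
    rewrite x0 /=; case: m u u01 ule S => [|m] u u01 ule S.
      by rewrite tuple0.
    have := ule ord0 (lift ord0 ord0) isT; rewrite tnth0 S.
    by rewrite (tnth_nth (1 : R)) nth0.
have /andP[x0 xh] := xu.
have hle (j : 'I_m) : (head (1 : R) u : R) <= tnth u j.
  case: m u u01 ule xu xh j => [|m] u u01 ule xu xh j; first by case: j.
  by have := ule ord0 j isT; rewrite {1}(tnth_nth (1 : R)) nth0.
have h1 : (head (1 : R) u : R) <= 1.
  case: m u u01 ule {xu xh hle} => [|m] u u01 ule; first by rewrite tuple0.
  by have /andP[_] := u01 ord0; rewrite (tnth_nth (1 : R)) nth0.
split=> [i|i j].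
  by case: (unliftP ord0 i) => [k|] ->; rewrite ?tnthS ?tnth0// x0 (le_trans xh).
case: (unliftP ord0 i) => [k|] ->; case: (unliftP ord0 j) => [l|] ->.
- by rewrite !tnthS leq_bump2; exact: ule.
- by rewrite /= ltn0.
- by rewrite tnth0 tnthS => _; rewrite (le_trans xh).
- by rewrite tnth0.
Qed.

Lemma measurable_simplex m : measurable (@simplex R m).
Proof.
elim: m => [|m IH].
  rewrite (_ : @simplex R 0 = setT); first exact: measurableT.
  by apply/seteqP; split=> // u _; split=> [[]|[]].
have -> : @simplex R m.+1 =
    ((fun w : m.+1.-tuple RT => [tuple of behead w]) @^-1` @simplex R m) `&`
    ((fun w : m.+1.-tuple RT => tnth w ord0) @^-1` `[0%R, +oo[) `&`
    ((fun w : m.+1.-tuple RT => (head (1:R) (behead w) : R) - tnth w ord0) @^-1` `[0%R, +oo[).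
  apply/seteqP; split=> [w|w]; rewrite (tuple_eta w) /=.
    move=> /simplex_cons[sw /andP[x0 xh]]; split; first split.
    + by congr (simplex _) : sw; apply: val_inj.
    + by rewrite tnth0 in_itv /= andbT.
    + by rewrite tnth0 in_itv /= andbT subr_ge0.
  rewrite tnth0 => -[[sw]]; rewrite !in_itv /= !andbT subr_ge0 => x0 xh.
  apply/simplex_cons; split; last by rewrite x0.
  by congr (simplex _) : sw; apply: val_inj.
have mb : measurable_fun setT (fun w : m.+1.-tuple RT => [tuple of behead w] : m.-tuple RT).
  exact: measurable_behead.
have m0 : measurable_fun setT (fun w : m.+1.-tuple RT => tnth w ord0).
  exact: measurable_tnth.
apply: measurableI; first apply: measurableI.
- by rewrite -[X in measurable X]setTI; exact: mb.
- by rewrite -[X in measurable X]setTI; apply: m0 => //; exact: measurable_itv.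
rewrite -[X in measurable X]setTI.
have mh : measurable_fun setT
    (fun w : m.+1.-tuple RT => (head (1:R) (behead w) : R) - tnth w ord0).
  apply: measurable_funB => //; case: m {IH mb m0} => [|m].
    rewrite (_ : (fun w => _) = cst (1:R)); first exact: measurable_cst.
    by apply/funext => -[[|a [|b s]] //= ws].
  rewrite (_ : (fun w => _) = fun w : m.+2.-tuple RT => tnth w (lift ord0 ord0)).
    exact: measurable_tnth.
  by apply/funext => -[[|a [|b s]] //= ws]; rewrite (tnth_nth (1 : R)).
by apply: mh => //; exact: measurable_itv.
Qed.

Definition mnm_fun m (e : nat -> nat) (u : m.-tuple RT) : R :=
  \prod_(i < m) (tnth u i : R) ^+ e i.

Lemma measurable_mnm_fun m e : measurable_fun setT (@mnm_fun m e).
Proof.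
apply: measurable_prod => i _; apply: measurable_funX; exact: measurable_tnth.
Qed.

Lemma mnm_fun_cons m e (x : RT) (u : m.-tuple RT) :
  mnm_fun e [tuple of x :: u] = (x : R) ^+ e 0%N * mnm_fun (fun i => e i.+1) u.
Proof.
rewrite /mnm_fun big_ord_recl tnth0; congr (_ * _).
by apply: eq_bigr => i _; rewrite tnthS.
Qed.

Let natV k : R := k%:R^-1.

Lemma integral_mnm m e :
  (\int[@lebesgue_tuple R m]_(u in @simplex R m) (mnm_fun e u)%:E
   = (mnm_int natV m e)%:E)%E.
Proof.
elim: m e => [|m IH] e.
  rewrite /mnm_int big_geq// (_ : @simplex R 0 = setT); last first.
    by apply/seteqP; split=> // u _; split=> [[]|[]].
  rewrite (eq_measure_integral (\d_ ([tuple] : 0.-tuple RT)))//.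
  rewrite integral_dirac//; last by apply/measurable_EFinP; apply: measurable_mnm_fun.
  by rewrite diracT mul1e /mnm_fun big_ord0.
pose F (w : m.+1.-tuple RT) : \bar R := ((fun w => (mnm_fun e w)%:E) \_ (@simplex R m.+1)) w.
have F0 w : (0 <= F w)%E.
  rewrite /F patchE; case: ifPn => // /set_mem [w01 _]; rewrite lee_fin.
  by apply: prodr_ge0 => i _; apply: exprn_ge0; have /andP[] := w01 i.
have mF : measurable_fun setT F.
  have [H _] := measurable_restrictT (fun w => (mnm_fun e w)%:E) (@measurable_simplex m.+1).
  apply: H => //.
  apply/measurable_EFinP; apply: measurable_funTS; exact: measurable_mnm_fun.
rewrite integral_mkcond -/F.
rewrite (eq_measure_integral (pushforward (mu \x @lebesgue_tuple R m)%E (@tcons R m)))//.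
rewrite ge0_integral_pushforward//; last exact: measurable_tcons.
rewrite preimage_setT fubini_tonelli2//; last first.
- by move=> z; exact: F0.
- by apply: measurableT_comp => //; exact: measurable_tcons.
(* The exponents after the first integration; [psum e' k] equals [psum e k.+1]. *)
pose e' i := if i is 0 then (e 0 + e 1).+1%N else e i.+1.
have e'E : mnm_int natV m.+1 e = natV (e 0%N).+1 * mnm_int natV m e'.
  rewrite /mnm_int big_nat_recl//; congr (_ * _); first by rewrite /psum big_nat1.
  apply: eq_big_nat => k _; congr natV; elim: k => [|k IHk].
    by rewrite psumS !psum0 /e' addSn addnS.
  by rewrite psumS IHk [in RHS]psumS.
rewrite e'E EFinM -IH -ge0_integralZl//; last first.
- by rewrite lee_fin invr_ge0.
- move=> u [u01 _]; rewrite lee_fin.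
  by apply: prodr_ge0 => i _; apply: exprn_ge0; have /andP[] := u01 i.
- apply/measurable_EFinP; apply: measurable_funTS; exact: measurable_mnm_fun.
- exact: measurable_simplex.
rewrite [RHS]integral_mkcond; apply: eq_integral => u _ /=.
rewrite /fubini_G /= patchE; case: ifPn => [/set_mem su|/negP su]; last first.
  apply: integral0_eq => x _; rewrite /F patchE; case: ifPn => // /set_mem.
  by move=> /simplex_cons[su' _]; exfalso; apply: su; exact: mem_set.
have hd0 : 0 <= (head (1 : R) u : R).
  case: u su => -[|a s] //= us [u01 _].
  by case: m us u01 {IH F F0 mF e'E} => // m us /(_ ord0) /andP[].
pose b : R := head (1 : R) u.
transitivity ((mnm_fun (fun i => e i.+1) u)%:E *
    \int[mu]_(x in `[0%R, b]) (x ^+ e 0%N)%:E)%E.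
  rewrite -ge0_integralZl//; last first.
  - case: su => [u01 _]; rewrite lee_fin.
    by apply: prodr_ge0 => i _; apply: exprn_ge0; have /andP[] := u01 i.
  - move=> x; rewrite /= in_itv /= => /andP[x0 _].
    by rewrite lee_fin exprn_ge0.
  - apply/measurable_EFinP; exact: measurable_funX.
  rewrite [RHS]integral_mkcond; apply: eq_integral => x _.
  rewrite /F /= !patchE /tcons /=.
  have E : (([tuple of x :: u] : m.+1.-tuple RT) \in @simplex R m.+1)
      = (x \in [set` `[0, b]%R]).
    apply/idP/idP => [/set_mem/simplex_cons[_ xh]|/set_mem xh]; apply/mem_set.
      by rewrite /= in_itv.
    by apply/simplex_cons; split => //; move: xh; rewrite /= in_itv.
  rewrite E; case: ifP => // _.
  by rewrite -EFinM mnm_fun_cons mulrC.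
rewrite integral_exprn// -!EFinM; congr EFin; rewrite /b {b}.
rewrite /natV.
case: m u {IH F F0 mF su e'E} hd0 => [|m] u hd0.
  by rewrite /mnm_fun !big_ord0 tuple0 /= expr1n; ring.
rewrite /mnm_fun !big_ord_recl (tnth_nth (1:R)) nth0 /= -addSn exprD.
by rewrite /bump /=; ring.
Qed.

Lemma Rintegral_simplex m (f : {mpoly R[m]}) :
  \int[@lebesgue_tuple R m]_(u in @simplex R m) f.@[tnth u]
  = simplex_int natV f.
Proof.
have int1 e : (@lebesgue_tuple R m).-integrable (@simplex R m)
    (fun u => (mnm_fun e u)%:E).
  apply/integrableP; split.
    apply/measurable_EFinP; apply: measurable_funTS; exact: measurable_mnm_fun.
  rewrite (_ : (\int[_]_(u in _) _)%E = (mnm_int natV m e)%:E) ?ltry//.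
  rewrite -integral_mnm; apply: eq_integral => u /set_mem[u01 _].
  rewrite gee0_abs// lee_fin.
  by apply: prodr_ge0 => i _; apply: exprn_ge0; have /andP[] := u01 i.
rewrite /Rintegral.
rewrite (eq_integral (fun u => \sum_(k <- msupp f)
   ((f@_k)%:E * (mnm_fun (fun i => nth 0%N k i) u)%:E)))%E; last first.
  move=> u _; rewrite mevalE -sumEFin; apply: eq_bigr => k _.
  rewrite EFinM; congr (_ * _%:E)%E; apply: eq_bigr => i _.
  by rewrite -mnm_nth.
rewrite integral_sum; last 2 first.
- exact: measurable_simplex.
- by move=> k; apply: integrableZl => //; exact: measurable_simplex.
under eq_bigr => k _.
  rewrite integralZl//; last exact: measurable_simplex.
  rewrite integral_mnm -EFinM; over.
by rewrite sumEFin.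
Qed.

End SimplexLebesgue.

(** * Truncated exponentials *)

Section TruncatedExp.
Variables (A : comNzRingType) (fi : nat -> A).
Hypothesis fiK : forall k, k`!%:R * fi k = 1.

(** The inverse factorials [fi] are abstract, since the ring may consist of symbols or of
    polynomials with symbols as coefficients. *)
Definition texp M (x : A) : A := \sum_(k < M) fi k * x ^+ k.

Lemma fi0 : fi 0 = 1.
Proof. by have := fiK 0; rewrite fact0 mul1r. Qed.

Lemma fi1 : fi 1 = 1.
Proof. by have := fiK 1; rewrite mul1r. Qed.

Lemma fi_succ k : k.+1%:R * fi k.+1 = fi k.
Proof.
rewrite -[LHS]mul1r -{1}(fiK k).
transitivity ((k.+1`!%:R * fi k.+1) * fi k); last by rewrite fiK mul1r.
by rewrite factS natrM; ring.
Qed.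

Lemma fi_bin k i : (i <= k)%N -> fi k * 'C(k, i)%:R = fi i * fi (k - i).
Proof.
move=> ik; have := fiK k; rewrite -(bin_fact ik) !natrM.
have := fiK (k - i); have := fiK i.
set a := (i`!)%:R; set b := ((k - i)`!)%:R; set c := _%:R => aK bK cK.
transitivity (((a * fi i) * (b * fi (k - i))) * (fi k * c)).
  by rewrite aK bK !mul1r.
transitivity ((c * (a * b) * fi k) * (fi i * fi (k - i))); first by ring.
by rewrite cK mul1r.
Qed.

(** In the square of pairs i, j < M, those with i + j < M assemble to the truncated exponential of
    the sum by the binomial theorem; the others are the error. *)
Lemma texpM M x y : texp M x * texp M y
  = texp M (x + y)
    + \sum_(i < M) \sum_(j < M | (M <= i + j)%N) (fi i * x ^+ i) * (fi j * y ^+ j).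
Proof.
have -> : texp M (x + y) =
    \sum_(i < M) \sum_(j < M | ~~ (M <= i + j)%N) (fi i * x ^+ i) * (fi j * y ^+ j).
  pose h i j := (fi i * x ^+ i) * (fi j * y ^+ j).
  transitivity (\sum_(k < M) \sum_(i < M) \sum_(j < M | (i + j == k)%N) h i j).
    apply: eq_bigr => k _; rewrite addrC exprDn mulr_sumr.
    rewrite (big_ord_widen_cond M xpredT (fun i => fi k * (y ^+ (k - i) * x ^+ i *+ 'C(k, i))))//.
    rewrite big_mkcond /=; apply: eq_bigr => i _; rewrite ltnS.
    case: leqP => ik; last first.
      by rewrite big_pred0// => j; apply/negbTE; lia.
    have kiM : (k - i < M)%N by have := ltn_ord k; lia.
    rewrite (big_pred1 (Ordinal kiM)); last first.
      by move=> j; rewrite /= -val_eqE /=; lia.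
    rewrite /h /= -[_ *+ _]mulr_natr.
    transitivity ((fi k * 'C(k, i)%:R) * (x ^+ i * y ^+ (k - i))); first by ring.
    by rewrite fi_bin//; ring.
  rewrite exchange_big; apply: eq_bigr => i _ /=.
  rewrite (exchange_big_dep (fun j : 'I_M => ~~ (M <= i + j)%N)) /=; last first.
    by move=> k j _ /eqP E; have := ltn_ord k; lia.
  apply: eq_bigr => j ijM; have ijM' : (i + j < M)%N by lia.
  by rewrite (big_pred1 (Ordinal ijM')) // => k; rewrite /= -val_eqE eq_sym.
rewrite addrC -big_split /= /texp mulr_suml; apply: eq_bigr => i _.
by rewrite mulr_sumr (bigID (fun j : 'I_M => (M <= i + j)%N)).
Qed.

Lemma texp0 M : texp M.+1 0 = 1.
Proof.
rewrite /texp big_ord_recl /= fi0 mul1r big1 ?addr0// => i _.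
by rewrite expr0n mulr0.
Qed.

Lemma texp_split M x :
  texp M.+2 x = 1 + x + \sum_(i < M) fi i.+2 * x ^+ i.+2.
Proof.
by rewrite /texp !big_ord_recl /= fi0 fi1 !mul1r addrA expr0 expr1.
Qed.

End TruncatedExp.

Section TexpMap.
Variables (A B : comNzRingType) (f : {rmorphism A -> B}).
Variables (fiA : nat -> A) (fiB : nat -> B).
Hypothesis fiE : forall k, f (fiA k) = fiB k.

Lemma rmorph_texp M x : f (texp fiA M x) = texp fiB M (f x).
Proof.
rewrite rmorph_sum; apply: eq_bigr => k _.
by rewrite rmorphM rmorphXn /= fiE.
Qed.
End TexpMap.

Section TexpDeriv.
Variables (S : comNzRingType) (fi : nat -> S) (d : nat).
Hypothesis fiK : forall k, k`!%:R * fi k = 1.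

(** Differentiation costs one order of truncation. *)
Lemma mderiv_texp M (k : 'I_d) (F : {mpoly S[d]}) :
  (texp (fun j => (fi j)%:MP) M.+1 F)^`M(k)
  = texp (fun j => (fi j)%:MP) M F * F^`M(k).
Proof.
have pow j : (F ^+ j.+1)^`M(k) = j.+1%:R * (F ^+ j * F^`M(k)).
  elim: j => [|j IH]; first by rewrite expr1 expr0 !mul1r.
  by rewrite exprS mderivM IH -[in RHS]natr1 [F ^+ j.+1]exprS; ring.
rewrite /texp big_ord_recl /= expr0 mulr1 mderivD mderivC add0r linear_sum /=.
rewrite mulr_suml; apply: eq_bigr => i _; rewrite mderiv_mulC pow.
have := fi_succ fiK i => <-; rewrite mpolyCM rmorph_nat.
by rewrite /bump /= add1n; ring.
Qed.

End TexpDeriv.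

(** * Filtrations of the coefficients *)

Section Coefficients.
Variables (S : comNzRingType) (d : nat).

(** The family [G] below abstracts a multiplicative filtration of the coefficient ring. It is later
    taken to be a lower bound on the total order, a condition on the degree in one slot, or the
    kernel of a derivation. *)
Definition coefs (Q : S -> Prop) (F : {mpoly S[d]}) := forall m, Q F@_m.

Variable G : nat -> S -> Prop.
Hypotheses (G0 : forall k, G k 0) (GD : forall k x y, G k x -> G k y -> G k (x + y)).

Lemma G_sum k (I : Type) (r : seq I) (P : pred I) (E : I -> S) :
  (forall i, P i -> G k (E i)) -> G k (\sum_(i <- r | P i) E i).
Proof. by move=> E_; elim/big_ind: _ => //; exact: GD. Qed.

Lemma coefs_sum k (I : Type) (r : seq I) (P : pred I) (E : I -> {mpoly S[d]}) :
  (forall i, P i -> coefs (G k) (E i)) -> coefs (G k) (\sum_(i <- r | P i) E i).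
Proof. by move=> E_ m; rewrite linear_sum; apply: G_sum => i Pi; exact: E_. Qed.

Lemma coefsC k c : G k c -> coefs (G k) c%:MP.
Proof. by move=> Gc m; rewrite mcoeffC; case: eqP; rewrite ?mulr1 ?mulr0. Qed.

Hypotheses (GM : forall k l x y, G k x -> G l y -> G (k + l)%N (x * y)) (G1 : G 0 1).

Lemma coefsM k l x y :
  coefs (G k) x -> coefs (G l) y -> coefs (G (k + l)%N) (x * y).
Proof. by move=> Gx Gy m; rewrite mcoeffM; apply: G_sum => i _; exact: GM. Qed.

Lemma coefs_exp k x i : coefs (G k) x -> coefs (G (i * k)%N) (x ^+ i).
Proof.
move=> Gx; elim: i => [|i IH].
  by rewrite -[X in G X]/0%N; apply: coefsC.
by rewrite exprS mulSn; apply: coefsM.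
Qed.

Lemma coefs_simplex_int (iw : nat -> S) k F : (forall j, G 0 (iw j)) ->
  coefs (G k) F -> G k (simplex_int iw F).
Proof.
move=> Giw GF; apply: G_sum => m _; rewrite -[k]addn0; apply: GM; first exact: GF.
by rewrite /mnm_int; elim/big_ind: _ => // x y Gx Gy; exact: (GM Gx Gy).
Qed.

End Coefficients.

(** * Symbols of differential operators *)

Section Supports.
Variables (K : comNzRingType) (N : nat).

Definition supp_in (D : 'X_{1..N} -> bool) (P : {mpoly K[N]}) :=
  forall m, P@_m != 0 -> D m.

Lemma supp_in0 D : supp_in D 0.
Proof. by move=> m; rewrite mcoeff0 eqxx. Qed.

Lemma supp_inD D P Q : supp_in D P -> supp_in D Q -> supp_in D (P + Q).
Proof.
move=> DP DQ m; rewrite mcoeffD; have [/DP//|/negPn/eqP ->] := boolP (P@_m != 0).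
by rewrite add0r => /DQ.
Qed.

Lemma supp_inM (D1 D2 D3 : 'X_{1..N} -> bool) P Q :
  (forall m1 m2, D1 m1 -> D2 m2 -> D3 (m1 + m2)%MM) ->
  supp_in D1 P -> supp_in D2 Q -> supp_in D3 (P * Q).
Proof.
move=> D12 DP DQ m; apply: contraR => mD; rewrite mcoeffM big1// => k /eqP mk.
apply/eqP; apply: contraR mD => PQ; rewrite mk; apply: D12.
  by apply: DP; apply: contraNneq PQ => ->; rewrite mul0r.
by apply: DQ; apply: contraNneq PQ => ->; rewrite mulr0.
Qed.

Lemma supp_inX (D : 'X_{1..N} -> bool) m : D m -> supp_in D 'X_[m].
Proof. by move=> Dm m'; rewrite mcoeffX; case: (eqVneq m m') => [<-//|_]; rewrite eqxx. Qed.

Lemma supp_inC (D : 'X_{1..N} -> bool) c : D 0%MM -> supp_in D c%:MP.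
Proof.
move=> D0 m; rewrite mcoeffC; case: (eqVneq m 0%MM) => [->//|_].
by rewrite mulr0 eqxx.
Qed.

Lemma supp_inS (D D' : 'X_{1..N} -> bool) P :
  (forall m, D m -> D' m) -> supp_in D P -> supp_in D' P.
Proof. by move=> DD' DP m /DP /DD'. Qed.

End Supports.

(** * Renaming of variables *)

Section Renaming.
Variables (K : comNzRingType).

Definition mren N N' (h : 'I_N -> 'I_N') : {mpoly K[N]} -> {mpoly K[N']} :=
  comp_mpoly [tuple 'X_(h j) | j < N].

HB.instance Definition _ N N' h := GRing.RMorphism.copy (@mren N N' h)
  (comp_mpoly [tuple 'X_(h j) | j < N]).
HB.instance Definition _ N N' h := GRing.Linear.copy (@mren N N' h)
  (comp_mpoly [tuple 'X_(h j) | j < N]).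

Lemma mrenM N N' (h : 'I_N -> 'I_N') : {morph mren h : p q / p * q}.
Proof. exact: rmorphM. Qed.

Lemma mren_prod N N' (h : 'I_N -> 'I_N') (I : Type) (r : seq I) (P : pred I) F :
  mren h (\prod_(i <- r | P i) F i) = \prod_(i <- r | P i) mren h (F i).
Proof. exact: rmorph_prod. Qed.

Lemma mrenXU N N' (h : 'I_N -> 'I_N') j : mren h 'X_j = 'X_(h j).
Proof. by rewrite /mren comp_mpolyXU -tnth_nth tnth_mktuple. Qed.

Lemma mrenX N N' (h : 'I_N -> 'I_N') m :
  mren h 'X_[m] = \prod_j 'X_(h j) ^+ m j.
Proof.
by rewrite /mren comp_mpolyX; apply: eq_bigr => j _; rewrite tnth_mktuple.
Qed.

Lemma mpoly_rmorph_ext N (B : comNzRingType) (f g : {rmorphism {mpoly K[N]} -> B}) :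
  (forall c, f c%:MP = g c%:MP) -> (forall j, f 'X_j = g 'X_j) -> f =1 g.
Proof.
move=> EC EX p; rewrite (mpolyE p) !rmorph_sum; apply: eq_bigr => m _ /=.
rewrite -mul_mpolyC !rmorphM EC; congr (_ * _).
rewrite mpolyXE_id !rmorph_prod; apply: eq_bigr => j _.
by rewrite !rmorphXn /= EX.
Qed.

Lemma mren_comp N N' N'' (h : 'I_N -> 'I_N') (h' : 'I_N' -> 'I_N'') p :
  mren h' (mren h p) = mren (h' \o h) p.
Proof.
pose f : {rmorphism {mpoly K[N]} -> {mpoly K[N'']}} := (mren h' \o mren h)%FUN.
rewrite -[LHS]/(f p); apply: mpoly_rmorph_ext => [c|j]; rewrite /f /=.
  by rewrite /mren !comp_mpolyC.
by rewrite !mrenXU.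
Qed.

Lemma eq_mren N N' (h h' : 'I_N -> 'I_N') : h =1 h' -> mren h =1 mren h'.
Proof.
move=> E p; rewrite /mren; congr comp_mpoly; apply: eq_mktuple => j.
by rewrite E.
Qed.

Lemma mderiv_prod0 N l (I : Type) (r : seq I) (P : pred I) (F : I -> {mpoly K[N]}) :
  (forall i, P i -> (F i)^`M(l) = 0) -> (\prod_(i <- r | P i) F i)^`M(l) = 0.
Proof.
move=> F0; apply: (big_rec (fun x => x^`M(l) = 0)); first by rewrite -mpolyC1 mderivC.
by move=> i x Pi x0; rewrite mderivM F0// x0 mul0r mulr0 addr0.
Qed.

(** The chain rule: h may identify variables, and each one sent to l contributes. *)
Lemma mderiv_mren N N' (h : 'I_N -> 'I_N') l p :
  (mren h p)^`M(l) = \sum_(k | h k == l) mren h p^`M(k).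
Proof.
pose f : {linear {mpoly K[N]} -> {mpoly K[N']}} := (mderiv l \o mren h)%FUN.
pose g0 q := \sum_(k | h k == l) mren h q^`M(k).
have g0lin : linear g0.
  move=> c s t; rewrite /g0 scaler_sumr -big_split; apply: eq_bigr => k _ /=.
  by rewrite !linearP.
pose g : {linear {mpoly K[N]} -> {mpoly K[N']}} :=
  HB.pack g0 (GRing.isLinear.Build _ _ _ _ g0 g0lin).
rewrite -[RHS]/(g p) -[LHS]/(f p); apply: mpoly_linear_ext => m; rewrite /f /g /= /g0 {f g g0lin g0}.
have pw k j : ('X_(h k) ^+ j : {mpoly K[N']})^`M(l)
    = (h k == l)%:R * (j%:R * 'X_(h k) ^+ j.-1).
  elim: j => [|j IH]; first by rewrite expr0 -mpolyC1 mderivC mul0r mulr0.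
  rewrite exprS mderivM IH mderivX mnm1E.
  case: eqP => [->|_]; last by rewrite scale0r !mul0r mulr0 addr0.
  have -> : (U_(l) - U_(l) = 0 :> 'X_{1..N'})%MM by apply/mnmP => i; rewrite mnmBE subnn mnm0E.
  rewrite mpolyX0 scale1r !mul1r /=; case: j {IH} => [|j]; first by rewrite mul0r mulr0 addr0 mul1r.
  by rewrite -[in RHS]natr1 exprS /=; ring.
rewrite mrenX.
have der (r : seq 'I_N) : uniq r ->
    (\prod_(j <- r) 'X_(h j) ^+ m j : {mpoly K[N']})^`M(l)
    = \sum_(k <- r | h k == l) (m k)%:R * \prod_(j <- r) 'X_(h j) ^+ (m j - (j == k)).
  elim: r => [|k r IH] /=; first by rewrite !big_nil -mpolyC1 mderivC.
  move=> /andP[kr ur]; rewrite !big_cons mderivM IH// pw.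
  have E j : j \in r -> (j == k) = false.
    by move=> jr; apply/negbTE; apply: contraNneq kr => <-.
  rewrite (eq_big_seq (fun j => 'X_(h j) ^+ (m j - (j == k)))); last first.
    by move=> j jr; rewrite E// subn0.
  have -> : \sum_(j <- r | h j == l) (m j)%:R *
     \prod_(j0 <- k :: r) 'X_(h j0) ^+ (m j0 - (j0 == j)) =
     'X_(h k) ^+ m k * \sum_(j <- r | h j == l) (m j)%:R * 
      \prod_(j0 <- r) ('X_(h j0) : {mpoly K[N']}) ^+ (m j0 - (j0 == j)).
    rewrite mulr_sumr big_seq_cond [RHS]big_seq_cond; apply: eq_bigr => j /andP[jr _].
    by rewrite big_cons eq_sym E// subn0 mulrCA.
  rewrite (eq_big_seq (fun j => 'X_(h j) ^+ (m j - (j == k)))); last first.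
    by move=> j jr; rewrite E// subn0.
  rewrite eqxx subn1.
  case: eqP => _; rewrite ?mul1r ?mul0r ?add0r //.
  by rewrite !mulrA.
rewrite (der _ (index_enum_uniq _)); apply: eq_bigr => k _.
rewrite mderivX linearZ /= mrenX scaler_nat mulr_natl; congr (_ *+ _).
by apply: eq_bigr => j _; rewrite mnmBE mnm1E eq_sym.
Qed.

Lemma mcoeff0_mren N N' (h : 'I_N -> 'I_N') p : (mren h p)@_0%MM = p@_0%MM.
Proof.
pose f : {rmorphism {mpoly K[N]} -> K} := (mcoeff 0%MM \o mren h)%FUN.
rewrite -[LHS]/(f p); apply: mpoly_rmorph_ext => [c|j]; rewrite /f /=.
  by rewrite /mren comp_mpolyC !mcoeffC !eqxx.
by rewrite mrenXU !mcoeffX !mnm1_eq0.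
Qed.

End Renaming.

(* A polynomial P in K[N], read as a symbol, acts on K[N] as a differential
   operator with constant coefficients. *)
Section Symbols.
Variables (K : comNzRingType) (N : nat).
Local Notation W := {mpoly K[N]}.

Definition dop (P t : W) : W := @mlift N K W (fun m => t^`M[m]) P.

Lemma dopX m t : dop 'X_[m] t = t^`M[m].
Proof. exact: mliftX. Qed.

Lemma dop_linear_l t c P Q : dop (c *: P + Q) t = c *: dop P t + dop Q t.
Proof. exact: mlift_is_linear. Qed.
Definition dopr t P := dop P t.
Lemma dopr_linear t : linear (dopr t).
Proof. by move=> c P Q; exact: dop_linear_l. Qed.
HB.instance Definition _ t :=
  GRing.isLinear.Build K W W _ (dopr t) (dopr_linear t).

Lemma dop_suml t (I : Type) (r : seq I) (D : pred I) (F : I -> W) :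
  dop (\sum_(i <- r | D i) F i) t = \sum_(i <- r | D i) dop (F i) t.
Proof. exact: (raddf_sum (dopr t)). Qed.

Lemma dop_linear P : linear (dop P).
Proof.
move=> c s t; rewrite /dop /mlift scaler_sumr -big_split; apply: eq_bigr => m _ /=.
by rewrite linearP scalerDr !scalerA mulrC.
Qed.
HB.instance Definition _ P := GRing.isLinear.Build K W W _ (dop P) (dop_linear P).

Lemma dopM P Q t : dop (P * Q) t = dop P (dop Q t).
Proof.
apply: (@mpoly_linear_ext_fun _ _ _ (fun P => dop (P * Q) t)
  (fun P => dop P (dop Q t))) => [c x y|c x y|m].
- by rewrite mulrDl -scalerAl dop_linear_l.
- by rewrite dop_linear_l.
apply: (@mpoly_linear_ext_fun _ _ _ (fun Q => dop ('X_[m] * Q) t)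
  (fun Q => dop 'X_[m] (dop Q t))) => [c x y|c x y|m'].
- by rewrite mulrDr -scalerAr dop_linear_l.
- by rewrite dop_linear_l dop_linear.
rewrite -mpolyXD !dopX.
by rewrite addmC mderivmDm.
Qed.

Lemma dopZ c P t : dop (c%:MP * P) t = c *: dop P t.
Proof. by rewrite mul_mpolyC -[LHS]/(dopr t _) linearZ. Qed.

Lemma dop1 t : dop 1 t = t.
Proof. by rewrite -mpolyX0 dopX mderivm0m. Qed.

Lemma dopXU i t : dop 'X_i t = t^`M(i).
Proof. by rewrite dopX mderivmU1m. Qed.

Lemma dop_exp P k t : dop (P ^+ k) t = iter k (dop P) t.
Proof. by elim: k => [|k IH]; rewrite ?dop1// exprS dopM IH. Qed.

(** For this pairing, operations on polynomials have transposes on symbols: a derivative becomes a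
    multiplication, a multiplication by a variable becomes a derivative. *)
Definition sympair (P t : W) : K := (dop P t)@_0%MM.

Lemma sympair_linear P : linear_for *%R (sympair P).
Proof. by move=> c s t; rewrite /sympair linearP mcoeffD mcoeffZ. Qed.
HB.instance Definition _ P :=
  GRing.isLinear.Build K W K *%R (sympair P) (sympair_linear P).

Definition sympairr t P := sympair P t.
Lemma sympairr_linear t : linear_for *%R (sympairr t).
Proof.
move=> c P Q; rewrite /sympairr /sympair -3![dop _ t]/(dopr t _).
by rewrite linearP mcoeffD mcoeffZ.
Qed.
HB.instance Definition _ t :=
  GRing.isLinear.Build K W K *%R (sympairr t) (sympairr_linear t).

Lemma sympairD t P Q : sympair (P + Q) t = sympair P t + sympair Q t.
Proof. exact: (raddfD (sympairr t)). Qed.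

Lemma sympairB t P Q : sympair (P - Q) t = sympair P t - sympair Q t.
Proof. exact: (raddfB (sympairr t)). Qed.

Lemma sympair0 t : sympair 0 t = 0.
Proof. exact: (raddf0 (sympairr t)). Qed.

Lemma sympairZ t c P : sympair (c%:MP * P) t = c * sympair P t.
Proof. by rewrite mul_mpolyC -[LHS]/(sympairr t _) linearZ. Qed.

Lemma sympair_sum t (I : Type) (r : seq I) (D : pred I) (F : I -> W) :
  sympair (\sum_(i <- r | D i) F i) t = \sum_(i <- r | D i) sympair (F i) t.
Proof. exact: (raddf_sum (sympairr t)). Qed.

Lemma dop_supp (D : 'X_{1..N} -> bool) P t :
  supp_in D P -> (forall m, D m -> t^`M[m] = 0) -> dop P t = 0.
Proof.
move=> DP Dt; rewrite /dop /mlift big_seq big1// => m.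
by rewrite mcoeff_msupp => /DP /Dt ->; rewrite scaler0.
Qed.

(** This makes truncation harmless: its order only has to reach the size of the argument. *)
Lemma dop_high P t M : (msize t <= M)%N ->
  supp_in (fun m => M <= mdeg m)%N P -> dop P t = 0.
Proof.
move=> tM PM; apply: (dop_supp PM) => m Mm; apply/mpolyP => m'.
rewrite mcoeff_mderivm mcoeff0 memN_msupp_eq0 ?mul0rn//.
by rewrite msize_mdeg_ge// mdegD (leq_trans tM)// (leq_trans Mm)// leq_addr.
Qed.

(** The Heisenberg commutation relation; by linearity P may be a monomial, and induction on its
    degree applies Leibniz' rule. *)
Lemma dop_mulX P k t : dop P ('X_k * t) = 'X_k * dop P t + dop P^`M(k) t.
Proof.
apply: (@mpoly_linear_ext_fun _ _ _ (fun P => dop P ('X_k * t))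
  (fun P => 'X_k * dop P t + dop P^`M(k) t)) => [c x y|c x y|m].
- by rewrite dop_linear_l.
- rewrite linearP !dop_linear_l mulrDr -scalerAr scalerDr addrACA.
  by [].
rewrite !dopX mderivX -[dop (_ *: _) _]/(dopr t _) linearZ /= /dopr dopX.
suff H n : forall m, mdeg m = n -> ('X_k * t)^`M[m] =
    'X_k * t^`M[m] + (m k)%:R *: t^`M[m - U_(k)] by exact: (H _ m erefl).
elim: n => [|n IH] {}m mn.
  have -> : m = 0%MM by apply/eqP; rewrite -mdeg_eq0 mn.
  by rewrite !mderivm0m mnm0E scale0r addr0.
have [i mi] : exists i, m i != 0%N.
  apply/existsP; apply: contraPT mn => /existsPn m0.
  rewrite mdegE big1// => i _; by apply/eqP/negPn/m0.
pose m' := (m - U_(i))%MM.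
have mE : m = (m' + U_(i))%MM by rewrite submK// lep1mP.
have m'n : mdeg m' = n.
  by move: mn; rewrite mE mdegD mdeg1 addn1 => -[].
rewrite {1 2}mE !mderivmDm !mderivmU1m IH// mderivD mderivM mderivX mnm1E.
rewrite mderivZ -!mderivmU1m -!mderivmDm -mE -addrA addrC -addrA; congr (_ + _).
have [ki|ki] := eqVneq k i; last first.
  rewrite scale0r mul0r addr0; congr (_%:R *: _^`M[_]).
    by rewrite mE mnmDE mnm1E eq_sym (negPf ki) addn0.
  apply/mnmP => j; rewrite !(mnmDE, mnmBE, mnm1E).
  case: (eqVneq i j) => [<-|ij]; last by rewrite !addn0 subn0.
  by rewrite (negPf ki) !subn0 subnK// lt0n.
have mk : m k = (m' k).+1 by rewrite mE mnmDE mnm1E ki eqxx addn1.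
have -> : (m - U_(k))%MM = m' by rewrite /m' ki.
rewrite mk -ki; have -> : (U_(k) - U_(k) = 0 :> 'X_{1..N})%MM.
  by apply/mnmP => j; rewrite mnmBE subnn mnm0E.
rewrite mpolyX0 scale1r mul1r -natr1 scalerDl scale1r; congr (_ + _).
(* If m' k = 0 the truncated subtraction gives a different monomial, but its coefficient is zero. *)
have [m'k|m'k] := posnP (m' k); first by rewrite m'k !scale0r.
congr (_ *: _^`M[_]); apply/mnmP => j; rewrite mnmDE mnmBE mnm1E.
by case: eqVneq => [<-|_]; rewrite ?addn0 ?subn0// subnK.
Qed.

Lemma sympair_mulX P k t : sympair P ('X_k * t) = sympair P^`M(k) t.
Proof.
rewrite /sympair dop_mulX mcoeffD [X in X + _](_ : _ = 0) ?add0r//.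
by rewrite rmorphM /= mcoeffX mnm1_eq0 mul0r.
Qed.

Lemma sympair_high P t M : (msize t <= M)%N ->
  supp_in (fun m => M <= mdeg m)%N P -> sympair P t = 0.
Proof. by move=> tM PM; rewrite /sympair (dop_high tM PM) mcoeff0. Qed.

End Symbols.

(** * Transposes of renamings *)

Section RenamingDual.
Variables (K : comNzRingType) (N N' : nat) (h : 'I_N -> 'I_N').

(** By the chain rule, a derivative in the new variable l acts as the sum of the derivatives in the
    variables that h sends to l; this is the transpose of [mren h]. *)
Definition mren_dual : {mpoly K[N']} -> {mpoly K[N]} :=
  comp_mpoly [tuple \sum_(k | h k == l) 'X_k | l < N'].

HB.instance Definition _ := GRing.RMorphism.copy mren_dual
  (comp_mpoly [tuple \sum_(k | h k == l) 'X_k | l < N']).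
HB.instance Definition _ := GRing.Linear.copy mren_dual
  (comp_mpoly [tuple \sum_(k | h k == l) 'X_k | l < N']).

Lemma mren_dualXU l : mren_dual 'X_l = \sum_(k | h k == l) 'X_k.
Proof. by rewrite /mren_dual comp_mpolyXU -tnth_nth tnth_mktuple. Qed.

Lemma mren_dualC c : mren_dual c%:MP = c%:MP.
Proof. exact: comp_mpolyC. Qed.

Lemma dop_mren P t : dop P (mren h t) = mren h (dop (mren_dual P) t).
Proof.
pose f t : {linear {mpoly K[N']} -> {mpoly K[N']}} := (dopr (mren h t))%FUN.
pose g t : {linear {mpoly K[N']} -> {mpoly K[N']}} :=
  (mren h \o dopr t \o mren_dual)%FUN.
rewrite -[LHS]/(f t P) -[RHS]/(g t P); apply: mpoly_linear_ext => m.
rewrite /f /g /= /dopr {f g}.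
have XU l s : dop 'X_l (mren h s) = mren h (dop (mren_dual 'X_l) s).
  rewrite dopXU mderiv_mren mren_dualXU dop_suml linear_sum /=.
  by apply: eq_bigr => k _; rewrite dopXU.
rewrite mpolyXE_id rmorph_prod /=.
elim: (index_enum _) t => [|l r IH] t; first by rewrite !big_nil !dop1.
rewrite !big_cons !dopM IH rmorphXn /= !dop_exp.
by elim: (m l) => [|j IHj] //=; rewrite IHj XU.
Qed.

Lemma sympair_mren P t : sympair P (mren h t) = sympair (mren_dual P) t.
Proof. by rewrite /sympair dop_mren mcoeff0_mren. Qed.

End RenamingDual.

(** * Symbols on tensor powers *)

Section SlotSymbols.
Variables (K : comUnitRingType) (eps : K) (n : nat).
Hypothesis natU : forall k, (0 < k)%N -> (k%:R : K) \is a GRing.unit.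
Local Notation d := (2 * n)%N.
Local Notation tpow := (tpow K n).

Definition symp (A : comNzRingType) (y z : 'I_d -> A) : A :=
  \sum_(r < n) (y (pidx r) * z (qidx r) - y (qidx r) * z (pidx r)).

Definition slotX m (i : 'I_m) (l : 'I_d) : tpow m := 'X_(mxvec_index i l).

(* the symbol of [eps_alpha i j] *)
Definition wsym m (i j : 'I_m) : tpow m :=
  (eps * 2^-1)%:MP * symp (slotX i) (slotX j).

Definition ifact N k : {mpoly K[N]} := (k`!%:R^-1)%:MP.

Lemma ifactK N k : k`!%:R * ifact N k = 1.
Proof.
by rewrite /ifact -mpolyC_nat -mpolyCM divrr ?mpolyC1// natU// fact_gt0.
Qed.

Definition inat N k : {mpoly K[N]} := (k%:R^-1)%:MP.

Lemma inatK N k : (0 < k)%N -> k%:R * inat N k = 1.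
Proof. by move=> k0; rewrite /inat -mpolyC_nat -mpolyCM divrr ?mpolyC1// natU. Qed.

Lemma eps_alphaE m (i j : 'I_m) (t : tpow m) :
  eps_alpha eps i j t = dop (wsym i j) t.
Proof.
rewrite /eps_alpha /alpha /wsym dopZ scalerA; congr (_ *: _).
rewrite /symp dop_suml; apply: eq_bigr => r _.
rewrite -[RHS]/(dopr t _) raddfB /= /dopr !dopM !dopXU.
by rewrite /tderiv.
Qed.

Lemma lexpwE m (i j : 'I_m) M (t : tpow m) : (msize t <= M)%N ->
  lexp (eps_alpha eps i j) t = \sum_(k < M) k`!%:R^-1 *: iter k (eps_alpha eps i j) t.
Proof.
move=> tM; rewrite /lexp -(big_mkord xpredT (fun k => k`!%:R^-1 *: iter k (eps_alpha eps i j) t)).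
rewrite (fsbigE (index_iota 0 M)) ?iota_uniq//.
  by apply: eq_bigl => k; rewrite in_setT.
move=> k _; rewrite mem_index_iota /= -leqNgt => Mk.
have := msize_iter_eps_alpha eps i j k t.
have -> : (msize t - k = 0)%N by apply/eqP; rewrite subn_eq0 (leq_trans tM).
by rewrite leqn0 msize_poly_eq0 => /eqP ->; rewrite scaler0.
Qed.

Lemma lexpE m (i j : 'I_m) M (t : tpow m) : (msize t <= M)%N ->
  lexp (eps_alpha eps i j) t = dop (texp (@ifact _) M (wsym i j)) t.
Proof.
move=> /lexpwE ->; rewrite /texp dop_suml; apply: eq_bigr => k _.
rewrite /ifact dopZ dop_exp; congr (_ *: _).
by elim: (k : nat) => //= j' ->; rewrite eps_alphaE.
Qed.

Lemma tensE m (a : 'I_m -> weyl K n) :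
  tens a = \prod_(i < m) mren (mxvec_index i) (a i).
Proof. by []. Qed.

Definition vidx m (k : 'I_(m * d)) : 'I_m * 'I_d :=
  enum_val (cast_ord (esym (mxvec_cast m d)) k).

Lemma vidxK m (i : 'I_m) (l : 'I_d) : vidx (mxvec_index i l) = (i, l).
Proof. by rewrite /vidx /mxvec_index cast_ordK enum_rankK. Qed.

Lemma mxvec_index_eq m (i i' : 'I_m) (l l' : 'I_d) :
  (mxvec_index i l == mxvec_index i' l') = (i == i') && (l == l').
Proof.
apply/eqP/andP => [/(congr1 (@vidx m))|[/eqP-> /eqP->]//].
by rewrite !vidxK => -[-> ->].
Qed.

Lemma tmulE m (t : tpow m) : tmul t = mren (fun k => (@vidx m k).2) t.
Proof.
rewrite /tmul /mren; congr comp_mpoly; apply: eq_mktuple => k.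
by case/mxvec_indexP: k => i l; rewrite mxvecE mxE vidxK.
Qed.

(* [tren g] multiplies together the factors of a tensor whose slots have the
   same image under g, and [trdual g] is its transpose for [sympair]. *)
Definition tren m m' (g : 'I_m -> 'I_m') : tpow m -> tpow m' :=
  mren (fun k => mxvec_index (g (vidx k).1) (vidx k).2).
Definition trdual m m' (g : 'I_m -> 'I_m') : tpow m' -> tpow m :=
  mren_dual (fun k => mxvec_index (g (vidx k).1) (vidx k).2).
HB.instance Definition _ m m' (g : 'I_m -> 'I_m') :=
  GRing.RMorphism.copy (tren g) (mren _).
HB.instance Definition _ m m' (g : 'I_m -> 'I_m') :=
  GRing.Linear.copy (tren g) (mren _).
HB.instance Definition _ m m' (g : 'I_m -> 'I_m') :=
  GRing.RMorphism.copy (trdual g) (mren_dual _).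
HB.instance Definition _ m m' (g : 'I_m -> 'I_m') :=
  GRing.Linear.copy (trdual g) (mren_dual _).

Lemma trdual_slotX m m' (g : 'I_m -> 'I_m') i l :
  trdual g (slotX i l) = \sum_(s | g s == i) slotX s l.
Proof.
rewrite /trdual mren_dualXU big_mkcond (reindex _ (curry_mxvec_bij m d)) -big_mkcond /=.
rewrite (eq_bigl (fun p : 'I_m * 'I_d => (g p.1 == i) && (p.2 == l))); last first.
  by case=> s l' /=; rewrite vidxK mxvec_index_eq.
rewrite (eq_bigr (fun p => slotX p.1 p.2)); last by case.
rewrite -(pair_big (fun s => g s == i) (fun l' => l' == l)
  (fun s l' => slotX s l')) /=.
by apply: eq_bigr => s _; rewrite big_pred1_eq.
Qed.

Lemma sympair_tren m m' (g : 'I_m -> 'I_m') (P : tpow m') (t : tpow m) :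
  sympair P (tren g t) = sympair (trdual g P) t.
Proof. exact: sympair_mren. Qed.

Lemma tren_tens m m' (g : 'I_m -> 'I_m') (a : 'I_m -> weyl K n) :
  tren g (tens a) = tens (fun i => \prod_(s | g s == i) a s).
Proof.
rewrite !tensE rmorph_prod (partition_big g xpredT)//=; apply: eq_bigr => i _.
rewrite rmorph_prod; apply: eq_bigr => s /eqP gs.
by rewrite /tren mren_comp; apply: eq_mren => l /=; rewrite vidxK /= gs.
Qed.

(** The star product is computed in the tensor square. Injecting its variables into the slots s and
    s' and multiplying by the other factors ([Phi]) commutes with the derivatives in these slots,
    hence with the exponential; g then multiplies the two slots. *)
Lemma star_tens m m' (g : 'I_m -> 'I_m') (s s' : 'I_m) (i : 'I_m') (a : 'I_m -> weyl K n) :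
  s != s' -> (forall r, (g r == i) = (r == s) || (r == s')) ->
  tren g (lexp (eps_alpha eps s s') (tens a))
  = tens (fun k => if k == i then star eps (a s) (a s') else \prod_(r | g r == k) a r).
Proof.
move=> ss' gE.
pose h (k : 'I_(2 * d)) := mxvec_index (if (vidx k).1 == ord0 then s else s') (vidx k).2.
have h0 l : h (mxvec_index ord0 l) = mxvec_index s l by rewrite /h vidxK eqxx.
have h1 l : h (mxvec_index ord_max l) = mxvec_index s' l by rewrite /h vidxK.
have hinj k k' : (h k == h k') = (k == k').
  case/mxvec_indexP: k => j l; case/mxvec_indexP: k' => j' l'.
  rewrite /h !vidxK !mxvec_index_eq /=; congr (_ && _).
  case: j => -[|[|//]] ?; case: j' => -[|[|//]] ? //=; rewrite ?eqxx//.
    by rewrite (negPf ss').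
  by rewrite eq_sym (negPf ss').
pose Rst : tpow m := \prod_(r | (r != s) && (r != s')) mren (mxvec_index r) (a r).
pose Phi (T : tpow 2) : tpow m := mren h T * Rst.
have PhiZ c T : Phi (c *: T) = c *: Phi T by rewrite /Phi linearZ -scalerAl.
have PhiB T T' : Phi (T - T') = Phi T - Phi T' by rewrite /Phi raddfB mulrBl.
have Phi_sum q (F : 'I_q -> tpow 2) : Phi (\sum_i F i) = \sum_i Phi (F i).
  by rewrite /Phi raddf_sum mulr_suml.
have Phi_der k T : (Phi T)^`M(h k) = Phi T^`M(k).
  rewrite /Phi mderivM mderiv_mren (big_pred1 k) => [|k']; last by rewrite /= hinj.
  rewrite [X in _ + X](_ : _ = 0) ?addr0// mderiv_prod0 ?mulr0// => r /andP[rs rs'].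
  rewrite mderiv_mren big_pred0// => l; rewrite /h mxvec_index_eq.
  by case: ifP => _; rewrite ?(negPf rs) ?(negPf rs').
have Phi_eps T : eps_alpha eps s s' (Phi T) = Phi (eps_alpha eps ord0 ord_max T).
  rewrite /eps_alpha /alpha !PhiZ Phi_sum.
  congr (_ *: (_ *: _)); apply: eq_bigr => r _; rewrite PhiB.
  by rewrite /tderiv -!h0 -!h1 !Phi_der.
pose b : 'I_2 -> weyl K n := fun k => if k == ord0 then a s else a s'.
have Phi_tens : Phi (tens b) = tens a.
  have -> : tens a = mren (mxvec_index s) (a s) * (mren (mxvec_index s') (a s') * Rst).
    rewrite tensE (bigD1 s)//=; congr (_ * _); rewrite (bigD1 s')//=.
    by rewrite eq_sym.
  have E0 : mren h (mren (mxvec_index ord0) (b ord0)) = mren (mxvec_index s) (a s).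
    by rewrite mren_comp; apply: eq_mren => l /=; rewrite h0.
  have E1 : mren h (mren (mxvec_index (lift ord0 ord0)) (b (lift ord0 ord0)))
      = mren (mxvec_index s') (a s').
    rewrite mren_comp; apply: eq_mren => l /=; rewrite -h1; congr h.
    by congr mxvec_index; apply: val_inj.
  by rewrite /Phi tensE big_ord_recl big_ord1 mrenM E0 E1 mulrA.
have Phi_lexp T : lexp (eps_alpha eps s s') (Phi T) = Phi (lexp (eps_alpha eps ord0 ord_max) T).
  pose M := maxn (msize T) (msize (Phi T)).
  rewrite !(@lexpwE _ _ _ M) ?leq_maxl ?leq_maxr// Phi_sum; apply: eq_bigr => k _.
  rewrite PhiZ; congr (_ *: _); elim: (k : nat) => //= j ->.
  by rewrite Phi_eps.
rewrite -Phi_tens Phi_lexp /Phi /tren mrenM [in RHS]tensE (bigD1 i)//= eqxx.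
congr (_ * _).
  rewrite /star tmulE !mren_comp; apply: eq_mren => k /=.
  rewrite /h vidxK /=; congr mxvec_index.
  have gs : g s = i by apply/eqP; rewrite gE eqxx.
  have gs' : g s' = i by apply/eqP; rewrite gE eqxx orbT.
  by case: ifP.
rewrite mren_prod (partition_big g (fun k => k != i)) => /= [|r]; last first.
  by rewrite gE negb_or.
apply: eq_bigr => k ki; rewrite (negPf ki) mren_prod; apply: eq_big => [r|r /andP[_ /eqP grk]].
  by case: (eqVneq (g r) k) => [E|]; rewrite ?andbF// andbT -negb_or -gE E.
by rewrite mren_comp; apply: eq_mren => l /=; rewrite vidxK /= grk.
Qed.

End SlotSymbols.

Arguments slotX {K n m} i l.
Arguments wsym {K} eps {n m} i j.

(** * The symbol of the cochain *)

Section Congruence.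
Variables (S : comNzRingType) (d : nat) (G : nat -> S -> Prop) (fi : nat -> S).
Hypotheses (fiK : forall k, k`!%:R * fi k = 1) (Gfi : forall k, G 0 (fi k)).
Hypotheses (G0 : forall k, G k 0) (G1 : G 0 1).
Hypothesis GD : forall k x y, G k x -> G k y -> G k (x + y).
Hypothesis GM : forall k l x y, G k x -> G l y -> G (k + l)%N (x * y).
Hypothesis GS : forall k l x, (l <= k)%N -> G k x -> G l x.
Local Notation fiu := (fun k => (fi k)%:MP : {mpoly S[d]}).
Local Notation cG := (fun k => coefs (G k)).

Lemma fiuK k : k`!%:R * fiu k = 1.
Proof. by rewrite -mpolyC_nat -mpolyCM fiK mpolyC1. Qed.

Lemma coefs_texp_term k x i : coefs (G k) x -> coefs (G (i * k)%N) (fiu i * x ^+ i).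
Proof.
move=> Gx; rewrite -[(i * k)%N]add0n; apply: coefsM => //; last exact: coefs_exp.
exact: coefsC.
Qed.

Lemma coefs_texp M x : coefs (G 0) x -> coefs (G 0) (texp fiu M x).
Proof.
move=> Gx; apply: coefs_sum => // i _.
by have := coefs_texp_term i Gx; rewrite muln0.
Qed.

Lemma coefsS k l x : (l <= k)%N -> coefs (G k) x -> @coefs S d (G l) x.
Proof. by move=> lk Gx m; exact: GS (Gx m). Qed.

Lemma coefsD k x y : coefs (G k) x -> coefs (G k) y -> @coefs S d (G k) (x + y).
Proof. by move=> Gx Gy m; rewrite mcoeffD; apply: GD. Qed.

(** Every error term contains at least M factors of order 1. *)
Lemma texpM_congr M x y : coefs (G 1) x -> coefs (G 1) y ->
  coefs (G M) (texp fiu M x * texp fiu M y - texp fiu M (x + y)).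
Proof.
move=> Gx Gy; rewrite (texpM fiuK) addrAC subrr add0r.
apply: coefs_sum => // i _; apply: coefs_sum => // j ij.
apply: (coefsS ij); apply: coefsM => //.
  by have := coefs_texp_term i Gx; rewrite muln1.
by have := coefs_texp_term j Gy; rewrite muln1.
Qed.

Lemma texp_prod_congr M (I : Type) (r : seq I) (z : I -> {mpoly S[d]}) :
  (forall i, coefs (G 1) (z i)) ->
  coefs (G M) (\prod_(i <- r) texp fiu M (z i) - texp fiu M (\sum_(i <- r) z i)).
Proof.
move=> Gz; elim: r => [|i r IH].
  rewrite !big_nil; case: M => [|M].
    by rewrite /texp big_ord0 subr0 -mpolyC1; apply: coefsC.
  by rewrite (texp0 fiuK) subrr => m; rewrite mcoeff0.
rewrite !big_cons.
set P := \prod_(j <- r) _ in IH *; set Z := \sum_(j <- r) _ in IH *.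
have E (a b c e : {mpoly S[d]}) : a * b - e = a * (b - c) + (a * c - e).
  by ring.
rewrite (E _ _ (texp fiu M Z)).
have GZ : coefs (G 1) Z by apply: coefs_sum.
apply: coefsD; last exact: texpM_congr.
rewrite -[M in G M]add0n; apply: coefsM => //; apply: coefs_texp.
exact: (@coefsS 1 0).
Qed.

End Congruence.

Section MapSimplex.
Variables (S S' : comNzRingType) (f : {rmorphism S -> S'}).

Lemma map_spt d k : map_mpoly f (spt S d k) = spt S' d k.
Proof.
case: k => [|k]; first exact: raddf0.
by rewrite /spt; case: insub => [i|]; rewrite ?rmorph1// map_mpolyX.
Qed.

Lemma simplex_int_map (iw : nat -> S) (iw' : nat -> S') d (F : {mpoly S[d]}) :
  (forall k, f (iw k) = iw' k) ->
  f (simplex_int iw F) = simplex_int iw' (map_mpoly f F).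
Proof.
move=> fiw; pose w := maxn (msize F) (msize (map_mpoly f F)).
rewrite /simplex_int !(@mliftwE _ _ _ _ w) ?leq_maxl ?leq_maxr// rmorph_sum.
apply: eq_bigr => m _; rewrite mcoeff_map_mpoly [RHS]/(_ * _) -[_ *: _]/(_ * _).
by rewrite rmorphM /mnm_int rmorph_prod; congr (_ * _); apply: eq_bigr => k _.
Qed.

End MapSimplex.

Section SimplexLinear.
Variables (S : comNzRingType) (iw : nat -> S) (d : nat).
Implicit Types F : {mpoly S[d]}.

Lemma simplex_intMC F c : simplex_int iw (F * c%:MP) = simplex_int iw F * c.
Proof. by rewrite [F * _]mulrC mul_mpolyC simplex_intZ mulrC. Qed.

Lemma simplex_intB F F' :
  simplex_int iw (F - F') = simplex_int iw F - simplex_int iw F'.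
Proof. exact: raddfB. Qed.

Lemma simplex_intD F F' :
  simplex_int iw (F + F') = simplex_int iw F + simplex_int iw F'.
Proof. exact: raddfD. Qed.

Lemma simplex_int_sum (I : Type) (r : seq I) (P : pred I) (F : I -> {mpoly S[d]}) :
  simplex_int iw (\sum_(i <- r | P i) F i)
  = \sum_(i <- r | P i) simplex_int iw (F i).
Proof. exact: raddf_sum. Qed.

End SimplexLinear.

Section TotalDegree.
Variables (K : comNzRingType) (N : nat).

Definition ord_ge k (P : {mpoly K[N]}) := supp_in (fun m => k <= mdeg m)%N P.

Lemma ord_ge0 P : ord_ge 0 P. Proof. by []. Qed.

Lemma ord_geM k l P Q : ord_ge k P -> ord_ge l Q -> ord_ge (k + l)%N (P * Q).
Proof. by apply: supp_inM => m1 m2 k1 l2; rewrite mdegD leq_add. Qed.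

Lemma ord_geS k l P : (l <= k)%N -> ord_ge k P -> ord_ge l P.
Proof. by move=> lk; apply: supp_inS => m; exact: leq_trans. Qed.

Lemma ord_geMl k P Q : ord_ge k Q -> ord_ge k (P * Q).
Proof. by move=> kQ; rewrite -[k]add0n; apply: ord_geM. Qed.

Lemma ord_geMr k P Q : ord_ge k P -> ord_ge k (P * Q).
Proof. by move=> kP; rewrite mulrC; apply: ord_geMl. Qed.

End TotalDegree.

(** * The cochain as a pairing with a symbol *)

Section TauFormula.
Variables (K : comUnitRingType) (eps : K) (n : nat).
Variables (R : realType) (emb : {rmorphism R -> K}).
Local Notation d := (2 * n)%N.
Local Notation tpow := (tpow K n).

Lemma natU k : (0 < k)%N -> (k%:R : K) \is a GRing.unit.
Proof.
by move=> k0; rewrite -(rmorph_nat emb) rmorph_unit// unitfE pnatr_eq0 -lt0n.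
Qed.

(** The values W are left free: the same exponent is needed for the symbols w_ij, for their
    pullbacks along slot maps and for their constant terms. *)
Definition Xpol (S : comNzRingType) e q (W : 'I_q -> 'I_q -> S) : {mpoly S[e]} :=
  \sum_(i < q) \sum_(j < q | (i < j)%N)
    (2 * spt S e i - 2 * spt S e j + 1) * (W i j)%:MP.

Lemma sum_slot_pair (V : nmodType) q (F : 'I_q -> 'I_q -> V) :
  \sum_(p : slot_pair q) F (val p).1 (val p).2
  = \sum_(i < q) \sum_(j < q | (i < j)%N) F i j.
Proof.
rewrite pair_big_dep /=.
exact/esym/(big_sub [pred p : 'I_q * 'I_q | (p.1 < p.2)%N] (fun p => F p.1 p.2)).
Qed.

Lemma meval_spt e (u : e.-tuple R) (k : 'I_e.+1) :
  (spt R e k).@[tnth u] = tnth [tuple of (0 : R) :: u] k.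
Proof.
case: (unliftP ord0 k) => [j|] ->; last by rewrite tnth0 /= meval0.
rewrite tnthS lift0 /spt insubT; first exact: ltn_ord.
move=> jP; rewrite mevalXU; congr tnth; exact: val_inj.
Qed.

Lemma ord_wsym m (i j : 'I_m) : ord_ge 1 (wsym eps i j : tpow m).
Proof.
apply: ord_geMl.
have slot1 (s : 'I_m) l : ord_ge 1 (slotX s l : tpow m).
  by apply: supp_inX; rewrite mdeg1.
rewrite /symp; elim/big_ind: _ => [|x y|r _]; first exact: supp_in0.
  exact: supp_inD.
by apply: supp_inD; rewrite -1?mulN1r; [|apply: ord_geMl]; apply: ord_geMr.
Qed.

Definition detsym : tpow d.+1 :=
  \det (\matrix_(k < d, l < d) slotX (lift ord0 k) l).

(** Leibniz' formula for the determinant. *)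
Lemma antisymE t : antisym t = dop detsym t.
Proof.
rewrite /antisym /detsym /determinant dop_suml; apply: eq_bigr => s _.
have -> : (-1) ^+ s = ((-1) ^+ s)%:MP :> tpow d.+1 by rewrite rmorph_sign.
rewrite dopZ; congr (_ *: _); rewrite -dopX; congr dop.
by rewrite -mprodXE; apply: eq_bigr => k _; rewrite mxE.
Qed.

Lemma taylor_opE N (t : tpow d.+1) : taylor_op eps N t =
  dop (\prod_(p : slot_pair d.+1) wsym eps (val p).1 (val p).2 ^+ N p) t.
Proof.
rewrite /taylor_op; elim/big_rec2: _ t => [t|p P f _ IH t]; first by rewrite dop1.
rewrite dopM -IH dop_exp /=.
by elim: (N p) => //= j ->; rewrite eps_alphaE.
Qed.

Local Notation iS := (inat K (d.+1 * d)).
Local Notation fiS := (ifact K (d.+1 * d)).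

Definition tausym M : tpow d.+1 :=
  simplex_int iS (texp (fun k => (fiS k)%:MP) M (@Xpol (tpow d.+1) d _ (wsym eps)))
  * detsym.

(** Families N with an entry at least M act by zero. The sum over the others factors into truncated
    exponentials, one for each pair of slots; by [texp_prod_congr] their product is the truncated
    exponential of the sum up to order M, and symbols of that order annihilate t. *)
Lemma tauE M t : (msize t <= M)%N -> tau eps emb t = sympair (tausym M) t.
Proof.
move=> tM; pose P := slot_pair d.+1.
pose c (S : comNzRingType) (p : P) : {mpoly S[d]} :=
  2 * spt S d (val p).1 - 2 * spt S d (val p).2 + 1.
pose w (p : P) : tpow d.+1 := wsym eps (val p).1 (val p).2.
pose ifK k : K := k`!%:R^-1.
pose ifR k : R := k`!%:R^-1.
pose cN (S : comNzRingType) (fi : nat -> S) (N : P -> nat) : {mpoly S[d]} :=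
  \prod_p (c S p ^+ N p * (fi (N p))%:MP).
have embV k : emb k%:R^-1 = k%:R^-1.
  have [->|k0] := posnP k; first by rewrite !invr0 rmorph0.
  by rewrite rmorphV ?rmorph_nat// unitfE pnatr_eq0 -lt0n.
have taylorE N : emb (taylor_int R N) = simplex_int (fun k => k%:R^-1) (cN K ifK N).
  have -> : taylor_int R N = simplex_int (fun k => k%:R^-1 : R) (cN R ifR N).
    rewrite -Rintegral_simplex; apply: eq_Rintegral => u _.
    rewrite rmorph_prod; apply: eq_bigr => p _ /=.
    rewrite rmorphM rmorphXn /= mevalC /c rmorphD rmorphB !rmorphM /= !meval_spt.
    by rewrite meval1 rmorph_nat.
  rewrite (simplex_int_map (iw' := fun k => k%:R^-1))//; congr simplex_int.
  rewrite /cN rmorph_prod; apply: eq_bigr => p _.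
  rewrite rmorphM rmorphXn /= map_mpolyC.
  congr (_ * _); last by congr (_%:MP); exact: embV.
  congr (_ ^+ _).
  by rewrite /c rmorphD rmorphB !rmorphM /= !map_spt rmorph1 rmorph_nat.
pose term N : tpow d.+1 := ((emb (taylor_int R N))%:MP * (\prod_p w p ^+ N p)) * detsym.
have termE (N : {ffun P -> nat}) :
    (emb (taylor_int R N) *: taylor_op eps N (antisym t)) = dop (term N) t.
  by rewrite antisymE taylor_opE dopM dopZ.
have high (N : {ffun P -> nat}) p : (M <= N p)%N -> dop (term N) t = 0.
  move=> MN; apply: (dop_high tM); apply: (ord_geS MN).
  rewrite /term (bigD1 p)//=; apply/ord_geMr/ord_geMl/ord_geMr.
  elim: (N p) => [|k IH]; first exact: ord_ge0.
  by rewrite exprS; apply: (@ord_geM _ _ 1 k) => //; exact: ord_wsym.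
pose h (N : {ffun P -> 'I_M}) : {ffun P -> nat} := [ffun p => N p : nat].
rewrite /tau (fsbigE [seq h N | N <- enum {: {ffun P -> 'I_M}}]) => [||//|]; first last.
- move=> N _; rewrite termE => NM.
  have /existsP[p] : [exists p, M <= N p]%N.
    apply: contraR NM => /existsPn NM; apply/mapP.
    have NM' p : (N p < M)%N by rewrite ltnNge NM.
    exists [ffun p => Ordinal (NM' p)]; first by rewrite mem_enum.
    by apply/ffunP => p; rewrite !ffunE.
  by move=> /high.
- rewrite map_inj_uniq ?enum_uniq// => N N' /ffunP NN'; apply/ffunP => p.
  by have := NN' p; rewrite !ffunE => /val_inj.
rewrite (eq_bigl xpredT) => [|N]; last by rewrite in_setT.
rewrite big_map big_enum /= (eq_bigr (fun N => dop (term (h N)) t)) => [|N _];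
  last by rewrite termE.
rewrite -dop_suml -[LHS]/(sympair _ _).
pose z p : {mpoly (tpow d.+1)[d]} := c (tpow d.+1) p * (w p)%:MP.
pose E := \prod_p texp (fun k => (fiS k)%:MP : {mpoly (tpow d.+1)[d]}) M (z p).
have -> : \sum_(N : {ffun P -> 'I_M}) term (h N) = simplex_int iS E * detsym.
  rewrite /E /texp bigA_distr_bigA simplex_int_sum mulr_suml.
  apply: eq_bigr => N _; rewrite /term taylorE; congr (_ * detsym).
  rewrite (simplex_int_map (f := @mpolyC _ K) (iw' := iS))//.
  rewrite -simplex_intMC; congr simplex_int.
  rewrite /cN !rmorph_prod -big_split; apply: eq_bigr => p _ /=.
  rewrite /h ffunE rmorphM !rmorphXn /= map_mpolyC /z exprMn.
  have -> : map_mpoly (@mpolyC _ K) (c K p) = c (tpow d.+1) p.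
    by rewrite /c rmorphD rmorphB !rmorphM /= !map_spt rmorph1 rmorph_nat.
  by rewrite /ifact [RHS]mulrA [X in _ = X * _]mulrC.
rewrite /tausym; have -> : @Xpol (tpow d.+1) d _ (wsym eps) = \sum_p z p.
  exact/esym/(sum_slot_pair (fun i j : 'I_d.+1 =>
    (2 * spt (tpow d.+1) d i - 2 * spt (tpow d.+1) d j + 1) * (wsym eps i j)%:MP)).
apply/eqP; rewrite -subr_eq0 -sympairB -mulrBl -simplex_intB; apply/eqP.
apply: (sympair_high tM); apply: ord_geMr.
apply: (coefs_simplex_int (G := fun k => @ord_ge K (d.+1 * d) k)) => //.
- by move=> k; exact: supp_in0.
- by move=> k x y; exact: supp_inD.
- by move=> k l x y; exact: ord_geM.
apply: texp_prod_congr => //.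
- by move=> k; apply: ifactK; exact: natU.
- by move=> k; exact: supp_in0.
- by move=> k x y; exact: supp_inD.
- by move=> k l x y; exact: ord_geM.
- by move=> k l x; exact: ord_geS.
move=> p m; rewrite /z mulrC mul_mpolyC mcoeffZ.
by apply: ord_geMr; exact: ord_wsym.
Qed.

End TauFormula.

(** * Cocycle property *)

Section SlotExponent.
Variables (K : comUnitRingType) (eps : K) (n : nat).
Local Notation d := (2 * n)%N.
Local Notation tpow := (tpow K n).

Lemma sympair_dop N (P Q t : {mpoly K[N]}) :
  sympair P (dop Q t) = sympair (P * Q) t.
Proof. by rewrite /sympair dopM. Qed.

Lemma rmorph_symp (A B : comNzRingType) (f : {rmorphism A -> B}) (y z : 'I_d -> A) :
  f (symp y z) = symp (fun l => f (y l)) (fun l => f (z l)).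
Proof.
rewrite /symp rmorph_sum; apply: eq_bigr => r _.
by rewrite rmorphB !rmorphM.
Qed.

Lemma symp_suml (A : comNzRingType) (I : finType) (P : pred I)
    (y : I -> 'I_d -> A) (z : 'I_d -> A) :
  symp (fun l => \sum_(s | P s) y s l) z = \sum_(s | P s) symp (y s) z.
Proof.
rewrite /symp exchange_big; apply: eq_bigr => r _ /=.
by rewrite !mulr_suml -sumrB.
Qed.

Lemma sympC (A : comNzRingType) (y z : 'I_d -> A) : symp z y = - symp y z.
Proof.
rewrite /symp -sumrN; apply: eq_bigr => r _.
by rewrite opprB mulrC [z (qidx r) * _]mulrC.
Qed.

Lemma symp_sumr (A : comNzRingType) (I : finType) (P : pred I)
    (y : 'I_d -> A) (z : I -> 'I_d -> A) :
  symp y (fun l => \sum_(s | P s) z s l) = \sum_(s | P s) symp y (z s).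
Proof.
rewrite sympC symp_suml -sumrN; apply: eq_bigr => s _; exact/esym/sympC.
Qed.

Lemma wsymC m (i j : 'I_m) : wsym eps j i = - wsym eps i j :> tpow m.
Proof. by rewrite /wsym sympC mulrN. Qed.

Lemma wsymii m (i : 'I_m) : wsym eps i i = 0 :> tpow m.
Proof.
rewrite /wsym /symp big1 ?mulr0// => r _.
by rewrite mulrC subrr.
Qed.

Lemma trdual_wsym m m' (g : 'I_m -> 'I_m') (i i' : 'I_m') :
  trdual g (wsym eps i i')
  = \sum_(s | g s == i) \sum_(s' | g s' == i') wsym eps s s' :> tpow m.
Proof.
rewrite /wsym rmorphM /= {1}/trdual mren_dualC rmorph_symp.
rewrite (_ : symp _ _ = symp (fun l => \sum_(s | g s == i) slotX s l)
   (fun l => \sum_(s | g s == i') slotX s l) :> tpow m); last first.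
  by congr symp; apply/funext => l; rewrite /= trdual_slotX.
rewrite symp_suml mulr_sumr; apply: eq_bigr => s _.
by rewrite symp_sumr mulr_sumr.
Qed.

Definition Xcoef (S : comNzRingType) e (k l : nat) : {mpoly S[e]} :=
  2 * spt S e k - 2 * spt S e l + 1.

Lemma XpolE (S : comNzRingType) e q (W : 'I_q -> 'I_q -> S) :
  Xpol e W = \sum_(i < q) \sum_(j < q | (i < j)%N) Xcoef S e i j * (W i j)%:MP.
Proof. by []. Qed.

Lemma map_Xpol (S S' : comNzRingType) (f : {rmorphism S -> S'}) e q
    (W : 'I_q -> 'I_q -> S) :
  map_mpoly f (Xpol e W) = Xpol e (fun i j => f (W i j)).
Proof.
rewrite /Xpol rmorph_sum; apply: eq_bigr => i _.
rewrite rmorph_sum; apply: eq_bigr => j _ /=.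
rewrite rmorphM rmorphD rmorphB !rmorphM /= !map_spt rmorph1 rmorph_nat.
by rewrite map_mpolyC.
Qed.

(** Pairs of slots that g identifies drop out; for a merged pair, the star product supplies the
    missing term. *)
Lemma Xpol_pull (S : comNzRingType) e m q (g : 'I_m -> 'I_q) (W : 'I_m -> 'I_m -> S) :
  Xpol e (fun i i' => \sum_(s | g s == i) \sum_(s' | g s' == i') W s s')
  = \sum_s \sum_(s' | (g s < g s')%N) Xcoef S e (g s) (g s') * (W s s')%:MP.
Proof.
rewrite XpolE [RHS](partition_big g xpredT)//=; apply: eq_bigr => i _.
transitivity (\sum_(i' < q | (i < i')%N) \sum_(s | g s == i) \sum_(s' | g s' == i')
   Xcoef S e (g s) (g s') * (W s s')%:MP).
  apply: eq_bigr => i' _; rewrite raddf_sum mulr_sumr; apply: eq_bigr => s /eqP gs.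
  by rewrite raddf_sum mulr_sumr; apply: eq_bigr => s' /eqP gs'; rewrite gs gs'.
rewrite exchange_big; apply: eq_bigr => s /eqP gs /=.
rewrite [RHS](partition_big g (fun i' => (i < i')%N)) /=; last by move=> s'; rewrite gs.
apply: eq_bigr => i' ii'; apply: eq_bigl => s'; rewrite gs.
by case: eqVneq => [->|_]; rewrite ?ii' ?andbT ?andbF.
Qed.

Lemma sfaceC (S : comNzRingType) e j (c : S) : sface j c%:MP_[e.+1] = c%:MP_[e].
Proof. exact: comp_mpolyC. Qed.

Lemma sface_Xpol (S : comNzRingType) e (W : 'I_e.+2 -> 'I_e.+2 -> S) j :
  sface j (Xpol e.+1 W) = \sum_(s < e.+2) \sum_(s' < e.+2 | (s < s')%N)
    Xcoef S e (if (s <= j)%N then s : nat else s.-1)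
              (if (s' <= j)%N then s' : nat else s'.-1) * (W s s')%:MP.
Proof.
rewrite XpolE raddf_sum; apply: eq_bigr => s _.
rewrite raddf_sum; apply: eq_bigr => s' _ /=.
have s1 : (s <= e.+1)%N by rewrite -ltnS.
have s'1 : (s' <= e.+1)%N by rewrite -ltnS.
rewrite rmorphM /Xcoef rmorphD rmorphB !rmorphM /= !sface_spt// rmorph1 rmorph_nat.
by rewrite sfaceC.
Qed.

(** Being constant symbols, these coefficients are invisible to slot degrees and to derivations of
    the symbols. *)
Lemma mcoeff_Xcoef (A : comNzRingType) N e k l u :
  exists c : A, (Xcoef {mpoly A[N]} e k l)@_u = c%:MP.
Proof.
exists (Xcoef A e k l)@_u; pose f : {rmorphism A -> {mpoly A[N]}} := @mpolyC N A.
transitivity ((map_mpoly f (Xcoef A e k l))@_u); last by rewrite mcoeff_map_mpoly.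
congr (_@_u); rewrite /Xcoef rmorphD rmorphB !rmorphM /= !(map_spt f).
by rewrite rmorph1 rmorph_nat.
Qed.

(* the slots j and j+1 are merged if j <= d, the slots d+1 and 0 if j = d+1 *)
Definition gmerge e (j : nat) (s : 'I_e.+2) : 'I_e.+1 :=
  inord (if (s <= j)%N then if (s < e.+1)%N then s : nat else 0%N else s.-1).

Lemma gmergeE e j (s : 'I_e.+2) : gmerge j s =
  (if (s <= j)%N then if (s < e.+1)%N then s : nat else 0%N else s.-1) :> nat.
Proof.
rewrite /gmerge inordK//; have := ltn_ord s.
by case: ifP => [_|/negbT]; [case: ifP|]; lia.
Qed.

(** Where two neighbouring points meet, their pair has weight 1, which gives the extra term. On the
    last face the point at 1 is carried to 0: there [Xcoef S e k e.+1] is the opposite of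
    [Xcoef S e 0 k], and the antisymmetry of W absorbs the sign. *)
Lemma sface_Xpol_merge (S : comNzRingType) e (W : 'I_e.+2 -> 'I_e.+2 -> S)
    (j : nat) (s0 s1 : 'I_e.+2) :
  (forall s s', W s' s = - W s s') ->
  (if (j < e.+1)%N then s0 = j :> nat /\ s1 = j.+1 :> nat
   else j = e.+1 /\ s0 = e.+1 :> nat /\ s1 = 0%N :> nat) ->
  sface j (Xpol e.+1 W) =
  Xpol e (fun i i' => \sum_(s | gmerge j s == i) \sum_(s' | gmerge j s' == i') W s s')
  + (W s0 s1)%:MP.
Proof.
move=> WC; rewrite sface_Xpol Xpol_pull.
have Xkk k : Xcoef S e k k = 1 by rewrite /Xcoef subrr add0r.
have lt2 (s : 'I_e.+2) := ltn_ord s.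
case: ltnP => [je [s0j s1j]|ej [{ej}-> [s0e s1e]]].
  have gE (s : 'I_e.+2) : gmerge j s = (if (s <= j)%N then s : nat else s.-1) :> nat.
    by rewrite gmergeE; case: (leqP s j) => // sj; rewrite (leq_ltn_trans sj je).
  (* Spreading the extra term over all pairs allows a comparison pair by pair. *)
  pose D s s' : {mpoly S[e]} := if (s == s0) && (s' == s1) then (W s s')%:MP else 0.
  have -> : (W s0 s1)%:MP = \sum_s \sum_s' D s s'.
    rewrite (bigD1 s0)//= [X in _ + X]big1 ?addr0; last first.
      by move=> s /negPf ss0; rewrite big1// => s' _; rewrite /D ss0.
    rewrite (bigD1 s1)//= [X in _ + X]big1 ?addr0; first by rewrite /D !eqxx.
    by move=> s /negPf ss1; rewrite /D ss1 andbF.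
  rewrite -big_split; apply: eq_bigr => s _ /=.
  rewrite [in LHS]big_mkcond [in RHS]big_mkcond -big_split; apply: eq_bigr => s' _ /=.
  rewrite -!gE /D -!val_eqE /= s0j s1j.
  case: ifP => ss'; case: ifP => gss'; case: ifP => E; rewrite ?addr0 ?add0r//.
  - by move: ss' gss' E; rewrite !gE; case: ifP; case: ifP; lia.
  - have -> : (gmerge j s : nat) = gmerge j s'.
      by move: ss' gss' E; rewrite !gE; case: ifP; case: ifP; lia.
    by rewrite Xkk mul1r.
  - by exfalso; move: ss' gss' E; rewrite !gE; case: ifP; case: ifP; lia.
  - by exfalso; move: ss' gss' E; rewrite !gE; case: ifP; case: ifP; lia.
  - by exfalso; move: ss' gss' E; rewrite !gE; case: ifP; case: ifP; lia.
  - by exfalso; move: ss' gss' E; rewrite !gE; case: ifP; case: ifP; lia.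
have s0E : s0 = ord_max by exact: val_inj.
have s1E : s1 = ord0 by exact: val_inj.
have gw (s : 'I_e.+1) : gmerge e.+1 (widen_ord (leqnSn _) s) = s :> nat.
  by rewrite gmergeE /= (ltnW (ltn_ord s)) ltn_ord.
have gm : gmerge e.+1 (ord_max : 'I_e.+2) = 0%N :> nat.
  by rewrite gmergeE /= leqnn ltnn.
(* The last slot is isolated in both sums: it alone moves, from the end to position 0. *)
have split2 (P : nat -> nat -> bool) (F : 'I_e.+2 -> 'I_e.+2 -> {mpoly S[e]})
    (p : 'I_e.+2 -> nat) :
  \sum_s \sum_(s' | P (p s) (p s')) F s s' =
  (\sum_(s < e.+1) \sum_(s' < e.+1 | P (p (widen_ord (leqnSn _) s)) (p (widen_ord (leqnSn _) s')))
     F (widen_ord (leqnSn _) s) (widen_ord (leqnSn _) s')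
   + \sum_(s < e.+1 | P (p (widen_ord (leqnSn _) s)) (p ord_max))
     F (widen_ord (leqnSn _) s) ord_max)
  + (\sum_(s' < e.+1 | P (p ord_max) (p (widen_ord (leqnSn _) s')))
     F ord_max (widen_ord (leqnSn _) s')
   + (if P (p ord_max) (p ord_max) then F ord_max ord_max else 0)).
  have split1 (Q : pred 'I_e.+2) (H : 'I_e.+2 -> {mpoly S[e]}) :
      \sum_(s' | Q s') H s' = \sum_(s' < e.+1 | Q (widen_ord (leqnSn _) s'))
        H (widen_ord (leqnSn _) s') + (if Q ord_max then H ord_max else 0).
    by rewrite big_mkcond big_ord_recr /= -big_mkcond.
  rewrite big_ord_recr /= split1; congr (_ + _).
  rewrite [X in _ = _ + X]big_mkcond -big_split; apply: eq_bigr => s _ /=.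
  exact: split1.
rewrite (split2 (fun a b => a < b)%N _ (fun s => s)).
rewrite [in RHS](split2 (fun a b => a < b)%N _ (fun s => gmerge e.+1 s)).
rewrite !gm !ltnn !addr0.
rewrite [X in _ + X = _]big_pred0 ?addr0; last first.
  by move=> s; rewrite ltnNge (ltnW (ltn_ord s)).
rewrite [X in _ = _ + X + _ + _]big_pred0 ?addr0; last first.
  by move=> s; rewrite ltn0.
rewrite -addrA; congr (_ + _).
  apply: eq_bigr => s _; apply: eq_big => [s'|s' _]; first by rewrite !gw.
  by rewrite !gw /= !(ltnW (ltn_ord _)).
have XkN k : Xcoef S e k e.+1 = - Xcoef S e 0 k.
  by rewrite /Xcoef spt_last /=; ring.
transitivity (\sum_(s < e.+1) Xcoef S e 0 s * (W ord_max (widen_ord (leqnSn _) s))%:MP).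
  apply: eq_big => [s|s _]; first by rewrite /= ltn_ord.
  by rewrite /= (ltnW (ltn_ord s)) leqnn XkN WC mpolyCN mulrN mulNr opprK.
rewrite [in RHS]big_mkcond !big_ord_recl /= [RHS]addrC; congr (_ + _).
  rewrite Xkk mul1r s0E s1E; congr (W _ _)%:MP; exact: val_inj.
rewrite gw ltnn add0r; apply: eq_bigr => s _.
by rewrite !gw.
Qed.

End SlotExponent.

(** * Maximal minors and merged slots *)

Section MergedSlots.
Variables (K : comUnitRingType) (eps : K) (n : nat).
Local Notation d := (2 * n)%N.
Local Notation tpow := (tpow K n).

Lemma mderiv_spt (S : comNzRingType) e (k : 'I_e) (s : nat) : (s <= e)%N ->
  (spt S e s)^`M(k) = (s == k.+1)%:R.
Proof.
case: s => [_|s se]; first by rewrite /= mderiv0.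
rewrite /spt (insubT (fun i => i < e)%N se) /= mderivX mnm1E eqSS.
rewrite -val_eqE /=; case: eqP => [E|_]; last by rewrite scale0r.
rewrite scale1r (_ : (_ - _)%MM = 0%MM) ?mpolyX0//; apply/mnmP => i.
rewrite mnmBE !mnm1E mnm0E -!val_eqE /= E; exact: subnn.
Qed.

Lemma mderiv_Xcoef (S : comNzRingType) e (k : 'I_e) (s s' : nat) :
  (s <= e)%N -> (s' <= e)%N ->
  (Xcoef S e s s')^`M(k) = 2 * ((s == k.+1)%:R - (s' == k.+1)%:R).
Proof.
move=> se s'e; have d1 : (1 : {mpoly S[e]})^`M(k) = 0 by rewrite -mpolyC1 mderivC.
rewrite /Xcoef !mulr_natl mderivD mderivB !mderivMn !mderiv_spt// d1 addr0.
by rewrite mulrnBl.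
Qed.

(** The slots before and after the one of u_k enter with opposite signs, and antisymmetry unites
    them in one sum. *)
Lemma mderiv_Xpol (S : comNzRingType) e (W : 'I_e.+1 -> 'I_e.+1 -> S) (k : 'I_e) :
  (forall s s', W s' s = - W s s') -> (forall s, W s s = 0) ->
  (Xpol e W)^`M(k) = (2 * \sum_s W (lift ord0 k) s)%:MP.
Proof.
move=> WC W0; pose q := lift ord0 k.
transitivity (2 * (\sum_(s < e.+1) \sum_(s' < e.+1 | (s < s')%N)
    ((s == q)%:R - (s' == q)%:R) * W s s'))%:MP_[e].
  rewrite XpolE !raddf_sum rmorphM rmorph_sum mulr_sumr; apply: eq_bigr => s _ /=.
  rewrite raddf_sum rmorph_sum mulr_sumr; apply: eq_bigr => s' _ /=.
  rewrite mderivM mderivC mulr0 addr0 mderiv_Xcoef -1?ltnS//.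
  have qE (r : 'I_e.+1) : (r == q) = (r == k.+1 :> nat) by rewrite -val_eqE /q [val (lift _ _)]lift0.
  by rewrite !rmorphM rmorphB /= !mpolyC_nat mulrA !qE.
congr (_%:MP_[e]); congr (_ * _).
transitivity (\sum_(s' < e.+1 | (q < s')%N) W q s' - \sum_(s < e.+1 | (s < q)%N) W s q).
  rewrite (eq_bigr (fun s : 'I_e.+1 => \sum_(s' < e.+1 | (s < s')%N) (s == q)%:R * W s s'
      - \sum_(s' < e.+1 | (s < s')%N) (s' == q)%:R * W s s')); last first.
    by move=> s _; rewrite -sumrB; apply: eq_bigr => s' _; rewrite mulrBl.
  rewrite sumrB; congr (_ - _).
    rewrite (bigD1 q)//= [X in _ + X]big1 ?addr0 => [|s /negPf sq].
      by apply: eq_bigr => s' _; rewrite eqxx mul1r.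
    by rewrite big1// => s' _; rewrite sq mul0r.
  rewrite [RHS]big_mkcond; apply: eq_bigr => s _.
  case: ifP => sq; last first.
    by rewrite big1// => s' ss'; case: eqVneq => [E|_]; rewrite ?mul0r// -E ss' in sq *.
  rewrite (bigD1 q)//= eqxx mul1r big1 ?addr0// => s' /andP[_ /negPf ->].
  by rewrite mul0r.
rewrite [RHS](bigID (fun s : 'I_e.+1 => (q < s)%N)) /=; congr (_ + _).
rewrite -sumrN [RHS](bigD1 q)/= ?ltnn// W0 add0r; apply: eq_big => [s|s _].
  by rewrite -leqNgt ltn_neqAle andbC -val_eqE.
by rewrite -WC.
Qed.

Lemma minors_repeated (B : comNzRingType) q (A : 'M[B]_(q.+1, q)) (l : 'I_q) :
  \sum_(k < q.+1) (-1) ^+ k * (A k l * \det (row' k A)) = 0.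
Proof.
(* The transpose of A with its column l repeated as row 0. *)
pose C : 'M[B]_(q.+1) := \matrix_(i, j) if unlift ord0 i is Some i' then A j i' else A j l.
have : \det C = 0.
  apply: (@determinant_alternate _ _ C ord0 (lift ord0 l)) => // j.
  by rewrite !mxE unlift_none liftK.
rewrite (expand_det_row C ord0) => E; rewrite -[RHS]E; apply: eq_bigr => k _.
rewrite mxE unlift_none /cofactor add0n mulrCA; congr (_ * (_ * _)).
rewrite -det_tr; congr (\det _); apply/matrixP => i j.
by rewrite !mxE liftK.
Qed.

(** Abel summation; the zero end values of D remove the boundary terms. *)
Lemma alternating_sum (B : comNzRingType) q (E D : nat -> B) :
  D 0%N = 0 -> D q.+2 = 0 ->
  \sum_(j < q.+2) (-1) ^+ j * (E j * (D j + D j.+1))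
  = - \sum_(k < q.+1) (-1) ^+ k * (D k.+1 * (E k.+1 - E k)).
Proof.
move=> D0 Dq.
rewrite (eq_bigr (fun j : 'I_q.+2 => (-1) ^+ j * (E j * D j)
    + (-1) ^+ j * (E j * D j.+1))); last by move=> j _; rewrite !mulrDr.
rewrite big_split /= big_ord_recl [X in _ + X]big_ord_recr /= D0 Dq.
rewrite !mulr0 add0r addr0 -big_split -sumrN; apply: eq_bigr => k _ /=.
by rewrite /bump /= add1n exprS; ring.
Qed.

Definition slotmx : 'M[tpow d.+2]_(d.+1, d) :=
  \matrix_(k, l) slotX (lift ord0 k) l.

(** The minor that omits slot k. The value 0 outside 1, ..., d.+1 lets the two merges with slot 0
    obey the same formula as the others. *)
Definition slotminor (k : nat) : tpow d.+2 :=
  if k is k'.+1 then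
    if insub k' is Some i then \det (row' (i : 'I_d.+1) slotmx) else 0
  else 0.

Lemma slotminorS (k : 'I_d.+1) : slotminor k.+1 = \det (row' k slotmx).
Proof. by rewrite /slotminor valK. Qed.

(** If slot 0 is not involved, the row of the merged slot is the sum of the variables of both, and
    multilinearity splits the determinant. A merge with slot 0 leaves a single minor, because slot 0
    does not occur in the determinant. *)
Lemma trdual_detsym j : (j <= d.+1)%N ->
  trdual (@gmerge d j) (detsym K n) = slotminor j + slotminor j.+1.
Proof.
move=> jd; rewrite /detsym -det_map_mx.
set M := map_mx _ _.
have ME k l : M k l = \sum_(s | gmerge j s == lift ord0 k) slotX s l.
  by rewrite /M !mxE; exact: trdual_slotX.
clearbody M.
have row1 (k : 'I_d) (s0 : 'I_d.+2) :
    (forall s, (gmerge j s == lift ord0 k) = (s == s0)) ->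
    forall l, M k l = slotX s0 l.
  by move=> gE l; rewrite ME (big_pred1 s0).
have gval (k : 'I_d) (s : 'I_d.+2) : (gmerge j s == lift ord0 k)
   = ((if (s <= j)%N then if (s < d.+1)%N then s : nat else 0%N else s.-1) == k.+1).
  by rewrite -val_eqE [val (gmerge j s)]gmergeE [val (lift _ _)]lift0.
case: j jd M ME row1 gval => [_|j jd] M ME row1 gval.
  rewrite add0r -[1%N]/((ord0 : 'I_d.+1).+1) slotminorS; congr (\det _).
  apply/matrixP => k l; rewrite (row1 k (lift ord0 (lift ord0 k))) ?mxE// => s.
  rewrite gval -val_eqE /= /bump !leq0n !add1n; have := ltn_ord s; have := ltn_ord k.
  by case: ifP; [case: ifP|]; lia.
have [jd'|jd'] := leqP d j.
  have jE : j = (ord_max : 'I_d.+1) by apply/eqP; rewrite /= eqn_leq jd' andbT.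
  rewrite [X in _ + X](_ : _ = 0) ?addr0; last first.
    by rewrite /slotminor insubF// jE ltnn.
  rewrite [in RHS]jE slotminorS; congr (\det _); apply/matrixP => k l.
  rewrite (row1 k (lift ord0 (lift ord_max k))) ?mxE// => s.
  rewrite gval -val_eqE /= /bump !leq0n !add1n [(2 * n <= k)%N]leqNgt ltn_ord add0n.
  have := ltn_ord s; have := ltn_ord k.
  by case: ifP; [case: ifP|]; lia.
have j1d : (j < d.+1)%N by exact: leqW.
pose i1 : 'I_d.+1 := Ordinal j1d.
have j2d : (j.+1 < d.+1)%N by [].
pose i2 : 'I_d.+1 := Ordinal j2d.
rewrite -[j.+1]/(i1.+1) slotminorS -[X in slotminor X.+1]/(nat_of_ord i2) slotminorS.
pose i0 : 'I_d := Ordinal jd'.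
rewrite (@determinant_multilinear _ _ M (row' i1 slotmx) (row' i2 slotmx) i0 1 1)
  ?mul1r//.
- apply/matrixP => ? l; rewrite !mxE !mul1r ME.
  pose s1 : 'I_d.+2 := lift ord0 (lift i1 i0).
  pose s2 : 'I_d.+2 := lift ord0 (lift i2 i0).
  rewrite -/s1 -/s2.
  have s1E : s1 = j.+2 :> nat by rewrite /s1 /= /bump leq0n leqnn !add1n.
  have s2E : s2 = j.+1 :> nat by rewrite /s2 /= /bump leq0n ltnn add1n.
  have i0E : i0 = j :> nat by [].
  clearbody s1 s2; have s21 : s2 != s1 by rewrite -val_eqE /= s1E s2E; lia.
  rewrite (bigD1 s1)/=; last by rewrite gval s1E i0E; case: ifP; [case: ifP|]; lia.
  congr (_ + _); rewrite (big_pred1 s2)// => s; rewrite /= gval -!val_eqE /=.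
  rewrite s1E s2E ?i0E; have := ltn_ord s.
  by case: ifP; [case: ifP|]; lia.
- apply/matrixP => k l; rewrite !mxE (row1 (lift i0 k) (lift ord0 (lift i1 (lift i0 k)))) ?mxE// => s.
  rewrite gval -val_eqE /= /bump !leq0n !add1n; have := ltn_ord s; have := ltn_ord k.
  case: (leqP j k) => jk; rewrite ?add1n ?add0n.
    by rewrite (leqW jk); case: ifP; [case: ifP|]; lia.
  have -> : (j <= k)%N = false by rewrite leqNgt jk.
  by case: ifP; [case: ifP|]; lia.
- apply/matrixP => k l; rewrite !mxE (row1 (lift i0 k) (lift ord0 (lift i2 (lift i0 k)))) ?mxE// => s.
  rewrite gval -val_eqE /= /bump !leq0n !add1n; have := ltn_ord s; have := ltn_ord k.
  case: (leqP j k) => jk; rewrite ?add1n ?add0n.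
    have -> : (j < k.+1)%N by [].
    by case: ifP; [case: ifP|]; lia.
  have -> : (j < k)%N = false by lia.
  by case: ifP; [case: ifP|]; lia.
Qed.

End MergedSlots.

Section Cocycle.
Variables (K : comUnitRingType) (eps : K) (n : nat).
Variables (R : realType) (emb : {rmorphism R -> K}).
Local Notation d := (2 * n)%N.
Local Notation tpow := (tpow K n).
Local Notation tau := (tau eps emb).
Local Notation iS m := (inat K (m * d)).
Local Notation fiS m := (fun k => (ifact K (m * d) k)%:MP).

Lemma coefs_Xpol m e q (g : 'I_q -> 'I_q -> tpow m) :
  (forall i j, ord_ge 1 (g i j)) -> coefs (@ord_ge K (m * d) 1) (Xpol e g).
Proof.
move=> g1; apply: (coefs_sum (G := fun k => @ord_ge K (m * d) k)) => //.
- by move=> k; exact: supp_in0.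
- by move=> k x y; exact: supp_inD.
move=> i _; apply: (coefs_sum (G := fun k => @ord_ge K (m * d) k)) => //.
- by move=> k; exact: supp_in0.
- by move=> k x y; exact: supp_inD.
move=> j _ u; rewrite mulrC mul_mpolyC mcoeffZ; exact: ord_geMr.
Qed.

(* Exponentials multiply up to terms of order M, and these annihilate
   polynomials of size at most M. *)
Lemma sympair_texpM m e M (X Y : {mpoly (tpow m)[e]}) (P : tpow m) t :
  (msize t <= M)%N ->
  coefs (@ord_ge K (m * d) 1) X -> coefs (@ord_ge K (m * d) 1) Y ->
  sympair (simplex_int (iS m) (texp (fiS m) M X * texp (fiS m) M Y) * P) t
  = sympair (simplex_int (iS m) (texp (fiS m) M (X + Y)) * P) t.
Proof.
move=> tM X1 Y1; apply/eqP; rewrite -subr_eq0 -sympairB -mulrBl -simplex_intB.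
apply/eqP; apply: (sympair_high tM); apply: ord_geMr.
apply: (coefs_simplex_int (G := fun k => @ord_ge K (m * d) k)) => //.
- by move=> k; exact: supp_in0.
- by move=> k x y; exact: supp_inD.
- by move=> k l x y; exact: ord_geM.
apply: texpM_congr => //.
- by move=> k; apply: ifactK; exact: (natU emb).
- by move=> k; exact: supp_in0.
- by move=> k x y; exact: supp_inD.
- by move=> k l x y; exact: ord_geM.
- by move=> k l x; exact: ord_geS.
Qed.

Lemma trdual_tausym m (g : 'I_m -> 'I_d.+1) M :
  trdual g (tausym eps n M)
  = simplex_int (iS m) (texp (fiS m) M (Xpol d (fun i i' =>
      \sum_(s | g s == i) \sum_(s' | g s' == i') wsym eps s s')))
    * trdual g (detsym K n).
Proof.
rewrite /tausym rmorphM /=; congr (_ * _).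
rewrite (simplex_int_map (iw' := iS m)) => [|k]; last exact: mren_dualC.
congr simplex_int; rewrite (rmorph_texp (fiB := fiS m)) => [|k]; last first.
  by rewrite /= map_mpolyC /= /ifact; congr (_%:MP); exact: mren_dualC.
congr texp; apply: etrans (map_Xpol (trdual g) _ _) _; congr Xpol.
by apply/funext => i; apply/funext => i'; exact: trdual_wsym.
Qed.

(** The star product contributes the exponential of the symbol of s0 and s1; it completes the pulled
    back exponent to a face of the exponent on the larger simplex. *)
Lemma tau_merge (j : nat) (s0 s1 : 'I_d.+2) (a : 'I_d.+2 -> weyl K n) M :
  (j <= d.+1)%N ->
  (if (j < d.+1)%N then s0 = j :> nat /\ s1 = j.+1 :> nat
   else j = d.+1 /\ s0 = d.+1 :> nat /\ s1 = 0%N :> nat) ->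
  (msize (tens a) <= M)%N ->
  (msize (tren (gmerge j) (lexp (eps_alpha eps s0 s1) (tens a))) <= M)%N ->
  tau (tren (gmerge j) (lexp (eps_alpha eps s0 s1) (tens a)))
  = sympair (simplex_int (iS d.+2)
       (sface j (texp (fiS d.+2) M (Xpol d.+1 (fun s s' : 'I_d.+2 => wsym eps s s'))))
     * (slotminor K n j + slotminor K n j.+1)) (tens a).
Proof.
move=> jd js aM rM; rewrite (tauE eps emb rM) sympair_tren.
rewrite (lexpE eps s0 s1 aM) sympair_dop.
rewrite trdual_tausym -(trdual_detsym K jd) mulrAC.
set X := Xpol d _; set D := trdual _ _.
have -> : simplex_int (iS d.+2) (texp (fiS d.+2) M X) * texp (@ifact K _) M (wsym eps s0 s1)
  = simplex_int (iS d.+2) (texp (fiS d.+2) M X * texp (fiS d.+2) M (wsym eps s0 s1)%:MP).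
  rewrite -simplex_intMC; congr (simplex_int _ (_ * _)).
  exact: (rmorph_texp (f := @mpolyC _ _)).
have E : sface j (texp (fiS d.+2) M (Xpol d.+1 (fun s s' : 'I_d.+2 => wsym eps s s')))
    = texp (fiS d.+2) M (X + (wsym eps s0 s1)%:MP).
  rewrite (rmorph_texp (f := @sface _ d j) (fiB := fiS d.+2)) => [|k]; last exact: sfaceC.
  by congr texp; apply: (sface_Xpol_merge _ js) => s s'; exact: wsymC.
have Y1 : coefs (@ord_ge K (d.+2 * d) 1) (wsym eps s0 s1)%:MP_[d].
  by move=> u; rewrite mcoeffC mulrC; apply: ord_geMl; exact: ord_wsym.
have X1 : coefs (@ord_ge K (d.+2 * d) 1) X.
  apply: coefs_Xpol => i i'; elim/big_ind: _ => [|x y|s _].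
  - exact: supp_in0.
  - exact: supp_inD.
  elim/big_ind: _ => [|x y|s' _]; [exact: supp_in0|exact: supp_inD|exact: ord_wsym].
rewrite (sympair_texpM D aM X1 Y1).
by rewrite E.
Qed.

Lemma face_merge (a : 'I_d.+2 -> weyl K n) (j : 'I_d.+1) :
  tens (face eps a j) = tren (gmerge j)
    (lexp (eps_alpha eps (widen_ord (leqnSn _) j) (lift ord0 j)) (tens a)).
Proof.
have gE (s : 'I_d.+2) : gmerge j s = (if (s <= j)%N then s : nat else s.-1) :> nat.
  by rewrite gmergeE; case: (leqP s j) => // sj; rewrite (leq_ltn_trans sj (ltn_ord j)).
rewrite (star_tens _ (i := j)); first last.
- move=> r; rewrite -!val_eqE /= gE /bump leq0n add1n; have := ltn_ord r; have := ltn_ord j.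
  by case: ifP; lia.
- by rewrite -val_eqE /= /bump leq0n add1n; lia.
congr tens; apply/funext => k; rewrite /face -val_eqE /=.
case: (ltngtP k j) => kj //.
- rewrite (big_pred1 (widen_ord (leqnSn _) k))// => s.
  rewrite /= -!val_eqE /= gE; have := ltn_ord s; have := ltn_ord k.
  by case: ifP; lia.
- rewrite (big_pred1 (lift ord0 k))// => s.
  rewrite /= -!val_eqE /= gE /bump leq0n add1n; have := ltn_ord s; have := ltn_ord k.
  by case: ifP; lia.
Qed.

Lemma cyclic_face_merge (a : 'I_d.+2 -> weyl K n) :
  tens (cyclic_face eps a) = tren (gmerge d.+1)
    (lexp (eps_alpha eps ord_max ord0) (tens a)).
Proof.
have gE (s : 'I_d.+2) : gmerge d.+1 s = (if (s < d.+1)%N then s : nat else 0%N) :> nat.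
  by rewrite gmergeE -ltnS ltn_ord.
rewrite (star_tens _ (i := ord0))//; last first.
  move=> r; rewrite -!val_eqE /= gE; have := ltn_ord r.
  by case: ifP; lia.
congr tens; apply/funext => k; rewrite /cyclic_face.
case: (eqVneq k ord0) => // k0.
rewrite (big_pred1 (widen_ord (leqnSn _) k))// => s; move: k0.
rewrite /= -!val_eqE /= gE; have := ltn_ord s; have := ltn_ord k.
by case: ifP; lia.
Qed.

(** By bilinearity the inner sum pairs one slot with the total T of all slots, and [minors_repeated]
    kills each component of the combined first argument. *)
Lemma wsym_sum_minors :
  \sum_(k < d.+1) (-1) ^+ k * (slotminor K n k.+1
    * \sum_(s < d.+2) wsym eps (lift ord0 k) s) = 0.
Proof.
pose T l : tpow d.+2 := \sum_(s < d.+2) slotX s l.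
pose D (k : 'I_d.+1) : tpow d.+2 := (-1) ^+ k * slotminor K n k.+1.
have D0 l : \sum_k D k * slotX (lift ord0 k) l = 0.
  rewrite -[RHS](minors_repeated (slotmx K n) l); apply: eq_bigr => k _.
  by rewrite /D slotminorS mxE -mulrA [_ * slotX _ _]mulrC.
transitivity ((eps * 2^-1)%:MP * symp (fun l => \sum_k D k * slotX (lift ord0 k) l) T).
  rewrite symp_suml mulr_sumr; apply: eq_bigr => k _.
  have -> : \sum_(s < d.+2) wsym eps (lift ord0 k) s
      = (eps * 2^-1)%:MP * symp (slotX (lift ord0 k)) T :> tpow d.+2.
    by rewrite /T symp_sumr mulr_sumr.
  rewrite [LHS]mulrA -/(D k) [LHS]mulrCA; congr (_ * _); rewrite /symp mulr_sumr.
  by apply: eq_bigr => r _; rewrite mulrBr !mulrA.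
by rewrite /symp big1 ?mulr0// => r _; rewrite !D0 !mul0r subrr.
Qed.

Lemma tauZ c (t : tpow d.+1) : tau (c *: t) = c * tau t.
Proof. by rewrite -[c *: t]addr0 tau_linear raddf0 addr0. Qed.

Lemma tau_sum (I : Type) (r : seq I) (P : pred I) (F : I -> tpow d.+1) :
  tau (\sum_(i <- r | P i) F i) = \sum_(i <- r | P i) tau (F i).
Proof. exact: raddf_sum. Qed.

Lemma tau_dHoch (t : tpow d.+2) : tau (dHoch eps t) = 0.
Proof.
(* [dHoch] is by construction a combination of its values on tensors of monomials, so pure tensors
   suffice. *)
rewrite /dHoch /tlift tau_sum big1// => u _; rewrite tauZ.
set a := fun i => _; rewrite [X in _ * X](_ : _ = 0) ?mulr0//.
clearbody a; move: a => {t u} a.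
(* One formula for all summands; j = d.+1 is the cyclic one, which merges the last slot with slot
   0. *)
pose tf (j : nat) : tpow d.+1 :=
  tren (gmerge j) (lexp (eps_alpha eps (inord j) (inord (if (j < d.+1)%N then j.+1 else 0%N)))
    (tens a)).
have tf_face (j : 'I_d.+1) : tens (face eps a j) = tf j.
  have e0 : inord j = widen_ord (leqnSn d.+1) j.
    by apply/val_inj; rewrite /= inordK// leqW.
  have e1 : inord (if (j < d.+1)%N then j.+1 else 0%N) = lift ord0 j :> 'I_d.+2.
    by rewrite ltn_ord; apply/val_inj; rewrite /= inordK// ltnS.
  by rewrite face_merge /tf e0 e1.
have tf_cyc : tens (cyclic_face eps a) = tf d.+1.
  have e0 : inord d.+1 = ord_max :> 'I_d.+2 by apply/val_inj; rewrite /= inordK.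
  have e1 : inord (if (d.+1 < d.+1)%N then d.+2 else 0%N) = ord0 :> 'I_d.+2.
    by rewrite ltnn; apply/val_inj; rewrite /= inordK.
  by rewrite cyclic_face_merge /tf e0 e1.
pose M0 := maxn (msize (tens a)) (\max_(j < d.+2) msize (tf j)).
(* A successor, because the derivative in Stokes' formula lowers the order of truncation by one. *)
pose M := M0.+1.
have aM : (msize (tens a) <= M)%N by rewrite (leq_trans (leq_maxl _ _) (leqnSn _)).
have tfM (j : 'I_d.+2) : (msize (tf j) <= M)%N.
  apply: (leq_trans _ (leqnSn _)); apply: (leq_trans _ (leq_maxr _ _)).
  exact: (leq_bigmax j).
pose X := Xpol d.+1 (fun s s' : 'I_d.+2 => wsym eps s s' : tpow d.+2).
pose F := texp (fiS d.+2) M X.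
pose E (j : nat) : tpow d.+2 := simplex_int (iS d.+2) (sface j F).
pose D := slotminor K n.
have tau_tf (j : 'I_d.+2) : tau (tf j) = sympair (E j * (D j + D j.+1)) (tens a).
  apply: (tau_merge _ _ aM (tfM j)); first by rewrite -ltnS.
  case: ltnP => jd; first by rewrite !inordK// ltnS ltnW.
  have jE : j = d.+1 :> nat by apply/eqP; rewrite eqn_leq jd -ltnS ltn_ord.
  by rewrite jE !inordK.
have -> : dHoch_tens eps a = \sum_(j < d.+2) (-1) ^+ j *: tf j.
  rewrite /dHoch_tens [RHS]big_ord_recr /= tf_cyc; congr (_ + _).
  by apply: eq_bigr => j _; rewrite tf_face.
rewrite tau_sum (eq_bigr (fun j : 'I_d.+2 =>
    sympair ((-1) ^+ j * (E j * (D j + D j.+1))) (tens a))) => [|j _]; last first.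
  rewrite tauZ tau_tf -sympairZ; congr (sympair (_ * _) _).
  exact: rmorph_sign.
rewrite -sympair_sum alternating_sum//; last by rewrite /D /slotminor insubF// ltnn.
rewrite (_ : \sum_(k < _) _ = 0) ?oppr0 ?sympair0//.
pose G := simplex_int (iS d.+2) (texp (fiS d.+2) M0 X).
transitivity (2 * G * \sum_(k < d.+1) (-1) ^+ k * (D k.+1
    * \sum_(s < d.+2) wsym eps (lift ord0 k) s)); last by rewrite wsym_sum_minors mulr0.
rewrite mulr_sumr; apply: eq_bigr => k _.
have -> : E k.+1 - E k = 2 * G * \sum_(s < d.+2) wsym eps (lift ord0 k) s.
  rewrite -simplex_stokes; last by move=> l l0; apply: inatK => //; exact: (natU emb).
  rewrite /F mderiv_texp; last by move=> l; apply: ifactK; exact: (natU emb).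
  rewrite mderiv_Xpol; last 2 first.
  - by move=> s s'; exact: wsymC.
  - by move=> s; exact: wsymii.
  by rewrite simplex_intMC mulrCA mulrA.
by rewrite [X in _ * X = _]mulrCA [LHS]mulrCA.
Qed.

End Cocycle.

(** * Normalization *)

Section Normalization.
Variables (K : comUnitRingType) (eps : K) (n : nat).
Variables (R : realType) (emb : {rmorphism R -> K}).
Local Notation d := (2 * n)%N.
Local Notation tpow := (tpow K n).
Local Notation tau := (tau eps emb).

(** Moves the determinant back to the argument, where antisymmetrization can be computed
    explicitly. *)
Lemma sympair_tausym M (t : tpow d.+1) :
  sympair (tausym eps n M) t =
  sympair (simplex_int (inat K (d.+1 * d))
    (texp (fun k => (ifact K (d.+1 * d) k)%:MP) M (Xpol d (fun i j : 'I_d.+1 => wsym eps i j))))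
    (antisym t).
Proof. by rewrite antisymE sympair_dop. Qed.

Lemma tens_eq0 m (a : 'I_m -> weyl K n) i : a i = 0 -> tens a = 0.
Proof. by move=> ai; rewrite tensE (bigD1 i)//= ai raddf0 mul0r. Qed.

Lemma tau_normalized (a : 'I_d.+1 -> weyl K n) i c :
  i != ord0 -> a i = c%:MP -> tau (tens a) = 0.
Proof.
move=> i0 ai; rewrite (tauE eps emb (leqnn _)) sympair_tausym antisym_tens.
rewrite big1 ?raddf0// => s _; case: (unliftP ord0 i) i0 => [k ik _|->]; last by rewrite eqxx.
rewrite (@tens_eq0 _ _ i) ?scaler0//.
by rewrite {1}ik liftK ai mderivC.
Qed.

Lemma sympairC N (P : {mpoly K[N]}) (c : K) : sympair P c%:MP = c * P@_0%MM.
Proof.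
have E : dop P c%:MP = (c * P@_0%MM)%:MP.
  apply: (@mpoly_linear_ext_fun _ _ _ (fun P => dop P c%:MP)
    (fun P => (c * P@_0%MM)%:MP)) => [b x y|b x y|m].
  - exact: dop_linear_l.
  - rewrite mcoeffD mcoeffZ mulrDr mpolyCD -mul_mpolyC -mpolyCM.
    by congr (_%:MP + _); rewrite mulrCA.
  rewrite dopX mcoeffX; have [->|m0] := eqVneq m 0%MM.
    by rewrite mderivm0m mulr1.
  rewrite mulr0 mpolyC0; apply/mpolyP => m'; rewrite mcoeff_mderivm mcoeff0.
  by rewrite mcoeffC mnmD_eq0 (negPf m0) ?andbF /= mulr0 mul0rn.
by rewrite /sympair E mcoeffC eqxx mulr1.
Qed.

(** A permutation other than s differentiates some factor y_(s k) by a different variable, so s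
    contributes only its own term, with the square of its sign. *)
Lemma antisym_c2n : antisym (c2n K n) = (d`!%:R)%:MP.
Proof.
rewrite /c2n; transitivity (\sum_(s : 'S_d) (1 : tpow d.+1)).
  rewrite (big_morph (@antisym K n) (id1 := 0) (op1 := +%R)); first last.
  - by have := antisym_linear (-1) (0 : tpow d.+1) 0; rewrite !scaler0 !addr0 scaleN1r addNr.
  - by move=> x y; have := antisym_linear 1 x y; rewrite !scale1r.
  apply: eq_bigr => s _.
  have -> z : antisym ((-1) ^+ s *: z) = (-1) ^+ s *: antisym z :> tpow d.+1.
    have a0 : antisym 0 = 0 :> tpow d.+1.
      by have := antisym_linear (-1) (0 : tpow d.+1) 0; rewrite !scaler0 !addr0 scaleN1r addNr.
    by have := antisym_linear ((-1) ^+ s) z 0; rewrite a0 !addr0.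
  rewrite antisym_tens (bigD1 s)//= big1 ?addr0 => [|s' s's].
    rewrite scalerA -expr2 sqrr_sign scale1r.
    rewrite tensE big1// => i _; case: unliftP => [k|] _; last exact: rmorph1.
    rewrite mderivX mnm1E eqxx scale1r (_ : (_ - _)%MM = 0%MM) ?mpolyX0 ?rmorph1//.
    by apply/mnmP => l; rewrite mnmBE mnm0E subnn.
  have [k skk] : exists k, s k != s' k.
    apply/existsP; apply: contraR s's => /existsPn ss'; apply/eqP/permP => k.
    by apply/esym/eqP/negPn/ss'.
  rewrite (@tens_eq0 _ _ (lift ord0 k)) ?scaler0// liftK mderivX mnm1E (negPf skk).
  by rewrite scale0r.
by rewrite sumr_const card_Sn -mpolyC_nat.
Qed.

Lemma tau_c2n : tau (c2n K n) = 1.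
Proof.
(* The order is a successor, so the truncated exponential contains its term 1. Nothing else remains,
   w_ij having no constant term, and the volume 1 / d! of the simplex cancels d!. *)
rewrite (tauE eps emb (leqnSn _)) sympair_tausym antisym_c2n sympairC.
pose ev0 : {rmorphism tpow d.+1 -> K} := mcoeff 0%MM.
set M := (msize _).+1; pose iK k : K := k%:R^-1.
have -> F : (simplex_int (inat K (d.+1 * d)) F)@_0%MM
    = simplex_int iK (map_mpoly ev0 F).
  apply: (simplex_int_map (f := ev0)) => k.
  exact: mpolyCK.
rewrite (rmorph_texp (f := map_mpoly ev0) (fiB := fun k => (k`!%:R^-1)%:MP)); last first.
  by move=> k; rewrite /= map_mpolyC; congr (_%:MP); exact: mpolyCK.
set Xm := (X in texp _ _ X).
have {Xm}-> : Xm = 0.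
  transitivity (Xpol d (fun i j : 'I_d.+1 => ev0 (wsym eps i j))); first exact: map_Xpol.
  rewrite XpolE big1// => i _; rewrite big1// => j _.
  rewrite (_ : ev0 (wsym eps i j) = 0) ?mpolyC0 ?mulr0//.
  by apply/eqP; apply: contraT => h; have := ord_wsym h; rewrite mdeg0.
rewrite (texp0 (fi := fun k => (k`!%:R^-1)%:MP)); last first.
  by move=> k; rewrite -mpolyC_nat -mpolyCM divrr ?mpolyC1// (natU emb)// fact_gt0.
rewrite -mpolyX0 simplex_intX /mnm_int.
rewrite (eq_big_nat _ _ (F2 := fun k => iK k.+1)) => [|k kd]; last first.
  rewrite /psum (eq_big_nat _ _ (F2 := fun=> 1%N)); first by rewrite sum_nat_const_nat muln1 subn0.
  move=> i /andP[_ ik]; have id_ : (i < d)%N by apply: leq_trans ik _; case/andP: kd.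
  by have := mnm_nth 0%N (0%MM : 'X_{1..d}) (Ordinal id_); rewrite mnm0E => <-.
have H q : (q`!%:R : K) * \prod_(0 <= k < q) iK k.+1 = 1.
  elim: q => [|q IH]; first by rewrite big_geq// fact0 mulr1.
  rewrite big_nat_recr//= factS natrM [_ * (q`!)%:R]mulrC mulrACA IH mul1r.
  by rewrite /iK divrr// (natU emb).
exact: H.
Qed.

End Normalization.

(** * Invariance *)

Section QuadraticElements.
Variables (K : comUnitRingType) (eps : K) (n : nat).
Variables (R : realType) (emb : {rmorphism R -> K}).
Hypothesis epsU : eps \is a GRing.unit.
Local Notation d := (2 * n)%N.
Local Notation tpow := (tpow K n).
Local Notation tau := (tau eps emb).

Definition quadratic (x : weyl K n) := supp_in (fun m => mdeg m == 2)%N x.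

Lemma mderivm_tens m (a : 'I_m -> weyl K n) (u : 'X_{1..m * d}) :
  (tens a)^`M[u] = tens (fun i => (a i)^`M[slot_mnm u i]).
Proof.
suff H k : forall u : 'X_{1..m * d}, mdeg u = k ->
    (tens a)^`M[u] = tens (fun i => (a i)^`M[slot_mnm u i]) by exact: (H _ u erefl).
elim: k => [|k IH] {}u uk.
  have -> : u = 0%MM by apply/eqP; rewrite -mdeg_eq0 uk.
  rewrite mderivm0m; congr tens; apply/funext => i.
  rewrite (_ : slot_mnm _ _ = 0%MM) ?mderivm0m//.
  by apply/mnmP => l; rewrite !mnmE.
have [v ui] : exists v, u v != 0%N.
  apply/existsP; apply: contraPT uk => /existsPn m0.
  by rewrite mdegE big1// => v _; apply/eqP/negPn/m0.
pose u' := (u - U_(v))%MM.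
have uE : u = (u' + U_(v))%MM by rewrite submK// lep1mP.
have u'k : mdeg u' = k by move: uk; rewrite uE mdegD mdeg1 addn1 => -[].
clearbody u'; rewrite uE mderivmDm mderivmU1m.
case/mxvec_indexP: v {ui} uE => i l uE.
have -> : ((tens a)^`M[u'])^`M(mxvec_index i l) = tderiv i l (tens (fun i => (a i)^`M[slot_mnm u' i])).
  by rewrite /tderiv IH.
rewrite tderiv_tens; congr tens; apply/funext => s; rewrite /upd.
have S : slot_mnm (u' + U_(mxvec_index i l))%MM s
    = (slot_mnm u' s + (if s == i then U_(l) else 0))%MM.
  apply/mnmP => c; rewrite !mnmE mxvec_index_eq eq_sym.
  by case: eqP => _; rewrite ?mnmE.
by rewrite S; case: eqP => [->|_]; rewrite ?addm0// mderivmDm mderivmU1m.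
Qed.

Lemma dop_slot m (a : 'I_m -> weyl K n) (s : 'I_m) (D : nat -> bool) (P : tpow m) :
  supp_in (fun u => D (mdeg (slot_mnm u s))) P ->
  (forall v, D (mdeg v) -> (a s)^`M[v] = 0) -> dop P (tens a) = 0.
Proof.
move=> DP aD; apply: (dop_supp DP) => u Du; rewrite mderivm_tens.
by apply: (@tens_eq0 _ _ _ _ s); exact: aD.
Qed.

(** The value at 0 sees only the coefficients of [a s] in the degrees allowed by D, whereas
    [dop_slot] requires whole derivatives to vanish. *)
Lemma sympair_slot m (a : 'I_m -> weyl K n) (s : 'I_m) (D : nat -> bool) (P : tpow m) :
  supp_in (fun u => D (mdeg (slot_mnm u s))) P ->
  (forall v, D (mdeg v) -> (a s)@_v = 0) -> sympair P (tens a) = 0.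
Proof.
move=> DP aD; rewrite /sympair /dop /mlift raddf_sum big_seq big1// => u.
rewrite mcoeff_msupp => /DP Du; rewrite /= mcoeffZ mderivm_tens mcoeff0_tens.
by rewrite (bigD1 s)//= mcoeff_mderivm addm0 aD// mul0rn mul0r mulr0.
Qed.

Definition slot_wt m (s : 'I_m) k (P : tpow m) :=
  supp_in (fun u => mdeg (slot_mnm u s) == k) P.

Lemma slot_mnmD m (u v : 'X_{1..m * d}) (s : 'I_m) :
  slot_mnm (u + v)%MM s = (slot_mnm u s + slot_mnm v s)%MM.
Proof. by apply/mnmP => l; rewrite !mnmE. Qed.

Lemma slot_wtM m (s : 'I_m) k l P Q :
  slot_wt s k P -> slot_wt s l Q -> slot_wt s (k + l)%N (P * Q).
Proof.
by apply: supp_inM => u v /eqP <- /eqP <-; rewrite slot_mnmD mdegD.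
Qed.

Lemma slot_wtD m (s : 'I_m) k P Q :
  slot_wt s k P -> slot_wt s k Q -> slot_wt s k (P + Q).
Proof. exact: supp_inD. Qed.

Lemma slot_wt0 m (s : 'I_m) k : slot_wt s k 0.
Proof. exact: supp_in0. Qed.

Lemma slot_wtC m (s : 'I_m) c : slot_wt s 0 c%:MP.
Proof.
apply: supp_inC; rewrite (_ : slot_mnm _ _ = 0%MM) ?mdeg0//.
by apply/mnmP => l; rewrite !mnmE.
Qed.

Lemma slot_wt1 m (s : 'I_m) : slot_wt s 0 1.
Proof. by rewrite -mpolyC1; exact: slot_wtC. Qed.

Lemma slot_wtX m (s i : 'I_m) l : slot_wt s (i == s) (slotX i l : tpow m).
Proof.
apply: supp_inX; rewrite (_ : slot_mnm _ _ = if i == s then U_(l)%MM else 0%MM).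
  by case: (i == s); rewrite ?mdeg1 ?mdeg0.
by apply/mnmP => c; rewrite !mnmE mxvec_index_eq; case: eqP; rewrite ?mnmE.
Qed.

Lemma slot_wtN m (s : 'I_m) k P : slot_wt s k P -> slot_wt s k (- P).
Proof. by move=> Pk u; rewrite mcoeffN oppr_eq0; exact: Pk. Qed.

Lemma slot_wt_exp m (s : 'I_m) k P j : slot_wt s k P -> slot_wt s (j * k)%N (P ^+ j).
Proof.
move=> Pk; elim: j => [|j IH]; first exact: slot_wt1.
by rewrite exprS; apply: (@slot_wtM m s k (j * k)).
Qed.

Lemma slot_wt_wsym m (s i j : 'I_m) :
  slot_wt s ((i == s) + (j == s))%N (wsym eps i j : tpow m).
Proof.
apply: (@slot_wtM m s 0); first exact: slot_wtC.
rewrite /symp; elim/big_ind: _ => [|x y|r _]; first exact: slot_wt0.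
  exact: slot_wtD.
have H l l' : slot_wt s ((i == s) + (j == s))%N (slotX i l * slotX j l' : tpow m).
  by apply: slot_wtM; exact: slot_wtX.
apply: slot_wtD; first exact: H.
apply: slot_wtN; exact: H.
Qed.

Lemma quadratic_mderivm x v : quadratic x -> (2 < mdeg v)%N -> x^`M[v] = 0.
Proof.
move=> xq v2; apply/mpolyP => u; rewrite mcoeff_mderivm mcoeff0.
rewrite (_ : x@_(v + u)%MM = 0) ?mul0rn//; apply/eqP; apply: contraTT v2 => /xq.
by rewrite mdegD => /eqP E; rewrite -leqNgt; move: E; lia.
Qed.

(* The even terms of the star commutator cancel and those of order at least 3
   vanish, since they differentiate x at least three times. *)
Lemma bracketE (x f : weyl K n) : quadratic x ->
  bracket eps x f = \sum_(r < n) (x^`M(pidx r) * f^`M(qidx r) - x^`M(qidx r) * f^`M(pidx r)).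
Proof.
move=> xq; pose a : 'I_2 -> weyl K n := fun i => if i == ord0 then x else f.
(* Both star products are read off the same tensor: exchanging the slots changes the sign of w. *)
pose sw : 'I_2 -> 'I_2 := fun i => if i == ord0 then ord_max else ord0.
pose T := tens a; pose w : tpow 2 := wsym eps ord0 ord_max.
have swK i : sw (sw i) = i by case: i => -[|[|//]] ?; apply: val_inj.
have T'E : tens (fun i : 'I_2 => if i == ord0 then f else x) = tren sw T.
  rewrite tren_tens; congr tens; apply/funext => i.
  rewrite (big_pred1 (sw i)) => [|j]; last by rewrite /= -(inj_eq (can_inj swK)) swK.
  by rewrite /a; case: i => -[|[|//]] ?.
pose M := (maxn (msize T) (msize (tren sw T))).
have TM : (msize T <= M.+3)%N by rewrite (leq_trans (leq_maxl _ (msize (tren sw T))))// ltnW// ltnW.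
have T'M : (msize (tren sw T) <= M.+3)%N.
  by rewrite (leq_trans (leq_maxr (msize T) _))// ltnW// ltnW.
pose fi := ifact K (2 * d).
have sw_w : trdual sw w = - w.
  rewrite /w trdual_wsym (big_pred1 ord_max) => [|i]; last by case: i => -[|[|//]] ?.
  rewrite (big_pred1 ord0) => [|i]; last by case: i => -[|[|//]] ?.
  exact: wsymC.
have tmul_sw t : tmul (tren sw t) = tmul t :> weyl K n.
  by rewrite !tmulE /tren mren_comp; apply: eq_mren => k /=; rewrite vidxK.
have high k : (2 < k)%N -> dop (w ^+ k) T = 0.
  move=> k2; apply: (@dop_slot _ a ord0 (fun j => j == k)).
    have := @slot_wt_exp 2 ord0 1 w k; rewrite muln1; apply.
    exact: (@slot_wt_wsym 2 ord0 ord0 ord_max).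
  by move=> v /eqP vk; rewrite /a eqxx; apply: quadratic_mderivm => //; rewrite vk.
have starE1 : star eps x f = tmul (dop (texp fi M.+3 w) T).
  by rewrite /star (lexpE eps _ _ TM).
have starE2 : star eps f x = tmul (dop (texp fi M.+3 (- w)) T).
  rewrite /star T'E (lexpE eps _ _ T'M) /tren dop_mren.
  rewrite -[mren _ _]/(tren sw _) tmul_sw; congr (tmul (dop _ _)).
  by rewrite -sw_w; apply: (rmorph_texp (f := trdual sw)) => k; exact: mren_dualC.
have fiK k : k`!%:R * fi k = 1 by apply: ifactK; exact: (natU emb).
have dopDl P Q : dop (P + Q) T = dop P T + dop Q T := raddfD (dopr T) P Q.
have texpT z : z = w \/ z = - w ->
    dop (texp fi M.+3 z) T = T + dop z T + dop (fi 2 * w ^+ 2) T.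
  move=> zw; rewrite (texp_split fiK) big_ord_recl /= !dopDl dop1 dop_suml.
  rewrite [X in _ + (_ + X)]big1 ?addr0 => [|i _].
    by case: zw => ->; rewrite ?sqrrN.
  rewrite dopM (_ : dop (z ^+ _) T = 0) ?raddf0//; case: zw => ->.
    by apply: high.
  rewrite exprNn; apply: etrans (dopM _ _ _) _.
  by rewrite [X in dop _ X]high; [exact: raddf0|].
have tmulB s t : tmul (s - t) = tmul s - tmul t :> weyl K n.
  by rewrite !tmulE raddfB.
have tmulZ c t : tmul (c *: t) = c *: tmul t :> weyl K n.
  by rewrite !tmulE linearZ.
have tmul_sum (F : 'I_n -> tpow 2) : tmul (\sum_r F r) = \sum_r tmul (F r).
  by rewrite tmulE raddf_sum; apply: eq_bigr => r _; rewrite tmulE.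
have tder l l' : tmul (tderiv ord0 l (tderiv ord_max l' T)) = x^`M(l) * f^`M(l').
  by rewrite !tderiv_tens tmul_tens big_ord_recl big_ord1.
have dopN : dop (- w) T = - dop w T := raddfN (dopr T) w.
rewrite /bracket starE1 starE2 !texpT ?dopN; [|by right|by left].
rewrite -tmulB opprD addrACA subrr addr0 opprD addrACA subrr add0r opprK.
rewrite -mulr2n -scaler_nat /w -eps_alphaE /eps_alpha /alpha.
have two : (2%:R : K) \is a GRing.unit by exact: (natU emb).
rewrite !tmulZ !scalerA tmul_sum.
rewrite [X in X *: _](_ : _ = 1) ?scale1r; last first.
  transitivity ((eps^-1 * eps) * (2 * 2^-1)); first by ring.
  by rewrite mulVr// divrr// mulr1.
by apply: eq_bigr => r _; rewrite tmulB !tder.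
Qed.

Lemma quadratic_mderiv x l : quadratic x ->
  x^`M(l) = \sum_c (x^`M(l))@_(U_(c)) *: 'X_c.
Proof.
move=> xq; have d1 u : (x^`M(l))@_u != 0 -> mdeg u = 1%N.
  rewrite mcoeff_mderiv => xu; have : x@_(u + U_(l))%MM != 0.
    by apply: contraNneq xu => ->; rewrite mul0rn.
  by move=> /xq; rewrite mdegD mdeg1 addn1 => /eqP[].
apply/mpolyP => u; rewrite [RHS]raddf_sum.
have [u1|u1] := eqVneq (mdeg u) 1%N; last first.
  have -> : (x^`M(l))@_u = 0 by apply/eqP; apply: contraNT u1 => /d1 ->.
  rewrite big1// => c _; rewrite /= mcoeffZ mcoeffX.
  have [uc|_] := eqVneq U_(c)%MM u; last by rewrite mulr0.
  by move: u1; rewrite -uc mdeg1 eqxx.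
have /mdeg1P[c /eqP ->] : mdeg u == 1%N by rewrite u1.
rewrite (bigD1 c) //= mcoeffZ mcoeffXU eqxx mulr1 big1 ?addr0// => c' /negPf c'c.
by rewrite mcoeffZ mcoeffXU c'c mulr0.
Qed.

Definition hess (x : weyl K n) (l c : 'I_d) : K := (x^`M(l))@_(U_(c)).

Lemma hessC x l c : hess x l c = hess x c l.
Proof.
rewrite /hess !mcoeff_mderiv addmC !mnm1E; congr (_ *+ _.+1).
by rewrite eq_sym.
Qed.

(** If H is the Hessian of x and y the variables of a slot, this is the symbol of the coefficient of
    ['X_c] in the vector field [x, .]. *)
Definition sprot (A : comNzRingType) (H : 'I_d -> 'I_d -> A) (y : 'I_d -> A) (c : 'I_d) : A :=
  \sum_(r < n) (H (pidx r) c * y (qidx r) - H (qidx r) c * y (pidx r)).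

(** Infinitesimal invariance of the symplectic form: by the symmetry of H the terms cancel for each
    pair r, r'. *)
Lemma sprot_symp (A : comNzRingType) (H : 'I_d -> 'I_d -> A) (y z : 'I_d -> A) :
  (forall l c, H l c = H c l) ->
  symp (sprot H y) z + symp y (sprot H z) = 0.
Proof.
move=> HC; rewrite /symp.
pose F (r r' : 'I_n) := (H (pidx r') (pidx r) * y (qidx r') - H (qidx r') (pidx r) * y (pidx r')) * z (qidx r)
  - (H (pidx r') (qidx r) * y (qidx r') - H (qidx r') (qidx r) * y (pidx r')) * z (pidx r).
pose G (r r' : 'I_n) := y (pidx r) * (H (pidx r') (qidx r) * z (qidx r') - H (qidx r') (qidx r) * z (pidx r'))
  - y (qidx r) * (H (pidx r') (pidx r) * z (qidx r') - H (qidx r') (pidx r) * z (pidx r')).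
transitivity (\sum_r \sum_r' F r r' + \sum_r' \sum_r G r' r).
  congr (_ + _); apply: eq_bigr => r _.
    by rewrite sumrB !mulr_suml.
  by rewrite sumrB !mulr_sumr.
rewrite [X in _ + X]exchange_big -big_split big1// => r _ /=.
rewrite -big_split big1// => r' _ /=; rewrite /F /G.
rewrite (HC (pidx r') (pidx r)) (HC (qidx r') (pidx r)) (HC (pidx r') (qidx r)) (HC (qidx r') (qidx r)).
by ring.
Qed.

(** Jacobi's formula: Leibniz' rule differentiates one row at a time, and the determinant with row k
    differentiated is expanded along that row. *)
Lemma derivation_det (A : comNzRingType) (delta : A -> A) q (B : 'M[A]_q) :
  delta 0 = 0 -> delta 1 = 0 -> (forall u v, delta (u + v) = delta u + delta v) ->
  (forall u v, delta (u * v) = delta u * v + u * delta v) ->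
  delta (\det B) = \sum_k \sum_c delta (B k c) * cofactor B k c.
Proof.
move=> d0 d1 dD dM.
have dN u : delta (- u) = - delta u.
  by apply: (addrI (delta u)); rewrite -dD !subrr.
have dsum (I : Type) (r : seq I) (F : I -> A) :
    delta (\sum_(i <- r) F i) = \sum_(i <- r) delta (F i).
  exact: (big_morph delta dD d0).
have dprod (s : 'S_q) : delta (\prod_i B i (s i)) =
    \sum_k \prod_i (if i == k then delta (B i (s i)) else B i (s i)).
  have H (r : seq 'I_q) : uniq r -> delta (\prod_(i <- r) B i (s i)) =
      \sum_(k <- r) \prod_(i <- r) (if i == k then delta (B i (s i)) else B i (s i)).
    elim: r => [_|i r IH /= /andP[ir ur]]; first by rewrite !big_nil.
    rewrite !big_cons dM IH// eqxx; congr (_ + _).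
      congr (_ * _); apply: eq_big_seq => j jr; case: eqP => // ji.
      by rewrite -ji jr in ir.
    rewrite mulr_sumr; apply: eq_big_seq => j jr; rewrite big_cons.
    by case: eqP => // ij; rewrite ij jr in ir.
  by rewrite (H _ (index_enum_uniq _)).
rewrite /determinant dsum.
rewrite (eq_bigr (fun s : 'S_q => \sum_k (-1) ^+ s *
   \prod_i (if i == k then delta (B i (s i)) else B i (s i)))); last first.
  move=> s _; rewrite -mulr_sumr -dprod; case: (odd_perm s); rewrite ?expr0 ?expr1 ?mul1r//.
  by rewrite !mulN1r dN.
rewrite exchange_big; apply: eq_bigr => k _ /=.
pose Bk : 'M[A]_q := \matrix_(i, j) if i == k then delta (B i j) else B i j.
transitivity (\det Bk).
  apply: eq_bigr => s _; congr (_ * _); apply: eq_bigr => i _.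
  by rewrite mxE.
rewrite (expand_det_row Bk k); apply: eq_bigr => c _; rewrite mxE eqxx; congr (_ * _).
rewrite /cofactor; congr (_ * \det _); apply/matrixP => i j; rewrite !mxE.
by rewrite eq_sym (negPf (neq_lift _ _)).
Qed.

End QuadraticElements.

(** * The dual derivation on symbols *)

Section SpInvariance.
Variables (K : comUnitRingType) (eps : K) (n : nat).
Variables (R : realType) (emb : {rmorphism R -> K}).
Hypothesis epsU : eps \is a GRing.unit.
Local Notation d := (2 * n)%N.
Local Notation tpow := (tpow K n).
Local Notation tau := (tau eps emb).
Variable x : weyl K n.
Hypothesis xq : quadratic x.

Let H m (l c : 'I_d) : tpow m := (hess x l c)%:MP.

Let HC m l c : H m l c = H m c l.
Proof. by rewrite /H hessC. Qed.

(* the derivation of the symbols dual to the simultaneous action of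
   [x, .] on all slots *)
Definition sl_deriv m (P : tpow m) : tpow m :=
  \sum_i \sum_c sprot (H m) (slotX i) c * P^`M(mxvec_index i c).

Lemma sl_derivC m c : sl_deriv (c%:MP : tpow m) = 0.
Proof. by rewrite /sl_deriv big1// => i _; rewrite big1// => l _; rewrite mderivC mulr0. Qed.

Lemma sl_deriv0 m : sl_deriv (0 : tpow m) = 0.
Proof. by have := sl_derivC m 0; rewrite mpolyC0. Qed.

Lemma sl_deriv1 m : sl_deriv (1 : tpow m) = 0.
Proof. by have := sl_derivC m 1; rewrite mpolyC1. Qed.

Lemma sl_derivD m (P Q : tpow m) : sl_deriv (P + Q) = sl_deriv P + sl_deriv Q.
Proof.
rewrite /sl_deriv -big_split; apply: eq_bigr => i _ /=.
by rewrite -big_split; apply: eq_bigr => c _; rewrite mderivD mulrDr.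
Qed.

Lemma sl_derivM m (P Q : tpow m) : sl_deriv (P * Q) = sl_deriv P * Q + P * sl_deriv Q.
Proof.
rewrite /sl_deriv mulr_suml mulr_sumr -big_split; apply: eq_bigr => i _ /=.
rewrite mulr_suml mulr_sumr -big_split; apply: eq_bigr => c _ /=.
by rewrite mderivM mulrDr mulrA [X in _ + X]mulrCA.
Qed.

Lemma sl_derivX m (i : 'I_m) c :
  sl_deriv (slotX i c : tpow m) = sprot (H m) (slotX i) c.
Proof.
rewrite /sl_deriv (bigD1 i)//= (bigD1 c)//= [X in _ + X + _]big1 ?addr0; last first.
  move=> c' /negPf c'c; rewrite mderivX mnm1E mxvec_index_eq eqxx /= eq_sym c'c.
  by rewrite scale0r mulr0.
rewrite big1 ?addr0 => [|i' /negPf i'i]; last first.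
  rewrite big1// => c' _; rewrite mderivX mnm1E mxvec_index_eq eq_sym i'i.
  by rewrite scale0r mulr0.
rewrite mderivX mnm1E eqxx scale1r (_ : (_ - _)%MM = 0%MM) ?mpolyX0 ?mulr1//.
by apply/mnmP => k; rewrite mnmBE mnm0E subnn.
Qed.

Lemma sl_derivB m (P Q : tpow m) : sl_deriv (P - Q) = sl_deriv P - sl_deriv Q.
Proof.
rewrite sl_derivD; congr (_ + _); apply: (addrI (sl_deriv Q)).
by rewrite -sl_derivD !subrr sl_deriv0.
Qed.

Lemma sl_deriv_wsym m (i j : 'I_m) : sl_deriv (wsym eps i j : tpow m) = 0.
Proof.
rewrite /wsym sl_derivM sl_derivC mul0r add0r.
rewrite (_ : sl_deriv _ = 0) ?mulr0//.
rewrite -(sprot_symp (slotX i) (slotX j : 'I_d -> tpow m) (@HC m)) /symp -big_split /=.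
rewrite (big_morph (@sl_deriv m) (@sl_derivD m) (sl_deriv0 m)); apply: eq_bigr => r _.
rewrite sl_derivB !sl_derivM !sl_derivX.
set A := slotX i _ * _; set B := slotX i _ * _.
by rewrite opprD addrACA.
Qed.

(** Jacobi's formula and the adjugate turn the derivation into multiplication by a trace, whose
    entries at (p_r, q_r) and (q_r, p_r) cancel by the symmetry of H. *)
Lemma sl_deriv_detsym : sl_deriv (detsym K n) = 0.
Proof.
rewrite /detsym; set A := \matrix_(k, l) _.
have AE k l : A k l = slotX (lift ord0 k) l by rewrite mxE.
clearbody A.
rewrite derivation_det; [|exact: sl_deriv0|exact: sl_deriv1|exact: sl_derivD|exact: sl_derivM].
have trE l c : \sum_k A k l * cofactor A k c = (c == l)%:R * \det A.
  have := congr1 (fun B : 'M_d => B c l) (mul_adj_mx A).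
  rewrite !mxE mulr_natl => <-; apply: eq_bigr => k _.
  by rewrite ?mxE mulrC.
transitivity (\sum_c \sum_(r < n) (H _ (pidx r) c * ((c == qidx r)%:R * \det A)
   - H _ (qidx r) c * ((c == pidx r)%:R * \det A))).
  rewrite exchange_big; apply: eq_bigr => c _ /=.
  under eq_bigr => k _ do rewrite AE sl_derivX /sprot mulr_suml.
  rewrite exchange_big; apply: eq_bigr => r _ /=; rewrite -!trE !mulr_sumr -sumrB.
  by apply: eq_bigr => k _; rewrite mulrBl -!mulrA !AE.
rewrite exchange_big big1// => r _ /=; rewrite sumrB (bigD1 (qidx r))//=.
rewrite [X in _ - X](bigD1 (pidx r))//= !eqxx !mul1r.
rewrite big1 ?addr0 => [|c /negPf ->]; last by rewrite mul0r mulr0.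
rewrite big1 ?addr0 => [|c /negPf ->]; last by rewrite mul0r mulr0.
by rewrite HC subrr.
Qed.

Lemma sl_deriv_tausym M : sl_deriv (tausym eps n M) = 0.
Proof.
rewrite /tausym sl_derivM sl_deriv_detsym mulr0 addr0.
(* The kernel of the derivation is a subring, used as a filtration constant in k. *)
pose G (k : nat) (P : tpow d.+1) := sl_deriv P = 0.
have G0 k : G k 0 by exact: sl_deriv0.
have GD k P Q : G k P -> G k Q -> G k (P + Q).
  by rewrite /G sl_derivD => -> ->; rewrite addr0.
have GM k l P Q : G k P -> G l Q -> G (k + l)%N (P * Q).
  by rewrite /G sl_derivM => -> ->; rewrite mul0r mulr0 addr0.
have G1 : G 0 1 by exact: sl_deriv1.
rewrite [X in X * _](_ : _ = 0) ?mul0r//.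
apply: (coefs_simplex_int (G := G) G0 GD GM G1 (k := 0)) => [j|]; first exact: sl_derivC.
apply: (coefs_texp (G := G)) => //; first by move=> k; exact: sl_derivC.
rewrite XpolE; apply: (coefs_sum (G := G)) => // i _.
apply: (coefs_sum (G := G)) => // j _ u; rewrite mulrC mul_mpolyC mcoeffZ.
rewrite /G sl_derivM sl_deriv_wsym mul0r add0r.
by have [c ->] := mcoeff_Xcoef K (d.+1 * d) i j u; rewrite sl_derivC mulr0.
Qed.

(** [x, .] is a combination of operators that differentiate once and multiply by a variable; their
    transposes multiply the symbol by a variable and differentiate it, and add up to [sl_deriv]. *)
Lemma tau_sp_invariant (a : 'I_d.+1 -> weyl K n) :
  \sum_i tau (tens (upd a i (bracket eps x (a i)))) = 0.
Proof.
pose t i := tens (upd a i (bracket eps x (a i))).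
pose M := \max_i msize (t i).
have tM i : (msize (t i) <= M)%N by exact: (leq_bigmax i).
rewrite (eq_bigr (fun i => sympair (tausym eps n M) (t i))) => [|i _]; last by rewrite -(tauE eps emb (tM i)).
pose P := tausym eps n M.
rewrite -[RHS](sympair0 (tens a)) -(sl_deriv_tausym M) /sl_deriv sympair_sum.
apply: eq_bigr => i _; rewrite -/P.
pose Rst : tpow d.+1 := \prod_(k | k != i) mren (mxvec_index k) (a k).
have LE z : tens (upd a i z) = mren (mxvec_index i) z * Rst.
  rewrite tensE (bigD1 i isT) {1}/upd eqxx; congr (_ * _).
  by apply: eq_bigr => k /negPf ki; rewrite /upd ki.
have LX c l : tens (upd a i ('X_c * (a i)^`M(l))) = slotX i c * tderiv i l (tens a).
  by rewrite tderiv_tens !LE mrenM mrenXU mulrA.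
have LB y z : tens (upd a i (y - z)) = tens (upd a i y) - tens (upd a i z).
  by rewrite !LE raddfB mulrBl.
have LZ c y : tens (upd a i (c *: y)) = c *: tens (upd a i y).
  by rewrite !LE linearZ scalerAl.
have Lsum (I : finType) (F : I -> weyl K n) :
    tens (upd a i (\sum_j F j)) = \sum_j tens (upd a i (F j)).
  by rewrite LE raddf_sum mulr_suml; apply: eq_bigr => j _; rewrite LE.
have Lq l l' : tens (upd a i (x^`M(l) * (a i)^`M(l'))) =
    \sum_c hess x l c *: (slotX i c * tderiv i l' (tens a)).
  rewrite (quadratic_mderiv l xq) mulr_suml Lsum; apply: eq_bigr => c _.
  by rewrite -scalerAl LZ LX.
have Pq l l' : sympair P (tens (upd a i (x^`M(l) * (a i)^`M(l')))) =
    \sum_c sympair (H _ l c * slotX i l' * P^`M(mxvec_index i c)) (tens a).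
  rewrite Lq raddf_sum; apply: eq_bigr => c _ /=.
  rewrite linearZ /= sympair_mulX /tderiv -(dopXU (mxvec_index i l') (tens a)).
  by rewrite sympair_dop -sympairZ -mulrA [P^`M(_) * _]mulrC.
rewrite /t (bracketE emb epsU _ xq) Lsum raddf_sum.
rewrite [RHS](_ : _ = \sum_c \sum_(r < n)
   sympair ((H _ (pidx r) c * slotX i (qidx r) - H _ (qidx r) c * slotX i (pidx r))
     * P^`M(mxvec_index i c)) (tens a)); last first.
  rewrite sympair_sum; apply: eq_bigr => c _; rewrite /sprot mulr_suml.
  by rewrite sympair_sum.
rewrite exchange_big; apply: eq_bigr => r _ /=.
rewrite LB raddfB /= !Pq -sumrB; apply: eq_bigr => c _.
by rewrite -sympairB mulrBl.
Qed.

End SpInvariance.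

(** * Insertion of a quadratic element *)

Section Insertion.
Variables (S : comNzRingType) (iw fi : nat -> S).
Hypothesis iwK : forall k, (0 < k)%N -> k%:R * iw k = 1.
Hypothesis fiK : forall k, k`!%:R * fi k = 1.
Local Notation fiu e := (fun k => (fi k)%:MP_[e]).

Lemma sface_Xcoef e j k l : (k <= e.+1)%N -> (l <= e.+1)%N ->
  sface j (Xcoef S e.+1 k l) = Xcoef S e (if (k <= j)%N then k else k.-1)
                                         (if (l <= j)%N then l else l.-1).
Proof.
move=> ke le_; rewrite /Xcoef rmorphD rmorphB !rmorphM /= !sface_spt//.
by rewrite rmorph1 rmorph_nat.
Qed.

Definition Xrest e q (W : 'I_q -> 'I_q -> S) (i : 'I_q.+1) : {mpoly S[e]} :=
  \sum_(s < q) \sum_(s' < q | (s < s')%N) Xcoef S e (lift i s) (lift i s') * (W s s')%:MP.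

Definition Xins e q (w : 'I_q -> S) (i : 'I_q.+1) : {mpoly S[e]} :=
  \sum_(s < q) (if (s < i)%N then Xcoef S e (lift i s) i else - Xcoef S e i (lift i s))
    * (w s)%:MP.

(* The coefficient of each w_s is, as a function of the inserted point, a
   Bernoulli polynomial of degree 1 centered at the point s; its primitives on
   the pieces cut out by the other points glue to a periodic function, so
   that Stokes' theorem gives a telescoping sum with no boundary term. *)
Lemma insertion_sum q (W : 'I_q -> 'I_q -> S) (w : 'I_q -> S) M : (0 < q)%N ->
  \sum_(i < q.+1 | i != ord0)
    simplex_int iw (texp (fiu q) M (Xrest q W i) * Xins q w i) = 0.
Proof.
case: q W w => // e W w _; case: M => [|M].
  by rewrite big1// => i _; rewrite /texp big_ord0 mul0r raddf0.
pose U k := spt S e.+1 k; pose V k := spt S e k.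
(* The exponential without the inserted point, common to all faces that merge this point with a
   neighbour. *)
pose TX : {mpoly S[e]} := texp (fiu e) M.+1
  (\sum_(s < e.+1) \sum_(s' < e.+1 | (s < s')%N) Xcoef S e s s' * (W s s')%:MP).
pose Q (j i : nat) : {mpoly S[e]} := \sum_(s < e.+1)
  (- (V s - V j) ^+ 2 + (if (s < i)%N then V j - V s else V s - V j)) * (w s)%:MP.
(* For each s this is x - x^2, x being the distance to the inserted point; its symmetry under x -> 1
   - x gives equal values at 0 and 1. *)
pose Hp (i : 'I_e.+2) : {mpoly S[e.+1]} := \sum_(s < e.+1)
  (- (U (lift i s) - U i) ^+ 2
   + (if (s < i)%N then U i - U (lift i s) else U (lift i s) - U i)) * (w s)%:MP.
pose F (i : 'I_e.+2) := texp (fiu e.+1) M.+1 (Xrest e.+1 W i) * Hp i.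
have leU (i : 'I_e.+2) : (i <= e.+1)%N by rewrite -ltnS.
have leB (i : 'I_e.+2) (s : 'I_e.+1) : (bump i s <= e.+1)%N by exact: (leU (lift i s)).
have FE (i : 'I_e.+2) j : (j <= i)%N -> (i <= j.+1)%N ->
    sface j (F i) = TX * Q (if (i <= j)%N then i : nat else i.-1) i.
  move=> ji ij; rewrite /F rmorphM /=.
  have lE (s : 'I_e.+1) : (if (lift i s <= j)%N then lift i s : nat else (lift i s).-1) = s.
    by rewrite /= /bump; case: (leqP i s) => si; case: leqP; lia.
  congr (_ * _).
    rewrite (rmorph_texp (f := @sface _ e j) (fiB := fiu e)) => [|k]; last exact: sfaceC.
    congr texp; rewrite /Xrest raddf_sum; apply: eq_bigr => s _.
    rewrite raddf_sum; apply: eq_bigr => s' _ /=.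
    rewrite rmorphM /= sface_Xcoef ?leB//.
    by rewrite sfaceC [if (bump i s <= _)%N then _ else _]lE [if (bump i s' <= _)%N then _ else _]lE.
  rewrite /Hp /Q; rewrite raddf_sum; apply: eq_bigr => s _ /=.
  rewrite rmorphM rmorphD rmorphN rmorphXn rmorphB /= /U !sface_spt ?leU// sfaceC lE.
  congr ((_ + _) * _); by case: ifP => _; rewrite rmorphB /= !sface_spt ?leU// lE.
(* Only the branch of the term s = i changes, and both branches vanish there. *)
have QQ i : Q i i.+1 = Q i i.
  apply: eq_bigr => s _; congr ((_ + _) * _); rewrite ltnS leq_eqVlt.
  by case: eqVneq => [->|_] //=; rewrite ltnn subrr.
have dF (k : 'I_e.+1) : (F (lift ord0 k))^`M(k) =
    texp (fiu e.+1) M.+1 (Xrest e.+1 W (lift ord0 k)) * Xins e.+1 w (lift ord0 k).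
  set i := lift ord0 k; have iE : i = k.+1 :> nat by [].
  have dU s : (U (lift i s))^`M(k) = 0.
    rewrite mderiv_spt ?leU// -iE; case: eqP => // E; have := neq_lift i s.
    by rewrite eq_sym => /eqP[]; exact: val_inj.
  have dUi : (U i)^`M(k) = 1 by rewrite mderiv_spt ?leU// iE eqxx.
  rewrite /F mderivM (mderiv_texp fiK).
  have -> : (Xrest e.+1 W i)^`M(k) = 0.
    rewrite /Xrest raddf_sum big1// => s _; rewrite raddf_sum big1// => s' _ /=.
    rewrite mderivM mderivC mulr0 addr0.
    have dn (r : 'I_e.+1) : ((lift i r : nat) == k.+1) = false.
      by rewrite -iE; apply/negbTE; rewrite eq_sym; exact: (neq_lift i r).
    by rewrite (mderiv_Xcoef _ _ (leU (lift i s)) (leU (lift i s'))) (dn s) (dn s') subrr mulr0 mul0r.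
  rewrite mulr0 mul0r add0r; congr (_ * _).
  rewrite /Hp /Xins raddf_sum; apply: eq_bigr => s _ /=.
  rewrite mderivM mderivC mulr0 addr0; congr (_ * _).
  rewrite mderivD mderivN expr2 mderivM mderivB dU dUi sub0r.
  case: ifP => _; rewrite ?mderivB ?dU ?dUi /Xcoef /U /=; by ring.
rewrite big_mkcond big_ord_recl eqxx [LHS]add0r.
transitivity (\sum_(k < e.+1) (simplex_int iw (TX * Q k.+1 k.+1) - simplex_int iw (TX * Q k k))).
  apply: eq_bigr => k _; rewrite -dF (simplex_stokes iwK).
  rewrite !FE; try by rewrite /= /bump leq0n add1n.
  by rewrite /= /bump leq0n add1n leqnn ltnn /= QQ.
rewrite -(big_mkord xpredT (fun k => simplex_int iw (TX * Q k.+1 k.+1) - simplex_int iw (TX * Q k k))).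
rewrite (telescope_sumr (fun k => simplex_int iw (TX * Q k k)))//.
rewrite (_ : Q e.+1 e.+1 = Q 0 0)%N ?subrr//; apply: eq_bigr => s _.
congr (_ * _); rewrite ltn_ord ltn0 /V spt_last /=.
by ring.
Qed.

End Insertion.

(* slot 0 goes to i, and the slots 1, ..., q to those other than i, in order *)
Definition insslot q (i s : 'I_q.+1) : 'I_q.+1 :=
  if unlift ord0 s is Some r then lift i r else i.

Lemma insslot0 q (i : 'I_q.+1) : insslot i ord0 = i.
Proof. by rewrite /insslot unlift_none. Qed.

Lemma insslotS q (i : 'I_q.+1) (r : 'I_q) : insslot i (lift ord0 r) = lift i r.
Proof. by rewrite /insslot liftK. Qed.

Lemma insslot_inj q (i : 'I_q.+1) : injective (insslot i).
Proof.
move=> s s'; case: (unliftP ord0 s) => [r|] ->; case: (unliftP ord0 s') => [r'|] ->;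
  rewrite ?insslotS ?insslot0//.
- by move/lift_inj => ->.
- by move=> E; have := neq_lift i r; rewrite E eqxx.
- by move=> E; have := neq_lift i r'; rewrite -E eqxx.
Qed.

Lemma Xpol_insslot (S : comNzRingType) e q (W : 'I_q.+1 -> 'I_q.+1 -> S) i :
  (forall s s', W s' s = - W s s') ->
  Xpol e (fun j j' => \sum_(s | insslot i s == j) \sum_(s' | insslot i s' == j') W s s')
  = Xrest e (fun r r' => W (lift ord0 r) (lift ord0 r')) i
    + Xins e (fun r => W (lift ord0 r) ord0) i.
Proof.
move=> WC; rewrite Xpol_pull big_ord_recl /= insslot0.
have lt_lift (r r' : 'I_q) : (lift i r < lift i r')%N = (r < r')%N.
  by rewrite /= /bump; case: (leqP i r); case: (leqP i r'); lia.
have lt_lift_i (r : 'I_q) : (lift i r < i)%N = (r < i)%N.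
  by rewrite /= /bump; case: (leqP i r); lia.
have lt_i_lift (r : 'I_q) : (i < lift i r)%N = ~~ (r < i)%N.
  by rewrite /= /bump -leqNgt; case: (leqP i r); lia.
rewrite big_mkcond big_ord_recl insslot0 ltnn [X in X + _]add0r.
rewrite (eq_bigr (fun r : 'I_q => (if (r < i)%N then 0 else
   - Xcoef S e i (lift i r)) * (W (lift ord0 r) ord0)%:MP)); last first.
  move=> r _; rewrite insslotS lt_i_lift; case: (_ < _)%N => /=; first by rewrite mul0r.
  by rewrite WC mpolyCN mulrN mulNr.
rewrite [X in _ + X](eq_bigr (fun r : 'I_q =>
   (if (r < i)%N then Xcoef S e (lift i r) i else 0) * (W (lift ord0 r) ord0)%:MP
   + \sum_(r' < q | (r < r')%N) Xcoef S e (lift i r) (lift i r')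
       * (W (lift ord0 r) (lift ord0 r'))%:MP)); last first.
  move=> r _; rewrite insslotS big_mkcond big_ord_recl insslot0 lt_lift_i.
  congr (_ + _); first by case: ifP; rewrite ?mul0r.
  by rewrite [RHS]big_mkcond; apply: eq_bigr => r' _; rewrite insslotS lt_lift.
rewrite big_split /= addrA [RHS]addrC; congr (_ + _); rewrite -big_split.
by apply: eq_bigr => r _ /=; rewrite -mulrDl; case: ifP; rewrite ?add0r ?addr0.
Qed.

Lemma coefs_Xrest (S : comNzRingType) (Q : S -> Prop) e q
    (W : 'I_q -> 'I_q -> S) i :
  Q 0 -> (forall x y, Q x -> Q y -> Q (x + y)) ->
  (forall r r' k l u, Q (W r r' * (Xcoef S e k l)@_u)) -> coefs Q (Xrest e W i).
Proof.
move=> Q0 QD QW; apply: (coefs_sum (G := fun=> Q) _ _ (k := 0)) => // r _.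
apply: (coefs_sum (G := fun=> Q) _ _ (k := 0)) => // r' _ u.
by rewrite mulrC mul_mpolyC mcoeffZ.
Qed.

Lemma coefs_Xins (S : comNzRingType) (Q : S -> Prop) e q (w : 'I_q -> S) i :
  Q 0 -> (forall x y, Q x -> Q y -> Q (x + y)) ->
  (forall r c, Q (w r * c)) -> coefs Q (Xins e w i).
Proof.
move=> Q0 QD Qw; apply: (coefs_sum (G := fun=> Q) _ _ (k := 0)) => // r _ u.
by rewrite mulrC mul_mpolyC mcoeffZ.
Qed.

(** Expansion along the row of the inserted slot, which has index 0. Index 1 belongs to the first
    argument, absent from the determinant, so the other rows carry the indices 2, 3, ... in order
    whatever i is, and only the sign depends on i. *)
Lemma det_insert (A : comNzRingType) q (y : 'I_q.+1 -> 'I_q -> A) (B : 'M[A]_q) (i : 'I_q) :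
  (forall k l, B k l =
     y (if k == i then ord0 else inord (if (k < i)%N then k.+2 else k.+1)) l) ->
  \det B = (-1) ^+ i * \sum_l y ord0 l
    * ((-1) ^+ l * \det (\matrix_(k < q.-1, c < q.-1) y (inord k.+2) (lift l c))).
Proof.
move=> BE; rewrite (expand_det_row B i) mulr_sumr; apply: eq_bigr => l _.
rewrite BE eqxx [RHS]mulrCA; congr (_ * _); rewrite /cofactor exprD -mulrA.
congr (_ * (_ * \det _)); apply/matrixP => k c; rewrite !mxE BE.
rewrite eq_sym (negPf (neq_lift _ _)); congr (y (inord _) _).
by rewrite /= /bump; case: (leqP i k) => ik; case: ifP; lia.
Qed.

(** * The cochain with a quadratic argument inserted *)

Section InsertedQuadratic.
Variables (K : comUnitRingType) (eps : K) (n : nat).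
Variables (R : realType) (emb : {rmorphism R -> K}).
Local Notation d := (2 * n)%N.
Local Notation tpow := (tpow K n).
Local Notation tau := (tau eps emb).

Lemma tens_ins m (a : 'I_m -> weyl K n) i x :
  tens (ins a i x) = tren (insslot i) (tens (ins a ord0 x)).
Proof.
rewrite tren_tens; congr tens; apply/funext => k; rewrite /ins.
case: (unliftP i k) => [r ->|->] /=.
  rewrite (big_pred1 (lift ord0 r)) ?liftK// => s.
  by rewrite -insslotS (inj_eq (@insslot_inj _ _)).
rewrite (big_pred1 ord0) ?unlift_none// => s.
by rewrite -[X in _ == X]insslot0 (inj_eq (@insslot_inj _ _)).
Qed.

Definition ins_det : tpow d.+1 := \sum_l slotX ord0 l
  * ((-1) ^+ l * \det (\matrix_(k < d.-1, c < d.-1) slotX (inord k.+2) (lift l c))).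

Lemma trdual_insslot_detsym (i : 'I_d) :
  trdual (insslot (lift ord0 i)) (detsym K n) = (-1) ^+ i * ins_det.
Proof.
rewrite /detsym -det_map_mx; apply: (det_insert (y := slotX)) => k l.
rewrite !mxE; transitivity (\sum_(s | insslot (lift ord0 i) s == lift ord0 k) slotX s l : tpow d.+1).
  exact: trdual_slotX.
apply: big_pred1 => s.
rewrite -[RHS](inj_eq (@insslot_inj _ (lift ord0 i))); congr (_ == _).
case: eqVneq => [->|ki]; first by rewrite insslot0.
have kd := ltn_ord k; have id_ := ltn_ord i.
have ki' : (k : nat) <> i by move=> E; case/eqP: ki; exact: val_inj.
pose r0 := if (k < i)%N then k.+1 else (k : nat).
have r0d : (r0 < d)%N by rewrite /r0; case: ifP; lia.
have -> : inord (if (k < i)%N then k.+2 else k.+1) = lift ord0 (Ordinal r0d) :> 'I_d.+1.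
  apply: val_inj; rewrite [RHS]lift0 /= inordK /r0; first by case: ifP.
  by case: ifP; lia.
rewrite insslotS; apply: val_inj; rewrite /= /bump !leq0n !add1n /r0.
by case: ifP; lia.
Qed.

Lemma slot_wt_det m (s : 'I_m) q (A : 'M[tpow m]_q) :
  (forall k c, slot_wt s 0 (A k c)) -> slot_wt s 0 (\det A).
Proof.
move=> A0; rewrite /determinant; elim/big_ind: _ => [|P Q|p _].
- exact: slot_wt0.
- exact: slot_wtD.
apply: (@slot_wtM _ _ _ s 0 0).
  by rewrite -[_ ^+ _](rmorph_sign (@mpolyC _ K)); exact: slot_wtC.
elim/big_ind: _ => [|P Q|k _]; [exact: slot_wt1|exact: (@slot_wtM _ _ _ s 0 0)|exact: A0].
Qed.

Lemma slot_wt_ins_det : slot_wt ord0 1 ins_det.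
Proof.
rewrite /ins_det; elim/big_ind: _ => [|P Q|l _]; [exact: slot_wt0|exact: slot_wtD|].
apply: (@slot_wtM _ _ _ ord0 1 0).
  by have := @slot_wtX K n _ (ord0 : 'I_d.+1) ord0 l; rewrite eqxx.
apply: (@slot_wtM _ _ _ ord0 0 0).
  by rewrite -[_ ^+ _](rmorph_sign (@mpolyC _ K)); exact: slot_wtC.
apply: slot_wt_det => k c; rewrite mxE.
have := @slot_wtX K n _ (ord0 : 'I_d.+1) (inord k.+2) (lift l c).
rewrite -val_eqE /= inordK//; have := ltn_ord k; lia.
Qed.

Definition slot_ge m (s : 'I_m) k (P : tpow m) :=
  supp_in (fun u => k <= mdeg (slot_mnm u s))%N P.

Lemma slot_geM m (s : 'I_m) k l P Q :
  slot_ge s k P -> slot_ge s l Q -> slot_ge s (k + l)%N (P * Q).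
Proof. by apply: supp_inM => u v uk vl; rewrite slot_mnmD mdegD leq_add. Qed.

Lemma slot_wt_ge m (s : 'I_m) k P : slot_wt s k P -> slot_ge s k P.
Proof. by apply: supp_inS => u /eqP ->. Qed.

Lemma tau_insert x (a : 'I_d -> weyl K n) : (0 < n)%N -> quadratic x ->
  \sum_(i < d.+1 | i != ord0) (-1) ^+ i * tau (tens (ins a i x)) = 0.
Proof.
move=> n0 xq; pose b := ins a ord0 x.
have b0 : b ord0 = x by rewrite /b /ins unlift_none.
(* Two more orders make room for the terms 1 and Z of the exponential. *)
pose M0 := maxn (msize (tens b)) (\max_i msize (tens (ins a i x))); pose M := M0.+2.
have M0M : (M0 <= M)%N by exact: leqW.
have bM : (msize (tens b) <= M)%N by exact: leq_trans (leq_maxl _ _) M0M.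
have aM i : (msize (tens (ins a i x)) <= M)%N.
  apply: leq_trans M0M; apply: leq_trans (leq_maxr _ _).
  exact: (leq_bigmax i).
pose W (r r' : 'I_d) : tpow d.+1 := wsym eps (lift ord0 r) (lift ord0 r').
pose w (r : 'I_d) : tpow d.+1 := wsym eps (lift ord0 r) ord0.
pose X i : {mpoly (tpow d.+1)[d]} := Xrest d W i.
pose Z i : {mpoly (tpow d.+1)[d]} := Xins d w i.
pose fi := ifact K (d.+1 * d).
pose I := simplex_int (inat K (d.+1 * d)) (d := d).
pose E : {mpoly (tpow d.+1)[d]} -> {mpoly (tpow d.+1)[d]} := texp (fun k => (fi k)%:MP) M.
pose J F := sympair (I F * ins_det) (tens b).
have JD F F' : J (F + F') = J F + J F' by rewrite /J /I simplex_intD mulrDl sympairD.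
have nU := natU emb.
have fiK k : k`!%:R * fi k = 1 by exact: ifactK.
(* [ins_det] differentiates slot 0 exactly once, and x has no linear part. *)
have kill0 F : coefs (slot_wt ord0 0) F -> J F = 0.
  move=> F0; apply: (@sympair_slot _ _ _ b ord0 (pred1 1%N)); last first.
    by move=> v /eqP v1; apply/eqP; rewrite b0; apply: contraT => /xq; rewrite v1.
  apply: (@slot_wtM _ _ _ ord0 0 1); last exact: slot_wt_ins_det.
  apply: (coefs_simplex_int (G := fun=> @slot_wt K n _ ord0 0) _ _ _ _ (k := 0%N)) => //.
  - by move=> _; exact: slot_wt0.
  - by move=> _ P Q; exact: slot_wtD.
  - by move=> _ _ P Q; exact: (@slot_wtM _ _ _ ord0 0 0).
  - exact: slot_wt1.
  - by move=> j; exact: slot_wtC.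
(* Together with [ins_det] this differentiates x at least three times. *)
have kill2 F : coefs (slot_ge ord0 2) F -> J F = 0.
  move=> F2; apply: (@sympair_slot _ _ _ b ord0 (fun k => 2 < k)%N); last first.
    by move=> v v3; apply/eqP; rewrite b0; apply: contraT => /xq /eqP v2; rewrite v2 in v3.
  apply: (@slot_geM _ ord0 2 1); last exact/slot_wt_ge/slot_wt_ins_det.
  apply: (coefs_simplex_int (G := @slot_ge _ ord0) _ _ _ _ (k := 2%N)) => //.
  - by move=> k; exact: supp_in0.
  - by move=> k P Q; exact: supp_inD.
  - by move=> k l P Q; exact: slot_geM.
have X1 i : coefs (@ord_ge K (d.+1 * d) 1) (X i).
  apply: coefs_Xrest => [|P Q|r r' k l u]; [exact: supp_in0|exact: supp_inD|].
  by apply: ord_geMr; exact: ord_wsym.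
have Z1 i : coefs (@ord_ge K (d.+1 * d) 1) (Z i).
  apply: coefs_Xins => [|P Q|r c]; [exact: supp_in0|exact: supp_inD|].
  by apply: ord_geMr; exact: ord_wsym.
have EX0 i : coefs (slot_wt ord0 0) (E (X i)).
  apply: (coefs_texp (G := fun=> @slot_wt K n _ ord0 0)) => //.
  - by move=> k; exact: slot_wtC.
  - by move=> _; exact: slot_wt0.
  - exact: slot_wt1.
  - by move=> _ P Q; exact: slot_wtD.
  - by move=> _ _ P Q; exact: (@slot_wtM _ _ _ ord0 0 0).
  apply: coefs_Xrest => [|P Q|r r' k l u]; [exact: slot_wt0|exact: slot_wtD|].
  apply: (@slot_wtM _ _ _ ord0 0 0); first exact: (@slot_wt_wsym _ _ _ _ ord0).
  by have [c ->] := mcoeff_Xcoef K (d.+1 * d) k l u; exact: slot_wtC.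
have Zge1 i : coefs (slot_ge ord0 1) (Z i).
  apply: coefs_Xins => [|P Q|r c]; [exact: supp_in0|exact: supp_inD|].
  apply: (@slot_geM _ ord0 1 0) => //.
  exact/slot_wt_ge/(@slot_wt_wsym _ _ _ _ ord0).
have JE i : J (E (X i + Z i)) = J (E (X i) * Z i).
  transitivity (J (E (X i) * E (Z i))).
    exact/esym/(sympair_texpM emb ins_det bM (X1 i) (Z1 i)).
  have -> : E (Z i) = 1 + Z i + \sum_(j < M0) (fi j.+2)%:MP * Z i ^+ j.+2.
    apply: texp_split => k; by rewrite -mpolyC_nat -mpolyCM fiK mpolyC1.
  rewrite !mulrDr mulr1 !JD (kill0 _ (EX0 i)) add0r [X in _ + X]kill2 ?addr0//.
  pose G k := @slot_ge d.+1 ord0 k.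
  have G0 k : G k 0 by exact: supp_in0.
  have GD k P Q : G k P -> G k Q -> G k (P + Q) by exact: supp_inD.
  have GM k l P Q : G k P -> G l Q -> G (k + l)%N (P * Q) by exact: slot_geM.
  have H0 : coefs (G 0%N) (E (X i)) by [].
  have H2 : coefs (G 2%N) (\sum_(j < M0) (fi j.+2)%:MP * Z i ^+ j.+2); last first.
    exact: (coefsM G0 GD GM H0 H2).
  apply: (coefs_sum (G := G) G0 GD) => j _ u.
  have Gfi k : G 0%N (fi k) by [].
  have G1 : G 0%N 1 by [].
  have := coefs_texp_term Gfi G0 G1 GD GM j.+2 (Zge1 i) u.
  by rewrite muln1; apply: supp_inS => v; exact: leq_trans.
have step (i : 'I_d) : (-1) ^+ (lift ord0 i) * tau (tens (ins a (lift ord0 i) x))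
    = - J (E (X (lift ord0 i)) * Z (lift ord0 i)).
  have tM := aM (lift ord0 i); rewrite (tauE eps emb tM) tens_ins sympair_tren.
  rewrite trdual_tausym Xpol_insslot; last by move=> s s'; exact: wsymC.
  rewrite trdual_insslot_detsym mulrCA -JE /J.
  have -> : (-1) ^+ i = ((-1) ^+ i)%:MP :> tpow d.+1 by rewrite rmorph_sign.
  (* The sign of the position and that of the moved row differ by one factor for every i, so the sum
     over i has no alternating sign left. *)
  have sgn : (-1) ^+ (lift ord0 i) * (-1) ^+ i = -1 :> K.
    by rewrite lift0 exprS -mulrA -expr2 sqrr_sign mulr1.
  by rewrite sympairZ mulrA sgn mulN1r.
rewrite (eq_bigr (fun i => - J (E (X i) * Z i))); last first.
  by move=> i; case: (unliftP ord0 i) => [j ->|-> //]; rewrite step.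
rewrite sumrN /J -sympair_sum -mulr_suml insertion_sum ?mul0r ?sympair0 ?oppr0//.
- by move=> k k0; exact: inatK.
- by rewrite muln_gt0.
Qed.

End InsertedQuadratic.

Section ConstR.
Variable R : realType.

Lemma constR_is_zmod_morphism : zmod_morphism (@constR R).
Proof.
move=> x y; apply: etrans (rmorphB (@lconst (complex R)) _ _).
by congr lconst; exact: rmorphB.
Qed.
Lemma constR_is_monoid_morphism : monoid_morphism (@constR R).
Proof.
split=> [|x y]; first exact: (rmorph1 (@lconst (complex R))).
apply: etrans (rmorphM (@lconst (complex R)) _ _).
by congr lconst; exact: rmorphM.
Qed.
HB.instance Definition _ :=
  GRing.isZmodMorphism.Build R (KC R) (@constR R) constR_is_zmod_morphism.
HB.instance Definition _ :=
  GRing.isMonoidMorphism.Build R (KC R) (@constR R) constR_is_monoid_morphism.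

End ConstR.

Lemma sp_quadratic (C : nzRingType) (K : comUnitRingType) (n : nat) (f : {rmorphism C -> K})
    (x : weyl K n) : sp f x -> quadratic x.
Proof.
case=> b /dhomogP b2 -> m; rewrite mcoeff_map_mpoly => bm.
have mb : m \in msupp b by rewrite mcoeff_msupp; apply: contraNneq bm => bm0; rewrite bm0 raddf0.
by rewrite (b2 m mb).
Qed.

Theorem theorem2p2 (R : realType) (n : nat) (hn : (0 < n)%N) :
  [/\ (* (i) *)
      [/\ forall (a : 'I_(2 * n).+1 -> weyl (KC R) n) (i : 'I_(2 * n).+1)
             (c : KC R),
             i != ord0 -> a i = c%:MP -> tau epsC (@constR R) (tens a) = 0,
          forall t : tpow (KC R) n (2 * n).+2,
            tau epsC (@constR R) (dHoch epsC t) = 0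
        & forall x : weyl (KC R) n, sp (@constC R) x ->
          forall a : 'I_(2 * n).+1 -> weyl (KC R) n,
            \sum_(i < (2 * n).+1)
              tau epsC (@constR R) (tens (upd a i (bracket epsC x (a i)))) = 0],
      (* (ii) *)
      tau epsC (@constR R) (c2n (KC R) n) = 1
    & (* (iii) *)
      forall x : weyl (KC R) n, sp (@constC R) x ->
      forall a : 'I_(2 * n) -> weyl (KC R) n,
        \sum_(i < (2 * n).+1 | i != ord0)
          (-1) ^+ i * tau epsC (@constR R) (tens (ins a i x)) = 0].
Proof.
pose emb : {rmorphism R -> KC R} := @constR R.
split; first split.
- exact: (tau_normalized epsC emb).
- exact: (tau_dHoch epsC emb).
- by move=> x /sp_quadratic xq a; exact: (tau_sp_invariant emb (leps_unit _) xq).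
- exact: (tau_c2n _ _ emb).
- by move=> x /sp_quadratic xq a; exact: (tau_insert _ emb).
Qed.
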